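(* Let $0<r_0<r<+\infty$, $1<k<+\infty$, and let $E\subset\overline D(r)$ be a $\lambda$-measurable subset. Let $F\not\equiv0$ be a meromorphic function on $\mathbb C$, let $f\not\equiv0$ be an entire function, and put $u:=\ln|f|$. Then $$\int_E\ln^+|F(z)|\,d\lambda(z)\le\frac{2k}{k-1}\bigl(T(kr,F)-N(r_0,F)\bigr)\,\lambda(E)\,\ln\frac{100kr^2}{\lambda(E)},$$ $$\int_E\bigl|\ln|f(z)|\bigr|\,d\lambda(z)\le\frac{3k}{k-1}\bigl(\ln^+M(kr,f)+m(r_0,1/f)\bigr)\,\lambda(E)\,\ln\frac{100kr^2}{\lambda(E)},$$ $$m^{[2]}(r,F)\le\frac{7k\ln(ek)}{k-1}\bigl(T(kr,F)-N(r_0,F)\bigr),$$ $$m^{[2]}(r,f)+m^{[2]}(r,1/f)\le\frac{11k\ln(ek)}{k-1}\bigl(\mathsf M_{u^+}(kr)+\mathsf C_{u^-}(r_0)\bigr).$$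
   Context: $\overline D(r)=\{z\in\mathbb C:|z|\le r\}$; $\lambda$ is planar Lebesgue measure on $\mathbb C$; $\ln^+x=\max\{0,\ln x\}$, and for extended-real $v$, $v^+=\sup\{0,v\}$, $v^-=(-v)^+$. When $\lambda(E)=0$, the expression $\lambda(E)\ln\frac{c}{\lambda(E)}$ is read as $0$. For a meromorphic function $F\not\equiv0$ on $\mathbb C$ and $t>0$: $M(t,F)=\sup\{|F(z)|:|z|=t\}$; $n(t,F)$ is the number of poles of $F$ in $\overline D(t)$ counted with multiplicity (for $t=0$, the multiplicity of the pole at $0$); $$m(t,F)=\frac1{2\pi}\int_0^{2\pi}\ln^+|F(te^{i\varphi})|\,d\varphi,\qquad N(t,F)=\int_0^t\frac{n(x,F)-n(0,F)}{x}\,dx+n(0,F)\ln t,$$ $T(t,F)=m(t,F)+N(t,F)$ is the Nevanlinna characteristic; and $$m^{[2]}(t,F)=\frac2{t^2}\int_0^t m(x,F)\,x\,dx$$ is the average of $\ln^+|F|$ over $\overline D(t)$. For a function $v$: $\mathsf M_v(t)=\sup_{|z|=t}v(z)$ and $\mathsf C_v(t)=\frac1{2\pi}\int_0^{2\pi}v(te^{i\varphi})\,d\varphi$. *)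

(* Defs.v *)
From HB Require Import structures.
From mathcomp Require Import all_boot all_order all_algebra.
From mathcomp Require Import complex.
From mathcomp Require Import all_classical all_reals all_analysis.

Set Implicit Arguments.
Unset Strict Implicit.
Unset Printing Implicit Defensive.

Import Order.TTheory GRing.Theory Num.Theory.
Import numFieldNormedType.Exports.

Local Open Scope classical_set_scope.
Local Open Scope ring_scope.

Section ComplexFunctions.
Context {R : realType}.
Local Notation C := (R[i])^o.

Implicit Types (z w : R[i]) (f g : R[i] -> R[i]).

(* The norm of the numDomainType [R[i]] takes its values in [R[i]]; [cmod] is
   the same modulus as an element of [R]. *)
Definition cmod z : R := Normc.normc z.

Definition cdisc (t : R) : set R[i] := [set z | cmod z <= t].

Definition ccircle (t : R) : set R[i] := [set z | cmod z = t].

(* The point t e^{i phi}. *)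
Definition polar (t phi : R) : R[i] := Complex (t * cos phi) (t * sin phi).

(* [R[i]^o] is [R[i]] as a normed module over itself, so [derivable] in the
   direction [1] is complex differentiability. *)
Definition holo_at f z := derivable (f : C -> C) (z : C) (1 : C).

Definition entire f := forall z, holo_at f z.

(* Functions to the Riemann sphere have type [R[i] -> option R[i]], where
   [None] is the point at infinity.  [pole_order F z n]: near [z],
   F(w) = g(w) / (w - z)^n with g holomorphic, and g(z) <> 0 if n > 0, in which
   case F(z) is infinity.  So n = 0 means that F is finite and holomorphic
   near z, and n > 0 that F has a pole of multiplicity n at z. *)
Definition pole_order (F : R[i] -> option R[i]) z (n : nat) :=
  exists g : R[i] -> R[i],
    [/\ (\forall w \near (z : C), holo_at g w),
        ((0 < n)%N -> g z <> 0) &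
        (\forall w \near (z : C),
          F w = if (w == z) && (0 < n)%N then None
                else Some (g w / (w - z) ^+ n))].

Definition meromorphic (F : R[i] -> option R[i]) :=
  forall z, exists n, pole_order F z n.

Definition pole_mult (F : R[i] -> option R[i]) z : nat :=
  xget 0%N [set n | pole_order F z n].

Definition to_sphere f : R[i] -> option R[i] := fun z => Some (f z).

Definition inv_sphere (F : R[i] -> option R[i]) : R[i] -> option R[i] :=
  fun z => match F z with
           | None => Some 0
           | Some w => if w == 0 then None else Some w^-1
           end.

Definition smod (x : option R[i]) : \bar R :=
  match x with None => +oo%E | Some w => (cmod w)%:E end.

End ComplexFunctions.

Section Nevanlinna.
Context {R : realType}.
Local Open Scope ereal_scope.

Implicit Types (F : R[i] -> option R[i]) (v : R[i] -> \bar R) (t : R).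

(* [lne 0 = -oo] and [lne +oo = +oo]. *)
Definition lnp (x : \bar R) : \bar R := maxe 0 (lne x).

Definition pospart v : R[i] -> \bar R := fun z => maxe 0 (v z).
Definition negpart v : R[i] -> \bar R := pospart (fun z => - v z).

Definition circ_sup v t : \bar R := ereal_sup (v @` ccircle t).

Definition circ_mean v t : \bar R :=
  ((2 * pi)^-1)%:E *
  \int[@lebesgue_measure R]_(phi in `[0%R, (2 * pi)%R]) v (polar t phi).

Definition max_mod t F : \bar R := circ_sup (fun z => smod (F z)) t.

Definition prox t F : \bar R := circ_mean (fun z => lnp (smod (F z))) t.

(* The multiplicity is 0 off the poles, so this sums over the poles in the
   closed disc; the sum is finite when F is meromorphic. *)
Definition npoles t F : \bar R :=
  \esum_(z in cdisc t) ((pole_mult F z)%:R%:E : \bar R).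

Definition Npoles t F : \bar R :=
  \int[@lebesgue_measure R]_(x in `]0%R, t])
     ((npoles x F - npoles 0 F) * (x^-1)%:E)
  + npoles 0 F * (ln t)%:E.

Definition nevT t F : \bar R := prox t F + Npoles t F.

Definition prox2 t F : \bar R :=
  (2 / t ^+ 2)%:E *
  \int[@lebesgue_measure R]_(x in `[0%R, t]) (prox x F * x%:E).

Definition lnmod (f : R[i] -> R[i]) : R[i] -> \bar R :=
  fun z => lne (cmod (f z))%:E.

End Nevanlinna.

Section PlanarMeasure.
Context {R : realType}.
Local Open Scope ereal_scope.

Definition plane_pt (p : R * R) : R[i] := Complex p.1 p.2.

(* The library's product measure lives on the Borel sets; its completion has
   all Lebesgue measurable sets of the plane as measurable sets. *)
Definition leb2 :=
  @completed_measure_extension _ _ R (@lebesgue_measure R \x @lebesgue_measure R).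
HB.instance Definition _ := Measure.on leb2.

Definition plane_measurable (E : set R[i]) :=
  ((@lebesgue_measure R \x @lebesgue_measure R)^*)%mu.-cara.-measurable
    (plane_pt @^-1` E).

Definition area (E : set R[i]) : \bar R := leb2 (plane_pt @^-1` E).

Definition plane_integral (E : set R[i]) (v : R[i] -> \bar R) : \bar R :=
  \int[leb2]_(p in plane_pt @^-1` E) v (plane_pt p).

(* s ln (c / s), read as 0 when s = 0. *)
Definition xlog (c : R) (s : \bar R) : \bar R :=
  if s == 0 then 0 else s * lne (c%:E / s).

End PlanarMeasure.

(* Main.v *)
Require Import Defs.
From mathcomp Require Import all_boot all_order all_algebra.
From mathcomp Require Import complex ring lra.
From mathcomp Require Import all_classical all_reals all_analysis.
From mathcomp Require Import measurable_realfun.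

Set Implicit Arguments.
Unset Strict Implicit.
Unset Printing Implicit Defensive.

Import Order.TTheory GRing.Theory Num.Theory.
Import numFieldNormedType.Exports.
Local Open Scope classical_set_scope.
Local Open Scope ring_scope.


(** The four estimates come from the Poisson-Jensen inequality
      ln^+|F(z)| <= C m(kr,F) + sum_b p_b G_b(z),   |z| <= r,
    where b runs over the poles in the disc of radius rho = kr, p_b is the
    multiplicity, G_b is the Green function of that disc and
    C = (k + 1) / (k - 1) bounds its Poisson kernel ([poisson_jensen_le]).  It is
    obtained by cancelling the poles with factors of modulus at most that of
    (z - b)^-1 on the boundary, and applying to the resulting holomorphic function
    the sub-mean-value property of ln|f|, transported to an arbitrary point by a
    disc automorphism ([submean_centre], [harnack_log]).

    Since N(kr,F) - N(r_0,F) is the sum of p_b (ln rho - ln max(r_0,|b|))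
    ([nevT_sub_Npoles]), it remains to bound averages of G_b by the weight
    ln rho - ln max(r,|b|) of b, up to a factor depending on k.  The mean of G_b
    over the circle of radius x is at most ln rho - ln max(x,|b|)
    ([cmean_greenT]), and integration in x gives the bound for m^[2]
    ([prox2_le]).  Over a set E, either b is so close to the outer circle that G_b
    is uniformly comparable to the weight, or the weight is bounded below and the
    integral of G_b is at most that of a logarithmic pole, which is largest, up to
    a constant, when E is a square centred at b with the same area
    ([green_majorant], [plane_integral_log_le]).

    For an entire function f, ln^+|f| is at most its maximum on the circle of
    radius kr, and 1/f is a meromorphic function whose characteristic is
    controlled by Jensen's formula ([jensen_le]); then |ln|f|| is the sum of
    ln^+|f| and ln^+|1/f|.

    The required complex analysis is derived from Goursat's argument for
    homotopies ([goursat]): it gives the Cauchy formula, the maximum principle and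
    the finite order of zeros.  The sub-mean-value inequality for ln|f| follows
    from the maximum principle for the product of the rotates of f by roots of
    unity.  In place of the measurability of functions built from F, the estimates
    use that the Lebesgue integral of a nonnegative function is a supremum over the
    simple functions below it, hence monotone on arbitrary functions
    ([ge0_le_integral_any]) and determined by truncations
    ([integral_le_trunc]). *)

(** * Modulus and complex differentiability *)

Section ComplexModulus.
Context {R : realType}.
Implicit Types z w : R[i].

Lemma cmod_ge0 z : 0 <= cmod z.
Proof. by case: z => a b; rewrite /cmod /= sqrtr_ge0. Qed.

Lemma cmod0 : cmod (0 : R[i]) = 0. Proof. exact: Normc.normc0. Qed.
Lemma cmod1 : cmod (1 : R[i]) = 1. Proof. exact: Normc.normc1. Qed.
Lemma cmodM z w : cmod (z * w) = cmod z * cmod w. Proof. exact: Normc.normcM. Qed.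
Lemma cmodV z : cmod z^-1 = (cmod z)^-1. Proof. exact: Normc.normcV. Qed.
Lemma cmodN z : cmod (- z) = cmod z. Proof. exact: normcN. Qed.
Lemma cmodD z w : cmod (z + w) <= cmod z + cmod w. Proof. exact: le_normcD. Qed.
Lemma cmodB z w : cmod (z - w) = cmod (w - z). Proof. by rewrite -cmodN opprB. Qed.
Lemma cmodX z n : cmod (z ^+ n) = cmod z ^+ n.
Proof. by elim: n => [|n IH]; rewrite ?expr0 ?cmod1// !exprS cmodM IH. Qed.
Lemma cmod_prod (I : Type) (s : seq I) (P : pred I) (h : I -> R[i]) :
  cmod (\prod_(i <- s | P i) h i) = \prod_(i <- s | P i) cmod (h i).
Proof. by apply: (big_morph _ cmodM cmod1). Qed.
Lemma cmod_eq0 z : (cmod z == 0) = (z == 0).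
Proof.
by apply/eqP/eqP => [/Normc.eq0_normc//|->]; exact: cmod0.
Qed.
Lemma cmod_gt0 z : (0 < cmod z) = (z != 0).
Proof. by rewrite lt_def cmod_ge0 andbT cmod_eq0. Qed.
Lemma cmod_sqr z : cmod z ^+ 2 = complex.Re z ^+ 2 + complex.Im z ^+ 2.
Proof. by case: z => a b; rewrite /cmod /= sqr_sqrtr// addr_ge0// sqr_ge0. Qed.
Lemma cmod_real (x : R) : cmod (Complex x 0) = `|x|.
Proof. by rewrite /cmod /= expr0n /= addr0 sqrtr_sqr. Qed.
Lemma cmod_conj z : cmod (conjc z) = cmod z.
Proof. by case: z => a b; rewrite /cmod /= sqrrN. Qed.
Lemma ge_cmod_Re z : `|complex.Re z| <= cmod z.
Proof.
by rewrite -(ler_pXn2r (n:=2))// ?nnegrE ?cmod_ge0// real_normK ?num_real// cmod_sqr lerDl sqr_ge0.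
Qed.
Lemma ge_cmod_Im z : `|complex.Im z| <= cmod z.
Proof.
by rewrite -(ler_pXn2r (n:=2))// ?nnegrE ?cmod_ge0// real_normK ?num_real// cmod_sqr lerDr sqr_ge0.
Qed.
Lemma cmod_le_ReIm z : cmod z <= `|complex.Re z| + `|complex.Im z|.
Proof.
rewrite -(ler_pXn2r (n:=2))// ?nnegrE ?cmod_ge0// cmod_sqr sqrrD !real_normK ?num_real//.
by rewrite -addrA lerD2l lerDr mulrn_wge0 ?mulr_ge0.
Qed.
Lemma normC_cmod z : `|z| = (real_complex R (cmod z)).
Proof. by []. Qed.
Lemma ler_distcmod z w : `|cmod z - cmod w| <= cmod (z - w).
Proof.
have h (a b : R[i]) : cmod a - cmod b <= cmod (a - b).
  by have := cmodD (a - b) b; rewrite subrK -lerBlDr.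
by rewrite ler_norml h andbT lerNl opprB cmodB h.
Qed.

End ComplexModulus.

Section Differentiability.
Context {R : realType}.
Local Notation C := (R[i])^o.
Implicit Types (z w : R[i]) (f g : R[i] -> R[i]).

Lemma nearC_cmod (P : R[i] -> Prop) z :
  (\forall w \near (z : C), P w) <->
  exists2 d : R, 0 < d & forall w, cmod (w - z) < d -> P w.
Proof.
split.
  move=> /nbhs_ballP[e /= e0 he].
  have [er ei] : 0 < complex.Re e /\ complex.Im e = 0.
    by move: e0; case: (e) => a b; rewrite ltcE /= => /andP[/eqP-> ->].
  exists (complex.Re e) => // w hw; apply: he.
  rewrite -ball_normE /ball_ /= normC_cmod cmodB ltcE /= hw andbT.
  by rewrite ei.
move=> [d d0 hd]; apply/nbhs_ballP; exists (real_complex R d) => /=.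
  by rewrite ltcE /= eqxx d0.
move=> w; rewrite -ball_normE /ball_ /= normC_cmod ltcE /= eqxx /= => hw.
by apply: hd; rewrite cmodB.
Qed.

(** Complex differentiability in real epsilon-delta form, the shape that the
    integral estimates consume. *)
Definition cdiff f z := exists d : R[i], forall e : R, 0 < e ->
  exists2 del : R, 0 < del & forall w, cmod (w - z) < del ->
    cmod (f w - f z - d * (w - z)) <= e * cmod (w - z).

Lemma holo_cdiff f z : holo_at f z <-> cdiff f z.
Proof.
split.
  move=> /cvg_ex[d hd]; exists d => e e0.
  have e0' : 0 < real_complex R e by rewrite ltcE /= eqxx e0.
  move/cvgrPdist_le : hd => /(_ _ e0').
  rewrite /dnbhs near_withinE => /nearC_cmod[del del0 h].
  exists del => // w wz.
  have [->|wz0] := eqVneq w z; first by rewrite !subrr mulr0 subrr cmod0 mulr0.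
  have wz1 : w - z != 0 by rewrite subr_eq0.
  have := h (w - z); rewrite subr0 => /(_ wz wz1).
  rewrite /= normC_cmod lecE /= eqxx /=.
  have -> : (w - z)%R *: (1 : C) + z = w by rewrite /GRing.scale /= mulr1 subrK.
  rewrite /GRing.scale /= => h2.
  rewrite -ler_pdivrMr ?cmod_gt0// -cmodV -cmodM.
  apply: le_trans h2; rewrite le_eqVlt; apply/orP; left; apply/eqP.
  by rewrite -cmodN; congr cmod; rewrite mulrBl mulfK// opprB mulrC.
move=> [d hd]; apply/cvg_ex; exists (d : C); apply/cvgrPdist_le => e.
rewrite ltcE /= => /andP[/eqP ei er].
have [del del0 h] := hd _ er.
rewrite /dnbhs near_withinE; apply/nearC_cmod; exists del => // w.
rewrite subr0 => wd w0.
have := h (w + z); rewrite addrK => /(_ wd) h2.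
rewrite /= normC_cmod lecE /= ei eqxx /=.
have -> : w *: (1 : C) + z = w + z by rewrite /GRing.scale /= mulr1.
rewrite /GRing.scale /= -(ler_pM2r (x:=cmod w)) ?cmod_gt0//.
apply: le_trans h2; rewrite -cmodM -cmodN le_eqVlt; apply/orP; left; apply/eqP.
by congr cmod; field.
Qed.

Lemma near_cdiff f g z : (\forall w \near (z : C), f w = g w) ->
  cdiff f z -> cdiff g z.
Proof.
move=> fg /holo_cdiff hf; apply/holo_cdiff.
exact (@near_eq_derivable _ C C f g z 1 fg hf).
Qed.

Lemma eq_cdiff f g z : f =1 g -> cdiff f z -> cdiff g z.
Proof. by move=> fg; apply: near_cdiff; apply/nearC_cmod; exists 1. Qed.

Lemma cdiff_cst (c : R[i]) z : cdiff (fun=> c) z.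
Proof. apply/holo_cdiff; exact: (@derivable_cst _ C C). Qed.

Lemma cdiff_id z : cdiff (fun w => w) z.
Proof. apply/holo_cdiff; exact: (@derivable_id _ C). Qed.

Lemma cdiffD f g z : cdiff f z -> cdiff g z -> cdiff (fun w => f w + g w) z.
Proof.
move=> /holo_cdiff hf /holo_cdiff hg; apply/holo_cdiff.
exact: (@derivableD _ C C _ _ _ _ hf hg).
Qed.

Lemma cdiffN f z : cdiff f z -> cdiff (fun w => - f w) z.
Proof.
move=> /holo_cdiff hf; apply/holo_cdiff.
exact: (@derivableN _ C C _ _ _ hf).
Qed.

Lemma cdiffB f g z : cdiff f z -> cdiff g z -> cdiff (fun w => f w - g w) z.
Proof. by move=> hf hg; apply: cdiffD => //; apply: cdiffN. Qed.

Lemma cdiffM f g z : cdiff f z -> cdiff g z -> cdiff (fun w => f w * g w) z.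
Proof.
move=> /holo_cdiff hf /holo_cdiff hg; apply/holo_cdiff.
exact: (@derivableM _ C _ _ _ _ hf hg).
Qed.

Lemma cdiffV f z : f z != 0 -> cdiff f z -> cdiff (fun w => (f w)^-1) z.
Proof.
move=> f0 /holo_cdiff hf; apply/holo_cdiff.
exact: (@derivableV _ C _ _ _ f0 hf).
Qed.

Lemma cdiffX f n z : cdiff f z -> cdiff (fun w => f w ^+ n) z.
Proof.
move=> hf; elim: n => [|n IH].
  by apply: (eq_cdiff (f:=fun=> 1)) => [w|]; [rewrite expr0|exact: cdiff_cst].
apply: (eq_cdiff (f:=fun w => f w * f w ^+ n)) => [w|]; first by rewrite exprS.
exact: cdiffM.
Qed.

Lemma cdiff_prod (I : eqType) (s : seq I) (P : pred I) (h : I -> R[i] -> R[i]) z :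
  (forall i, i \in s -> P i -> cdiff (h i) z) ->
  cdiff (fun w => \prod_(i <- s | P i) h i w) z.
Proof.
elim: s => [|i s IH] hs.
  by apply: (eq_cdiff (f:=fun=> 1)) => [w|]; [rewrite big_nil|exact: cdiff_cst].
have h1 : cdiff (fun w => \prod_(i <- s | P i) h i w) z.
  by apply: IH => j js; apply: hs; rewrite in_cons js orbT.
case Pi : (P i); last by apply: eq_cdiff h1 => w; rewrite big_cons Pi.
apply: (eq_cdiff (f:=fun w => h i w * \prod_(i <- s | P i) h i w)) => [w|].
  by rewrite big_cons Pi.
by apply: cdiffM => //; apply: hs => //; rewrite mem_head.
Qed.

Lemma cdiff_comp f g z : cdiff g z -> cdiff f (g z) -> cdiff (fun w => f (g w)) z.
Proof.
move=> /holo_cdiff/derivable1_diffP dg /holo_cdiff/derivable1_diffP df.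
by apply/holo_cdiff/derivable1_diffP; exact: (@differentiable_comp _ C C C g f z dg df).
Qed.

Lemma cdiff_continuous f z : cdiff f z -> forall e : R, 0 < e ->
  exists2 del : R, 0 < del & forall w, cmod (w - z) < del -> cmod (f w - f z) < e.
Proof.
move=> [d hd] e e0; have [del del0 h] := hd _ ltr01.
have D0 : 0 < cmod d + 1 by rewrite ltr_wpDl// cmod_ge0.
exists (Num.min del (e / (cmod d + 1))); first by rewrite lt_min del0 divr_gt0.
move=> w; rewrite lt_min ltr_pdivlMr// => /andP[/h h1 h2].
apply: le_lt_trans h2; rewrite mulrDr mulr1.
have -> : f w - f z = (f w - f z - d * (w - z)) + d * (w - z) by ring.
apply: (le_trans (cmodD _ _)); rewrite cmodM addrC [X in _ <= X + _]mulrC lerD2l.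
by rewrite mul1r in h1.
Qed.

End Differentiability.

(** * Bisection of squares, and integrals of continuous functions *)

Section Bisection.
Context {R : realType}.

(** Cousin's principle for squares: if a property fails on a square, it fails on
    one of its quarters, and the nested squares of failure shrink to a point
    where the property cannot fail on all small squares. *)
Lemma bisection (P : R -> R -> R -> Prop) (x0 y0 h0 : R) : 0 < h0 ->
  (forall x y h, 0 < h -> P x y (h / 2) -> P (x + h / 2) y (h / 2) ->
     P x (y + h / 2) (h / 2) -> P (x + h / 2) (y + h / 2) (h / 2) -> P x y h) ->
  (forall x y, x0 <= x <= x0 + h0 -> y0 <= y <= y0 + h0 ->
     exists2 d, 0 < d & forall x' y' h', 0 < h' -> h' < d ->
       x' <= x <= x' + h' -> y' <= y <= y' + h' -> P x' y' h') ->
  P x0 y0 h0.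
Proof.
move=> h00 split local; apply: contrapT => nP.
pose bad (s : R * R * R) := 0 < s.2 /\ ~ P s.1.1 s.1.2 s.2.
pose child (s t : R * R * R) := [/\ bad t, t.2 = s.2 / 2,
   (s.1.1 <= t.1.1 /\ t.1.1 + t.2 <= s.1.1 + s.2) &
   (s.1.2 <= t.1.2 /\ t.1.2 + t.2 <= s.1.2 + s.2)].
have step s : exists t, bad s -> child s t.
  have [[s0 sP]|nb] := pselect (bad s); last by exists s.
  apply: contrapT => nt; apply: sP; have h2 : 0 < s.2 / 2 by rewrite divr_gt0.
  have sp := splitr s.2.
  have mk x y : s.1.1 <= x -> x + s.2 / 2 <= s.1.1 + s.2 ->
     s.1.2 <= y -> y + s.2 / 2 <= s.1.2 + s.2 -> P x y (s.2 / 2).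
    move=> a b c d; apply: contrapT => nPx; apply: nt.
    by exists (x, y, s.2 / 2) => _; split.
  by apply: split => //; apply: mk; lra.
have [nxt nxtP] := choice step.
pose q n := iter n nxt (x0, y0, h0).
have qbad n : bad (q n).
  elim: n => [|n IH]; first by split.
  by have [] := nxtP _ IH.
have qh n : (q n).2 = h0 / 2 ^+ n.
  elim: n => [|n IH]; first by rewrite expr0 divr1.
  have [_ -> _ _] := nxtP _ (qbad n).
  by rewrite IH exprS invfM mulrA mulrAC.
have nest n m : [/\ (q n).1.1 <= (q (n + m)%N).1.1,
   (q (n + m)%N).1.1 + (q (n + m)%N).2 <= (q n).1.1 + (q n).2,
   (q n).1.2 <= (q (n + m)%N).1.2 &
   (q (n + m)%N).1.2 + (q (n + m)%N).2 <= (q n).1.2 + (q n).2].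
  elim: m => [|m [a b c d]]; first by rewrite addn0; split.
  rewrite addnS; have [_ _ [e f] [g h]] := nxtP _ (qbad (n + m)%N).
  by split; [exact: le_trans e|exact: le_trans b|exact: le_trans g|exact: le_trans d].
have key (p : R * R -> R) :
    (forall n m, p (q n).1 <= p (q (n + m)%N).1 /\
       p (q (n + m)%N).1 + (q (n + m)%N).2 <= p (q n).1 + (q n).2) ->
    exists x, forall n, p (q n).1 <= x <= p (q n).1 + (q n).2.
  move=> np; pose A := range (fun n => p (q n).1).
  have ub n : ubound A (p (q n).1 + (q n).2).
    move=> _ [m _ <-]; have [_ b1] := np n m; have [a2 _] := np m n.
    rewrite addnC in a2; apply: (le_trans a2); apply: le_trans b1.
    by rewrite lerDl; have [/ltW] := qbad (n + m)%N.
  exists (sup A) => n; apply/andP; split.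
    by apply: ub_le_sup; [exists (p (q 0%N).1 + (q 0%N).2); exact: ub|exists n].
  by apply: ge_sup => //; exists (p (q 0%N).1); exists 0%N.
have [x xP] := key fst (fun n m => let: And4 a b _ _ := nest n m in conj a b).
have [y yP] := key snd (fun n m => let: And4 _ _ a b := nest n m in conj a b).
have [d d0 dP] := local x y (xP 0%N) (yP 0%N).
have [n hn] : exists n, h0 / 2 ^+ n < d.
  exists (Num.Def.archi_bound (h0 / d)); rewrite ltr_pdivrMr ?exprn_gt0//.
  by rewrite mulrC -ltr_pdivrMr// upper_nthrootP.
have [b1 nb] := qbad n; apply: nb; apply: dP => //; by rewrite ?xP ?yP// qh.
Qed.

End Bisection.

Section ContinuousIntegrals.
Context {R : realType}.
Implicit Types (f g h F : R -> R) (a b c : R).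

Definition icont h a b := forall x, a <= x <= b -> {for x, continuous h}.

Definition rint h a b : R := \int[@lebesgue_measure R]_(x in `[a, b]) h x.

Lemma icont_within h a b : icont h a b -> {within `[a, b], continuous h}.
Proof.
move=> hc; apply: continuous_in_subspaceT => x; rewrite inE /= in_itv /=.
exact: hc.
Qed.

Lemma icont_integrable h a b : icont h a b ->
  (@lebesgue_measure R).-integrable `[a, b] (EFin \o h).
Proof.
move=> hc; apply: continuous_compact_integrable; first exact: segment_compact.
exact: icont_within.
Qed.

Lemma icont_sub h a b c d : a <= c -> d <= b -> icont h a b -> icont h c d.
Proof.
move=> ac db hc x /andP[cx xd]; apply: hc.
by rewrite (le_trans ac cx) (le_trans xd db).
Qed.

Lemma eq_icont f h a b : f =1 h -> icont f a b -> icont h a b.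
Proof. by move=> /funext ->. Qed.

Lemma icont_cst (k : R) a b : icont (fun=> k) a b.
Proof. by move=> x _; apply: cst_continuous. Qed.

Lemma icontD f g a b : icont f a b -> icont g a b -> icont (fun x => f x + g x) a b.
Proof. by move=> hf hg x xab; apply: continuousD; [exact: hf|exact: hg]. Qed.

Lemma icontN f a b : icont f a b -> icont (fun x => - f x) a b.
Proof. by move=> hf x xab; apply: continuousN; exact: hf. Qed.

Lemma icontB f g a b : icont f a b -> icont g a b -> icont (fun x => f x - g x) a b.
Proof. by move=> hf hg; apply: icontD => //; apply: icontN. Qed.

Lemma icontM f g a b : icont f a b -> icont g a b -> icont (fun x => f x * g x) a b.
Proof. by move=> hf hg x xab; apply: continuousM; [exact: hf|exact: hg]. Qed.

Lemma rintD f g a b : icont f a b -> icont g a b ->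
  rint (fun x => f x + g x) a b = rint f a b + rint g a b.
Proof.
by move=> hf hg; apply: RintegralD => //; apply: icont_integrable.
Qed.

Lemma rintB f g a b : icont f a b -> icont g a b ->
  rint (fun x => f x - g x) a b = rint f a b - rint g a b.
Proof.
by move=> hf hg; apply: RintegralB => //; apply: icont_integrable.
Qed.

Lemma rintZ (k : R) f a b : icont f a b ->
  rint (fun x => k * f x) a b = k * rint f a b.
Proof. by move=> hf; apply: RintegralZl => //; apply: icont_integrable. Qed.

Lemma eq_rint f g a b : (forall x, a <= x <= b -> f x = g x) ->
  rint f a b = rint g a b.
Proof.
by move=> fg; apply: eq_Rintegral => x; rewrite inE /= in_itv /=; exact: fg.
Qed.

Lemma rint_cst (k : R) a b : a <= b -> rint (fun=> k) a b = k * (b - a).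
Proof.
move=> ab; rewrite /rint Rintegral_cst//.
have -> : fine (@lebesgue_measure R `[a, b]%classic) = b - a; last by [].
have -> := @lebesgue_measure_itv R `[a, b]%R.
rewrite /= lte_fin; case: ltP => // ba.
by rewrite (@le_anti _ R a b) ?ab// subrr.
Qed.

Lemma le_rint f g a b : icont f a b -> icont g a b ->
  (forall x, a <= x <= b -> f x <= g x) -> rint f a b <= rint g a b.
Proof.
move=> hf hg fg; apply: le_Rintegral => //; exact: icont_integrable.
Qed.

Lemma rint_norm_le f a b (M : R) : a <= b -> icont f a b ->
  (forall x, a <= x <= b -> `|f x| <= M) -> `|rint f a b| <= M * (b - a).
Proof.
move=> ab hf fM; rewrite ler_norml -mulNr -!rint_cst//; apply/andP; split.
  apply: le_rint => //; first exact: icont_cst.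
  by move=> x /fM; rewrite ler_norml => /andP[].
apply: le_rint => //; first exact: icont_cst.
by move=> x /fM; rewrite ler_norml => /andP[].
Qed.

Lemma rint_cat f a b c : a <= c -> c <= b -> icont f a b ->
  rint f a b = rint f a c + rint f c b.
Proof.
move=> ac cb hf; apply/eqP; rewrite addrC -subr_eq; apply/eqP; rewrite /rint.
rewrite (Rintegral_itvB (icont_integrable hf)) ?bnd_simp//.
rewrite Rintegral_itv_obnd_cbnd//.
apply: integrableS (icont_integrable (icont_sub ac (lexx b) hf)) => //.
by apply: subset_itvr; rewrite bnd_simp.
Qed.

Lemma is_derive_cont F (x d : R) : is_derive x 1 F d -> {for x, continuous F}.
Proof.
by move=> [dF _]; apply/differentiable_continuous/derivable1_diffP.
Qed.

Lemma rint_FTC F f a b : a <= b -> icont f a b ->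
  (forall x, a <= x <= b -> is_derive x 1 F (f x)) -> rint f a b = F b - F a.
Proof.
rewrite le_eqVlt => /predU1P[<- _ _|ab hf dF].
  by rewrite subrr /rint set_itv1 Rintegral_set1.
rewrite /rint /Rintegral (@continuous_FTC2 _ f F a b ab).
- by rewrite -EFinB.
- exact: icont_within.
- split.
  + move=> x; rewrite in_itv /= => /andP[/ltW ax /ltW xb].
    by have [] := dF x _; rewrite ?ax ?xb.
  + apply: cvg_at_right_filter; apply: is_derive_cont; apply: dF.
    by rewrite lexx ltW.
  + apply: cvg_at_left_filter; apply: is_derive_cont; apply: dF.
    by rewrite lexx ltW.
- move=> x; rewrite in_itv /= => /andP[/ltW ax /ltW xb].
  have /dF[d1 d2] : a <= x <= b by rewrite ax xb.
  by rewrite derive1E d2.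
Qed.

Lemma primitive_exists f a b : a <= b -> continuous f ->
  exists F, forall x, a <= x <= b -> is_derive x 1 F (f x).
Proof.
move=> ab cf; pose F x := \int[@lebesgue_measure R]_(t in `[(a - 1), x]) f t.
exists F => x /andP[ax xb].
have xb1 : x < b + 1 by lra.
have fi : icont f (a - 1) (b + 1) by move=> y _; exact: cf.
have [d1 d2] := @continuous_FTC1_closed _ f (a - 1) x (b + 1) xb1 (icont_integrable fi) ltac:(lra) (cf x).
by split; [exact: d1|rewrite -derive1E; exact: d2].
Qed.

End ContinuousIntegrals.

(** * Goursat's lemma for homotopies *)

Section Goursat.
Context {R : realType}.
Implicit Types (A B : R -> R -> R) (x y : R -> R).

(** A real one-form A dx + B dy whose linear part at the point is closed: the
    shared coefficient b is the Cauchy-Riemann (or mixed-partials) condition. *)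
Definition closed_form_at A B (x0 y0 : R) := exists a b c : R, forall e : R, 0 < e ->
  exists2 d : R, 0 < d & forall x y : R, `|x - x0| < d -> `|y - y0| < d ->
    `|A x y - A x0 y0 - a * (x - x0) - b * (y - y0)| <= e * (`|x - x0| + `|y - y0|) /\
    `|B x y - B x0 y0 - b * (x - x0) - c * (y - y0)| <= e * (`|x - x0| + `|y - y0|).

Definition quad_potential (A0 B0 a b c X Y : R) : R :=
  A0 * X + B0 * Y + a * X ^+ 2 / 2 + b * (X * Y) + c * Y ^+ 2 / 2.

(** The affine part of the form is exact, so along a path only the error of the
    affine approximation contributes beyond the increment of the potential. *)
Lemma path_integral_approx A B x y x' y' (W : R -> R) (u v x0 y0 a b c e K : R) : u <= v ->
  (forall p, u <= p <= v -> is_derive p 1 x (x' p)) ->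
  (forall p, u <= p <= v -> is_derive p 1 y (y' p)) ->
  icont x' u v -> icont y' u v ->
  icont (fun p => A (x p) (y p)) u v -> icont (fun p => B (x p) (y p)) u v ->
  (forall p, u <= p <= v -> `|x' p| <= K) ->
  (forall p, u <= p <= v -> `|y' p| <= K) ->
  (forall p, u <= p <= v ->
    `|A (x p) (y p) - A x0 y0 - a * (x p - x0) - b * (y p - y0)| <= e /\
    `|B (x p) (y p) - B x0 y0 - b * (x p - x0) - c * (y p - y0)| <= e) ->
  (W = fun p => quad_potential (A x0 y0) (B x0 y0) a b c (x p - x0) (y p - y0)) ->
  `|rint (fun p => A (x p) (y p) * x' p + B (x p) (y p) * y' p) u v - (W v - W u)|
    <= 2 * e * K * (v - u).
Proof.
move=> uv dx dy cx' cy' cA cB Kx Ky err WE.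
have cx : icont x u v by move=> p puv; apply: is_derive_cont; exact: dx.
have cy : icont y u v by move=> p puv; apply: is_derive_cont; exact: dy.
pose w p := (A x0 y0 + a * (x p - x0) + b * (y p - y0)) * x' p +
            (B x0 y0 + b * (x p - x0) + c * (y p - y0)) * y' p.
have aff (k1 k2 k3 : R) : icont (fun p => k1 + k2 * (x p - x0) + k3 * (y p - y0)) u v.
  apply: icontD; first apply: icontD; first exact: icont_cst.
    by apply: icontM; [exact: icont_cst|apply: icontB => //; exact: icont_cst].
  by apply: icontM; [exact: icont_cst|apply: icontB => //; exact: icont_cst].
have cw : icont w u v.
  by apply: icontD; apply: icontM => //; exact: aff.
have dW p : u <= p <= v -> is_derive p 1 W (w p).
  move=> puv; have dxp := dx _ puv; have dyp := dy _ puv.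
  rewrite WE /quad_potential.
  apply: is_derive_eq.
  rewrite /w /GRing.scale /=. 
  by field.
rewrite -(rint_FTC uv cw dW).
have cf : icont (fun p => A (x p) (y p) * x' p + B (x p) (y p) * y' p) u v.
  by apply: icontD; apply: icontM.
rewrite -rintB//; apply: rint_norm_le => //; first exact: icontB.
move=> p puv; have [e1 e2] := err _ puv.
have -> : A (x p) (y p) * x' p + B (x p) (y p) * y' p - w p =
  (A (x p) (y p) - A x0 y0 - a * (x p - x0) - b * (y p - y0)) * x' p +
  (B (x p) (y p) - B x0 y0 - b * (x p - x0) - c * (y p - y0)) * y' p.
  by rewrite /w; ring.
apply: (le_trans (ler_normD _ _)); rewrite !normrM.
have -> : 2 * e * K = e * K + e * K by ring.
by apply: lerD; apply: ler_pM => //; [exact: Kx|exact: Ky].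
Qed.

Lemma derive_lipschitz x x' (u v K : R) :
  (forall p, u <= p <= v -> is_derive p 1 x (x' p)) ->
  (forall p, u <= p <= v -> `|x' p| <= K) ->
  forall p q, u <= p <= v -> u <= q <= v -> `|x p - x q| <= K * `|p - q|.
Proof.
move=> dx Kx; have main p q : u <= p -> p <= q -> q <= v ->
    `|x q - x p| <= K * `|q - p|.
  move=> up pq qv; have [||c] := @MVT_segment _ x x' p q pq.
  - move=> z; rewrite in_itv /= => /andP[/ltW pz /ltW zq]; apply: dx.
    by rewrite (le_trans up pz) (le_trans zq qv).
  - apply: icont_within => z /andP[pz zq]; apply: is_derive_cont; apply: dx.
    by rewrite (le_trans up pz) (le_trans zq qv).
  rewrite in_itv /= => /andP[pc cq] ->; rewrite normrM ler_wpM2r//; apply: Kx.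
  by rewrite (le_trans up pc) (le_trans cq qv).
move=> p q /andP[up pv] /andP[uq qv]; have [pq|/ltW qp] := leP p q.
  by rewrite distrC [`|p - q|]distrC; exact: main.
exact: main.
Qed.

Section Homotopy.
Variables (A B X Y Xt Xs Yt Ys : R -> R -> R) (K : R).
Let I (p : R) := 0 <= p <= 1.
Hypothesis K0 : 0 < K.
Hypothesis dXt : forall t s, I t -> I s -> is_derive t 1 (X ^~ s) (Xt t s).
Hypothesis dYt : forall t s, I t -> I s -> is_derive t 1 (Y ^~ s) (Yt t s).
Hypothesis dXs : forall t s, I t -> I s -> is_derive s 1 (X t) (Xs t s).
Hypothesis dYs : forall t s, I t -> I s -> is_derive s 1 (Y t) (Ys t s).
Hypothesis cXt : forall s, I s -> icont (Xt ^~ s) 0 1.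
Hypothesis cYt : forall s, I s -> icont (Yt ^~ s) 0 1.
Hypothesis cXs : forall t, I t -> icont (Xs t) 0 1.
Hypothesis cYs : forall t, I t -> icont (Ys t) 0 1.
Hypothesis cAt : forall s, I s -> icont (fun t => A (X t s) (Y t s)) 0 1.
Hypothesis cBt : forall s, I s -> icont (fun t => B (X t s) (Y t s)) 0 1.
Hypothesis cAs : forall t, I t -> icont (fun s => A (X t s) (Y t s)) 0 1.
Hypothesis cBs : forall t, I t -> icont (fun s => B (X t s) (Y t s)) 0 1.
Hypothesis bXt : forall t s, I t -> I s -> `|Xt t s| <= K.
Hypothesis bYt : forall t s, I t -> I s -> `|Yt t s| <= K.
Hypothesis bXs : forall t s, I t -> I s -> `|Xs t s| <= K.
Hypothesis bYs : forall t s, I t -> I s -> `|Ys t s| <= K.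
Hypothesis closedAB : forall t s, I t -> I s -> closed_form_at A B (X t s) (Y t s).

Let Es t := fun s => A (X t s) (Y t s) * Xs t s + B (X t s) (Y t s) * Ys t s.
Let Et s := fun t => A (X t s) (Y t s) * Xt t s + B (X t s) (Y t s) * Yt t s.

Let cEs t : I t -> icont (Es t) 0 1.
Proof.
by move=> It; apply: icontD; apply: icontM; [exact: cAs|exact: cXs|exact: cBs|exact: cYs].
Qed.
Let cEt s : I s -> icont (Et s) 0 1.
Proof.
by move=> Is; apply: icontD; apply: icontM; [exact: cAt|exact: cXt|exact: cBt|exact: cYt].
Qed.

Let Q t s h := rint (Es (t + h)) s (s + h) - rint (Es t) s (s + h)
  - rint (Et (s + h)) t (t + h) + rint (Et s) t (t + h).

Let Q_split t s h : 0 < h -> 0 <= t -> t + h <= 1 -> 0 <= s -> s + h <= 1 ->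
  Q t s h = Q t s (h / 2) + Q (t + h / 2) s (h / 2) + Q t (s + h / 2) (h / 2)
          + Q (t + h / 2) (s + h / 2) (h / 2).
Proof.
move=> h0 t0 t1 s0 s1.
have hh (x : R) : x + h / 2 + h / 2 = x + h by field.
have cutS tt : I tt -> rint (Es tt) s (s + h) =
    rint (Es tt) s (s + h / 2) + rint (Es tt) (s + h / 2) (s + h).
  by move=> It; apply: rint_cat; [lra|lra|]; apply: icont_sub (cEs It).
have cutT ss : I ss -> rint (Et ss) t (t + h) =
    rint (Et ss) t (t + h / 2) + rint (Et ss) (t + h / 2) (t + h).
  by move=> Is; apply: rint_cat; [lra|lra|]; apply: icont_sub (cEt Is).
rewrite /Q !hh (cutS (t + h)) ?(cutS t) ?(cutT (s + h)) ?(cutT s); first ring.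
all: by rewrite /I; apply/andP; split; lra.
Qed.

Let X_lip t s t' s' : I t -> I s -> I t' -> I s' ->
  `|X t s - X t' s'| <= K * (`|t - t'| + `|s - s'|).
Proof.
move=> It Is It' Is'.
have -> : X t s - X t' s' = (X t s - X t' s) + (X t' s - X t' s') by ring.
rewrite mulrDr; apply: (le_trans (ler_normD _ _)); apply: lerD.
  by apply: (derive_lipschitz (x:=X ^~ s) (x':=Xt ^~ s) (u:=0) (v:=1)) => // p Ip;
    [exact: dXt|exact: bXt].
by apply: (derive_lipschitz (x:=X t') (x':=Xs t') (u:=0) (v:=1)) => // p Ip;
    [exact: dXs|exact: bXs].
Qed.

Let Y_lip t s t' s' : I t -> I s -> I t' -> I s' ->
  `|Y t s - Y t' s'| <= K * (`|t - t'| + `|s - s'|).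
Proof.
move=> It Is It' Is'.
have -> : Y t s - Y t' s' = (Y t s - Y t' s) + (Y t' s - Y t' s') by ring.
rewrite mulrDr; apply: (le_trans (ler_normD _ _)); apply: lerD.
  by apply: (derive_lipschitz (x:=Y ^~ s) (x':=Yt ^~ s) (u:=0) (v:=1)) => // p Ip;
    [exact: dYt|exact: bYt].
by apply: (derive_lipschitz (x:=Y t') (x':=Ys t') (u:=0) (v:=1)) => // p Ip;
    [exact: dYs|exact: bYs].
Qed.

(** Goursat's argument for the pullback of a pointwise closed form by a C1
    homotopy.  It rests on the pointwise affine approximation of A and B alone, and
    so applies to the real and imaginary parts of f dz. *)
Lemma goursat : rint (Es 1) 0 1 - rint (Es 0) 0 1 - rint (Et 1) 0 1 + rint (Et 0) 0 1 = 0.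
Proof.
have small e : 0 < e -> `|Q 0 0 1| <= e.
  move=> e0.
  pose P t s h := 0 <= t -> t + h <= 1 -> 0 <= s -> s + h <= 1 -> `|Q t s h| <= e * h ^+ 2.
  have : P 0 0 1; last by rewrite /P expr1n mulr1 => ->//; lra.
  apply: bisection => //.
    move=> t s h h0 P1 P2 P3 P4 t0 t1 s0 s1; rewrite Q_split//.
    have -> : e * h ^+ 2 = 4 * (e * (h / 2) ^+ 2) by field.
    have := P1 ltac:(lra) ltac:(lra) ltac:(lra) ltac:(lra).
    have := P2 ltac:(lra) ltac:(lra) ltac:(lra) ltac:(lra).
    have := P3 ltac:(lra) ltac:(lra) ltac:(lra) ltac:(lra).
    have := P4 ltac:(lra) ltac:(lra) ltac:(lra) ltac:(lra).
    rewrite !ler_norml => /andP[? ?] /andP[? ?] /andP[? ?] /andP[? ?].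
    by apply/andP; split; lra.
  move=> t0 s0; rewrite !add0r => It0 Is0.
  have [a [b [c cl]]] := closedAB It0 Is0.
  have e1 : 0 < e / (32 * K ^+ 2) by rewrite divr_gt0// mulr_gt0// exprn_gt0.
  have [d d0 hd] := cl _ e1.
  exists (d / (2 * K)); first by rewrite divr_gt0// mulr_gt0.
  move=> t s h h0; rewrite ltr_pdivlMr ?mulr_gt0// => hd1 /andP[tt0 t0h] /andP[ss0 s0h] tp t1 sp s1.
  pose w (x y : R) := quad_potential (A (X t0 s0) (Y t0 s0)) (B (X t0 s0) (Y t0 s0)) a b c
     (x - X t0 s0) (y - Y t0 s0).
  pose err := e / (8 * K) * h.
  have close tt ss : t <= tt <= t + h -> s <= ss <= s + h ->
    `|A (X tt ss) (Y tt ss) - A (X t0 s0) (Y t0 s0) - a * (X tt ss - X t0 s0) - b * (Y tt ss - Y t0 s0)| <= err /\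
    `|B (X tt ss) (Y tt ss) - B (X t0 s0) (Y t0 s0) - b * (X tt ss - X t0 s0) - c * (Y tt ss - Y t0 s0)| <= err.
    move=> /andP[ta tb] /andP[sa sb].
    have It : I tt by apply/andP; split; lra.
    have Is : I ss by apply/andP; split; lra.
    have dt : `|tt - t0| <= h by rewrite ler_norml; apply/andP; split; lra.
    have ds : `|ss - s0| <= h by rewrite ler_norml; apply/andP; split; lra.
    have dd : K * (`|tt - t0| + `|ss - s0|) <= h * (2 * K).
      by have := lerD dt ds; rewrite -(ler_pM2l K0); lra.
    have lX := le_trans (X_lip It Is It0 Is0) dd.
    have lY := le_trans (Y_lip It Is It0 Is0) dd.
    have [h1 h2] := hd _ _ (le_lt_trans lX hd1) (le_lt_trans lY hd1).
    have eE : e / (32 * K ^+ 2) * (h * (2 * K) + h * (2 * K)) = err.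
      by rewrite /err; field; rewrite gt_eqF.
    have F : e / (32 * K ^+ 2) * (`|X tt ss - X t0 s0| + `|Y tt ss - Y t0 s0|) <= err.
      by rewrite -eE; apply: ler_wpM2l; [exact: ltW|exact: lerD].
    by split; [exact: le_trans h1 F|exact: le_trans h2 F].
  have edgeS tt : t <= tt <= t + h ->
      `|rint (Es tt) s (s + h) - (w (X tt (s + h)) (Y tt (s + h)) - w (X tt s) (Y tt s))| <= e / 4 * h ^+ 2.
    move=> ttI; have It : I tt by move: ttI => /andP[? ?]; apply/andP; split; lra.
    have sub p : s <= p <= s + h -> I p by move=> /andP[? ?]; apply/andP; split; lra.
    have -> : e / 4 * h ^+ 2 = 2 * err * K * (s + h - s) by rewrite /err; field; rewrite gt_eqF.
    apply: (path_integral_approx (x:=X tt) (y:=Y tt) (x':=Xs tt) (y':=Ys tt)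
       (W:=fun p => w (X tt p) (Y tt p)) (x0:=X t0 s0) (y0:=Y t0 s0) (a:=a) (b:=b) (c:=c)) => //.
    - lra.
    - by move=> p /sub Ip; exact: dXs.
    - by move=> p /sub Ip; exact: dYs.
    - exact: icont_sub (cXs It).
    - exact: icont_sub (cYs It).
    - exact: icont_sub (cAs It).
    - exact: icont_sub (cBs It).
    - by move=> p /sub Ip; exact: bXs.
    - by move=> p /sub Ip; exact: bYs.
    - by move=> p Ip; exact: close.
  have edgeT ss : s <= ss <= s + h ->
      `|rint (Et ss) t (t + h) - (w (X (t + h) ss) (Y (t + h) ss) - w (X t ss) (Y t ss))| <= e / 4 * h ^+ 2.
    move=> ssI; have Is : I ss by move: ssI => /andP[? ?]; apply/andP; split; lra.
    have sub p : t <= p <= t + h -> I p by move=> /andP[? ?]; apply/andP; split; lra.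
    have -> : e / 4 * h ^+ 2 = 2 * err * K * (t + h - t) by rewrite /err; field; rewrite gt_eqF.
    apply: (path_integral_approx (x:=X ^~ ss) (y:=Y ^~ ss) (x':=Xt ^~ ss) (y':=Yt ^~ ss)
       (W:=fun p => w (X p ss) (Y p ss)) (x0:=X t0 s0) (y0:=Y t0 s0) (a:=a) (b:=b) (c:=c)) => //.
    - lra.
    - by move=> p /sub Ip; exact: dXt.
    - by move=> p /sub Ip; exact: dYt.
    - exact: icont_sub (cXt Is).
    - exact: icont_sub (cYt Is).
    - exact: icont_sub (cAt Is).
    - exact: icont_sub (cBt Is).
    - by move=> p /sub Ip; exact: bXt.
    - by move=> p /sub Ip; exact: bYt.
    - by move=> p Ip; exact: close.
  have H1 := edgeS t ltac:(apply/andP; split; lra).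
  have H2 := edgeS (t + h) ltac:(apply/andP; split; lra).
  have H3 := edgeT s ltac:(apply/andP; split; lra).
  have H4 := edgeT (s + h) ltac:(apply/andP; split; lra).
  move: H1 H2 H3 H4; rewrite /Q !ler_norml => /andP[? ?] /andP[? ?] /andP[? ?] /andP[? ?].
  apply/andP; split; lra.
have : Q 0 0 1 = 0.
  apply/eqP; rewrite -normr_le0; apply/ler_addgt0Pr => e e0; rewrite add0r; exact: small.
by rewrite /Q !add0r.
Qed.

End Homotopy.

End Goursat.

(** * Homotopic circles *)

Section CircleIntegrals.
Context {R : realType}.
Implicit Types (z w a b : R[i]) (f g : R[i] -> R[i]).
Local Notation Re := complex.Re.
Local Notation Im := complex.Im.

Lemma le_eq (x y : R) : x = y -> x <= y. Proof. by move=> ->. Qed.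

Lemma cReD z w : Re (z + w) = Re z + Re w. Proof. by case: z w => [? ?] []. Qed.
Lemma cImD z w : Im (z + w) = Im z + Im w. Proof. by case: z w => [? ?] []. Qed.
Lemma cReN z : Re (- z) = - Re z. Proof. by case: z. Qed.
Lemma cImN z : Im (- z) = - Im z. Proof. by case: z. Qed.
Lemma cReM z w : Re (z * w) = Re z * Re w - Im z * Im w. Proof. by case: z w => [? ?] []. Qed.
Lemma cImM z w : Im (z * w) = Re z * Im w + Im z * Re w. Proof. by case: z w => [? ?] []. Qed.

Lemma cmod_Complex_le (x y : R) : cmod (Complex x y) <= `|x| + `|y|.
Proof. exact: cmod_le_ReIm. Qed.

Lemma cdiff_closed_form f z : cdiff f z ->
  closed_form_at (fun x y => Re (f (Complex x y))) (fun x y => - Im (f (Complex x y))) (Re z) (Im z) /\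
  closed_form_at (fun x y => Im (f (Complex x y))) (fun x y => Re (f (Complex x y))) (Re z) (Im z).
Proof.
case: z => x0 y0 [[d1 d2] hd] /=.
have key e : 0 < e -> exists2 d : R, 0 < d & forall x y : R, `|x - x0| < d -> `|y - y0| < d ->
    `|Re (f (Complex x y)) - Re (f (Complex x0 y0)) - d1 * (x - x0) + d2 * (y - y0)| <= e * (`|x - x0| + `|y - y0|) /\
    `|Im (f (Complex x y)) - Im (f (Complex x0 y0)) - d2 * (x - x0) - d1 * (y - y0)| <= e * (`|x - x0| + `|y - y0|).
  move=> e0; have [del del0 h] := hd _ e0.
  exists (del / 2); first by rewrite divr_gt0.
  move=> x y hx hy.
  have := h (Complex x y).
  have -> : Complex x y - Complex x0 y0 = Complex (x - x0) (y - y0) by [].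
  have le1 := cmod_Complex_le (x - x0) (y - y0).
  have lt1 : cmod (Complex (x - x0) (y - y0)) < del.
    by apply: le_lt_trans le1 _; rewrite [del]splitr ltrD.
  move=> /(_ lt1) h2.
  have h3 := le_trans h2 (ler_wpM2l (ltW e0) le1).
  have := le_trans (ge_cmod_Re _) h3; have := le_trans (ge_cmod_Im _) h3.
  rewrite !(cReD, cImD, cReN, cImN) !(cReM, cImM) /= => hi hr.
  split; [apply: le_trans hr|apply: le_trans hi]; apply: le_eq; congr (`|_|); ring.
split.
  exists d1, (- d2), (- d1) => e /key[d d0 hk]; exists d => // x y hx hy.
  have [h1 h2] := hk x y hx hy; split.
    by apply: le_trans h1; apply: le_eq; congr (`|_|); ring.
  by apply: le_trans h2; apply: le_eq; rewrite -normrN; congr (`|_|); ring.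
exists d2, d1, (- d2) => e /key[d d0 hk]; exists d => // x y hx hy.
have [h1 h2] := hk x y hx hy; split.
  by apply: le_trans h2; apply: le_eq; congr (`|_|); ring.
by apply: le_trans h1; apply: le_eq; congr (`|_|); ring.
Qed.

Lemma continuous_cdiff_path f (x y : R -> R) s : cdiff f (Complex (x s) (y s)) ->
  {for s, continuous x} -> {for s, continuous y} ->
  {for s, continuous (fun p => Re (f (Complex (x p) (y p))))} /\
  {for s, continuous (fun p => Im (f (Complex (x p) (y p))))}.
Proof.
move=> /cdiff_continuous cf cx cy.
suff near0 e : 0 < e -> \forall p \near s, cmod (f (Complex (x p) (y p)) - f (Complex (x s) (y s))) < e.
  split; apply/cvgrPdist_lt => e /near0; apply: filterS => p; apply: le_lt_trans;
    rewrite -?cReN -?cImN -?cReD -?cImD.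
    by rewrite cmodB; exact: ge_cmod_Re.
  by rewrite cmodB; exact: ge_cmod_Im.
move=> e0; have [del del0 h] := cf _ e0.
have d2 : 0 < del / 2 by rewrite divr_gt0.
move/cvgrPdist_lt : cx => /(_ _ d2) nx; move/cvgrPdist_lt : cy => /(_ _ d2) ny.
near=> p; apply: h.
have -> : Complex (x p) (y p) - Complex (x s) (y s) = Complex (x p - x s) (y p - y s) by [].
apply: (le_lt_trans (cmod_Complex_le _ _)); rewrite [del]splitr ltrD// distrC; near: p => //.
Unshelve. all: by end_near. Qed.

(** Unit circle parametrized by [0, 1], so that the homotopies live on the unit
    square. *)
Definition ucirc (s : R) : R[i] := Complex (cos (2 * pi * s)) (sin (2 * pi * s)).

Lemma cmod_ucirc s : cmod (ucirc s) = 1.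
Proof. by rewrite /cmod /ucirc /= cos2Dsin2 sqrtr1. Qed.

(** Up to the constant 2 pi i and the radius, the integral of f dz over the
    circle. *)
Definition circ_int f (c : R[i]) (rho : R) : R[i] :=
  Complex (rint (fun s => Re (f (c + real_complex R rho * ucirc s) * ucirc s)) 0 1)
          (rint (fun s => Im (f (c + real_complex R rho * ucirc s) * ucirc s)) 0 1).

(** In the homotopy (t, s) |-> circle of centre a + t (b - a) the sides s = 0 and
    s = 1 coincide, so only the two circles contribute to [goursat]. *)
Lemma circ_int_homotopy f (a b : R[i]) (al be : R) :
  (forall t s : R, 0 <= t <= 1 -> 0 <= s <= 1 ->
     cdiff f (a + real_complex R t * (b - a) + real_complex R (al + t * (be - al)) * ucirc s)) ->
  real_complex R be * circ_int f b be = real_complex R al * circ_int f a al.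
Proof.
move=> hf.
pose q t := al + t * (be - al).
pose X t s := Re a + t * Re (b - a) + q t * cos (2 * pi * s).
pose Y t s := Im a + t * Im (b - a) + q t * sin (2 * pi * s).
pose Xt (t s : R) := Re (b - a) + (be - al) * cos (2 * pi * s).
pose Yt (t s : R) := Im (b - a) + (be - al) * sin (2 * pi * s).
pose Xs t s := - (q t * (2 * pi) * sin (2 * pi * s)).
pose Ys t s := q t * (2 * pi) * cos (2 * pi * s).
have XY t s : a + real_complex R t * (b - a) + real_complex R (q t) * ucirc s = Complex (X t s) (Y t s).
  apply/eqP; rewrite eq_complex; apply/andP; split; apply/eqP;
  rewrite !(cReD, cImD) !(cReM, cImM) /=;
  rewrite /X /Y; ring.
have dXt (t s : R) : is_derive t 1 (X ^~ s) (Xt t s).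
  by rewrite /X /q; apply: is_derive_eq; rewrite /Xt /GRing.scale /=; ring.
have dYt (t s : R) : is_derive t 1 (Y ^~ s) (Yt t s).
  by rewrite /Y /q; apply: is_derive_eq; rewrite /Yt /GRing.scale /=; ring.
have dXs (t s : R) : is_derive s 1 (X t) (Xs t s).
  by rewrite /X; apply: is_derive_eq; rewrite /Xs /GRing.scale /=; ring.
have dYs (t s : R) : is_derive s 1 (Y t) (Ys t s).
  by rewrite /Y; apply: is_derive_eq; rewrite /Ys /GRing.scale /=; ring.
have cXt s : icont (Xt ^~ s) 0 1 by move=> t _; exact: cst_continuous.
have cYt s : icont (Yt ^~ s) 0 1 by move=> t _; exact: cst_continuous.
have cXs t : icont (Xs t) 0 1.
  move=> s _; apply: (is_derive_cont (d:=- (q t * (2 * pi) * (2 * pi * cos (2 * pi * s))))).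
  by apply: is_derive_eq; rewrite /GRing.scale /=; ring.
have cYs t : icont (Ys t) 0 1.
  move=> s _; apply: (is_derive_cont (d:=- (q t * (2 * pi) * (2 * pi * sin (2 * pi * s))))).
  by apply: is_derive_eq; rewrite /GRing.scale /=; ring.
pose K := `|Re (b - a)| + `|Im (b - a)| + `|be - al| + (`|al| + `|be - al|) * (2 * pi) + 1.
have pi2 : 0 <= 2 * pi :> R by rewrite mulr_ge0// pi_ge0.
have K4 : 0 <= (`|al| + `|be - al|) * (2 * pi) by rewrite mulr_ge0// addr_ge0.
have K0 : 0 < K by rewrite /K ltr_wpDl// !addr_ge0.
have cosb (x : R) : `|cos x| <= 1 by rewrite ler_norml cos_geN1 cos_le1.
have sinb (x : R) : `|sin x| <= 1 by rewrite ler_norml sin_geN1 sin_le1.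
have qb t : 0 <= t <= 1 -> `|q t| <= `|al| + `|be - al|.
  move=> /andP[t0 t1]; apply: (le_trans (ler_normD _ _)); rewrite lerD2l normrM.
  by rewrite ler_piMl// ger0_norm.
have n1 := normr_ge0 (Re (b - a)); have n2 := normr_ge0 (Im (b - a)).
have n3 := normr_ge0 (be - al).
have bt x y : `|y| <= 1 -> `|x| + `|be - al| <= K -> `|x + (be - al) * y| <= K.
  move=> y1 xK; apply: (le_trans (ler_normD _ _)); apply: le_trans xK.
  by rewrite lerD2l normrM ler_piMr.
have bs x t : 0 <= t <= 1 -> `|x| <= 1 -> `|q t * (2 * pi) * x| <= K.
  move=> /qb qt x1; apply: (@le_trans _ _ ((`|al| + `|be - al|) * (2 * pi))).
    rewrite 2!normrM (ger0_norm pi2) -[leRHS]mulr1; apply: ler_pM => //.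
      by rewrite mulr_ge0.
    by rewrite ler_wpM2r.
  by rewrite /K -addrA addrC -addrA lerDl !addr_ge0.
have cX (t s : R) : {for t, continuous (X ^~ s)} /\ {for s, continuous (X t)}.
  split; [exact: (is_derive_cont (dXt t s))|exact: (is_derive_cont (dXs t s))].
have cY (t s : R) : {for t, continuous (Y ^~ s)} /\ {for s, continuous (Y t)}.
  split; [exact: (is_derive_cont (dYt t s))|exact: (is_derive_cont (dYs t s))].
have fXY t s : 0 <= t <= 1 -> 0 <= s <= 1 -> cdiff f (Complex (X t s) (Y t s)).
  by move=> t01 s01; rewrite -XY; exact: hf.
have per (x : R -> R) : x = @cos R \/ x = @sin R -> x (2 * pi * 1) = x (2 * pi * 0).
  by case=> ->; rewrite mulr1 mulr0 mulr_natl ?cos2pi ?sin2pi ?cos0 ?sin0.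
have pc := per _ (or_introl erefl); have ps := per _ (or_intror erefl).
have main A B :
    (forall t s, 0 <= t <= 1 -> 0 <= s <= 1 -> closed_form_at A B (X t s) (Y t s)) ->
    (forall t s, 0 <= t <= 1 -> 0 <= s <= 1 ->
      ({for t, continuous (fun t => A (X t s) (Y t s))} /\
       {for t, continuous (fun t => B (X t s) (Y t s))}) /\
      ({for s, continuous (fun s => A (X t s) (Y t s))} /\
       {for s, continuous (fun s => B (X t s) (Y t s))})) ->
    rint (fun s => A (X 1 s) (Y 1 s) * Xs 1 s + B (X 1 s) (Y 1 s) * Ys 1 s) 0 1 =
    rint (fun s => A (X 0 s) (Y 0 s) * Xs 0 s + B (X 0 s) (Y 0 s) * Ys 0 s) 0 1.
  move=> cl ct.
  have := @goursat _ A B X Y Xt Xs Yt Ys K K0.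
  move=> /(_ (fun t s _ _ => dXt t s) (fun t s _ _ => dYt t s)
             (fun t s _ _ => dXs t s) (fun t s _ _ => dYs t s)
             (fun s _ => cXt s) (fun s _ => cYt s) (fun t _ => cXs t) (fun t _ => cYs t)).
  have -> : rint (fun t => A (X t 1) (Y t 1) * Xt t 1 + B (X t 1) (Y t 1) * Yt t 1) 0 1 =
            rint (fun t => A (X t 0) (Y t 0) * Xt t 0 + B (X t 0) (Y t 0) * Yt t 0) 0 1.
    by apply: eq_rint => t _; rewrite /X /Y /Xt /Yt pc ps.
  move=> G; apply/eqP; rewrite -subr_eq0; apply/eqP; rewrite -[LHS](subrK (rint (fun t => A (X t 0) (Y t 0) * Xt t 0 + B (X t 0) (Y t 0) * Yt t 0) 0 1)).
  apply: G => //.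
  - by move=> s s01 t t01; have [[]] := ct t s t01 s01.
  - by move=> s s01 t t01; have [[]] := ct t s t01 s01.
  - by move=> t t01 s s01; have [_ []] := ct t s t01 s01.
  - by move=> t t01 s s01; have [_ []] := ct t s t01 s01.
  - by move=> t s _ _; apply: bt => //; rewrite /K; lra.
  - by move=> t s _ _; apply: bt => //; rewrite /K; lra.
  - by move=> t s t01 _; rewrite /Xs normrN; apply: bs.
  - by move=> t s t01 _; apply: bs.
have cont t s : 0 <= t <= 1 -> 0 <= s <= 1 ->
    (({for t, continuous (fun t => Re (f (Complex (X t s) (Y t s))))} /\
      {for t, continuous (fun t => Im (f (Complex (X t s) (Y t s))))}) /\
     ({for s, continuous (fun s => Re (f (Complex (X t s) (Y t s))))} /\
      {for s, continuous (fun s => Im (f (Complex (X t s) (Y t s))))})).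
  move=> t01 s01; have hc := fXY t s t01 s01.
  have [cx1 cx2] := cX t s; have [cy1 cy2] := cY t s.
  by split; apply: (continuous_cdiff_path (f:=f)).
have E1 := main (fun x y => Re (f (Complex x y))) (fun x y => - Im (f (Complex x y)))
  (fun t s t01 s01 => (cdiff_closed_form (fXY t s t01 s01)).1).
have E2 := main (fun x y => Im (f (Complex x y))) (fun x y => Re (f (Complex x y)))
  (fun t s t01 s01 => (cdiff_closed_form (fXY t s t01 s01)).2).
have {}E1 := E1 (fun t s t01 s01 => let: conj (conj a1 a2) (conj a3 a4) := cont t s t01 s01 in
  conj (conj a1 (continuousN a2)) (conj a3 (continuousN a4))).
have {}E2 := E2 (fun t s t01 s01 => let: conj (conj a1 a2) (conj a3 a4) := cont t s t01 s01 in
  conj (conj a2 a1) (conj a4 a3)).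
have cu : icont (fun s => cos (2 * pi * s)) (0 : R) 1.
  move=> s _; apply: (is_derive_cont (d:=- (2 * pi * sin (2 * pi * s)))).
  by apply: is_derive_eq; rewrite /GRing.scale /=; ring.
have cv : icont (fun s => sin (2 * pi * s)) (0 : R) 1.
  move=> s _; apply: (is_derive_cont (d:=(2 * pi * cos (2 * pi * s)))).
  by apply: is_derive_eq; rewrite /GRing.scale /=; ring.
have side t c : 0 <= t <= 1 -> (forall s, c + real_complex R (q t) * ucirc s = Complex (X t s) (Y t s)) ->
  rint (fun s => Re (f (Complex (X t s) (Y t s))) * Xs t s + - Im (f (Complex (X t s) (Y t s))) * Ys t s) 0 1
   = - (2 * pi) * (q t * Im (circ_int f c (q t))) /\
  rint (fun s => Im (f (Complex (X t s) (Y t s))) * Xs t s + Re (f (Complex (X t s) (Y t s))) * Ys t s) 0 1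
   = (2 * pi) * (q t * Re (circ_int f c (q t))).
  move=> t01 cE.
  have c1 : icont (fun s => Re (f (c + real_complex R (q t) * ucirc s) * ucirc s)) 0 1.
    apply: (eq_icont (f:=fun s => Re (f (Complex (X t s) (Y t s))) * cos (2 * pi * s) -
      Im (f (Complex (X t s) (Y t s))) * sin (2 * pi * s))).
      by move=> s; rewrite cE cReM.
    by apply: icontB; apply: icontM => // s s01; have [_ []] := cont t s t01 s01.
  have c2 : icont (fun s => Im (f (c + real_complex R (q t) * ucirc s) * ucirc s)) 0 1.
    apply: (eq_icont (f:=fun s => Re (f (Complex (X t s) (Y t s))) * sin (2 * pi * s) +
      Im (f (Complex (X t s) (Y t s))) * cos (2 * pi * s))).
      by move=> s; rewrite cE cImM.
    by apply: icontD; apply: icontM => // s s01; have [_ []] := cont t s t01 s01.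
  rewrite /circ_int /= !mulrA -!rintZ//; split; apply: eq_rint => s _;
    by rewrite cE ?cImM ?cReM /Xs /Ys /=; ring.
have q1 : q 1 = be by rewrite /q; ring.
have q0 : q 0 = al by rewrite /q; ring.
have [||S1 S2] := side 1 b; first by rewrite ler01 lexx.
  by move=> s; rewrite -XY; congr (_ + _); rewrite mul1r addrC subrK.
have [||S3 S4] := side 0 a; first by rewrite ler01 lexx.
  by move=> s; rewrite -XY; congr (_ + _); rewrite mul0r addr0.
move: E1 E2; rewrite S1 S2 S3 S4 q1 q0.
have pi20 : 2 * pi != 0 :> R by rewrite mulf_neq0// gt_eqF// pi_gt0.
move=> /(mulfI _); rewrite oppr_eq0 => /(_ pi20) E1 /(mulfI pi20) E2.
apply/eqP; rewrite eq_complex !(cReM, cImM) E1 E2 /=; apply/andP; split; apply/eqP.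
  by move: E2 => /=; rewrite !mul0r !subr0.
by move: E1 => /=; rewrite !mul0r !addr0.
Qed.

End CircleIntegrals.

(** * The Cauchy formula and the maximum principle *)

Section CauchyFormula.
Context {R : realType}.
Implicit Types (z w a b : R[i]) (f g : R[i] -> R[i]) (h : R -> R[i]).
Local Notation Re := complex.Re.
Local Notation Im := complex.Im.

Lemma bernoulli_exprn (x : R) n : 0 <= x -> 1 + n%:R * x <= (1 + x) ^+ n.
Proof.
move=> x0; elim: n => [|n IH]; first by rewrite mul0r addr0 expr0.
rewrite exprS; have n0 : 0 <= n%:R :> R by [].
have := ler_wpM2l (addr_ge0 ler01 x0) IH; apply: le_trans.
by rewrite -natr1; have := mulr_ge0 n0 (mulr_ge0 x0 x0); lra.
Qed.

Lemma exprn_unbounded (x C : R) : 1 < x -> exists n, C < x ^+ n.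
Proof.
move=> x1; exists (Num.Def.archi_bound `|C / (x - 1)|).
have x10 : 0 < x - 1 by lra.
have : C / (x - 1) < (Num.Def.archi_bound `|C / (x - 1)|)%:R.
  by apply: le_lt_trans (ler_norm _) _; apply: archi_boundP.
rewrite ltr_pdivrMr// => /lt_le_trans; apply.
have := bernoulli_exprn (Num.Def.archi_bound `|C / (x - 1)|) (ltW x10).
by rewrite (_ : 1 + (x - 1) = x); [lra|ring].
Qed.

Lemma exprn_le_bounded (x y C : R) : 0 <= x -> 0 <= y ->
  (forall n, x ^+ n <= C * y ^+ n) -> x <= y.
Proof.
move=> x0 y0 h; rewrite leNgt; apply/negP => yx.
have [y00|yn0] := eqVneq y 0.
  by move: (h 1%N); rewrite y00 !expr1 mulr0 => /(lt_le_trans yx); rewrite y00 ltxx.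
have yp : 0 < y by rewrite lt_def yn0.
have [n] : exists n, C < (x / y) ^+ n by apply: exprn_unbounded; rewrite ltr_pdivlMr ?mul1r.
by rewrite expr_div_n ltr_pdivlMr ?exprn_gt0// ltNge h.
Qed.

Definition cint h : R[i] := Complex (rint (fun s => Re (h s)) 0 1) (rint (fun s => Im (h s)) 0 1).
Definition ccont h := icont (fun s => Re (h s)) 0 1 /\ icont (fun s => Im (h s)) 0 1.

Lemma circ_intE f c rho : circ_int f c rho =
  cint (fun s => f (c + real_complex R rho * ucirc s) * ucirc s).
Proof. by []. Qed.

Lemma eq_cint h1 h2 : (forall s, 0 <= s <= 1 -> h1 s = h2 s) -> cint h1 = cint h2.
Proof. by move=> hh; congr Complex; apply: eq_rint => s /hh ->. Qed.

Lemma ccontM h1 h2 : ccont h1 -> ccont h2 -> ccont (fun s => h1 s * h2 s).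
Proof.
move=> [a1 b1] [a2 b2]; split.
  by apply: (eq_icont (f:=fun s => Re (h1 s) * Re (h2 s) - Im (h1 s) * Im (h2 s)))
    => [s /=|]; [rewrite cReM|apply: icontB; apply: icontM].
by apply: (eq_icont (f:=fun s => Re (h1 s) * Im (h2 s) + Im (h1 s) * Re (h2 s)))
    => [s /=|]; [rewrite cImM|apply: icontD; apply: icontM].
Qed.

Lemma ccontB h1 h2 : ccont h1 -> ccont h2 -> ccont (fun s => h1 s - h2 s).
Proof.
move=> [a1 b1] [a2 b2]; split.
  by apply: (eq_icont (f:=fun s => Re (h1 s) - Re (h2 s)))
    => [s /=|]; [rewrite cReD cReN|apply: icontB].
by apply: (eq_icont (f:=fun s => Im (h1 s) - Im (h2 s)))
    => [s /=|]; [rewrite cImD cImN|apply: icontB].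
Qed.

Lemma ccont_cst c : ccont (fun=> c).
Proof. by split; exact: icont_cst. Qed.

Lemma cintB h1 h2 : ccont h1 -> ccont h2 ->
  cint (fun s => h1 s - h2 s) = cint h1 - cint h2.
Proof.
move=> [a1 b1] [a2 b2]; apply/eqP; rewrite eq_complex; apply/andP; split; apply/eqP.
  by rewrite cReD cReN /= -rintB//; apply: eq_rint => s _; rewrite cReD cReN.
by rewrite cImD cImN /= -rintB//; apply: eq_rint => s _; rewrite cImD cImN.
Qed.

Lemma cintZ c h : ccont h -> cint (fun s => c * h s) = c * cint h.
Proof.
case: c => c1 c2 [a1 b1]; apply/eqP; rewrite eq_complex; apply/andP; split; apply/eqP.
  rewrite cReM /= -!rintZ// -rintB; first by apply: eq_rint => s _; rewrite cReM.
    by apply: icontM => //; exact: icont_cst.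
  by apply: icontM => //; exact: icont_cst.
rewrite cImM /= -!rintZ// -rintD; first by apply: eq_rint => s _; rewrite cImM.
  by apply: icontM => //; exact: icont_cst.
by apply: icontM => //; exact: icont_cst.
Qed.

Lemma cint_cst c : cint (fun=> c) = c.
Proof. by case: c => a b; rewrite /cint !rint_cst//= subr0 !mulr1. Qed.

(** The factor 2 comes from bounding the real and imaginary parts separately;
    it is harmless because it disappears when passing to powers of f. *)
Lemma cmod_cint_le h (M : R) : ccont h -> (forall s, 0 <= s <= 1 -> cmod (h s) <= M) ->
  cmod (cint h) <= 2 * M.
Proof.
move=> [a b] hM; apply: (le_trans (cmod_le_ReIm _)) => /=.
have -> : 2 * M = M * (1 - 0) + M * (1 - 0) by ring.
apply: lerD; apply: rint_norm_le => // s /hM; apply: le_trans.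
  exact: ge_cmod_Re.
exact: ge_cmod_Im.
Qed.

Lemma ccont_ucirc : ccont ucirc.
Proof.
split => s _ /=.
  apply: (is_derive_cont (d:=- (2 * pi * sin (2 * pi * s)))).
  by apply: is_derive_eq; rewrite /GRing.scale /=; ring.
apply: (is_derive_cont (d:=(2 * pi * cos (2 * pi * s)))).
by apply: is_derive_eq; rewrite /GRing.scale /=; ring.
Qed.

Lemma ccont_circle f c (rho : R) :
  (forall w, cmod (w - c) = `|rho| -> cdiff f w) ->
  ccont (fun s => f (c + real_complex R rho * ucirc s)).
Proof.
move=> hf; have [c1 c2] := ccontM (ccont_cst (real_complex R rho)) ccont_ucirc.
pose x s := Re (c + real_complex R rho * ucirc s).
pose y s := Im (c + real_complex R rho * ucirc s).
have cx : icont x 0 1.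
  apply: (eq_icont (f:=fun s => Re c + Re (real_complex R rho * ucirc s))) => [s|].
    by rewrite /x cReD.
  by apply: icontD => //; exact: icont_cst.
have cy : icont y 0 1.
  apply: (eq_icont (f:=fun s => Im c + Im (real_complex R rho * ucirc s))) => [s|].
    by rewrite /y cImD.
  by apply: icontD => //; exact: icont_cst.
have E s : c + real_complex R rho * ucirc s = Complex (x s) (y s).
  by rewrite /x /y; case: (_ + _).
have K s : 0 <= s <= 1 -> {for s, continuous (fun p => Re (f (Complex (x p) (y p))))} /\
  {for s, continuous (fun p => Im (f (Complex (x p) (y p))))}.
  move=> s01; apply: continuous_cdiff_path; [|exact: cx|exact: cy].
  by rewrite -E; apply: hf; rewrite addrC addKr cmodM cmod_ucirc mulr1 cmod_real.
by split; [apply: (eq_icont (f:=fun p => Re (f (Complex (x p) (y p)))))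
          |apply: (eq_icont (f:=fun p => Im (f (Complex (x p) (y p)))))] => s;
   rewrite ?E// => /K[].
Qed.

Lemma cmod_circle c (rho : R) s : cmod (c + real_complex R rho * ucirc s - c) = `|rho|.
Proof. by rewrite addrC addKr cmodM cmod_ucirc mulr1 cmod_real. Qed.

(** A homotopy shrinks the circle around 0 to a small circle around z, on which f
    is nearly constant. *)
Theorem cauchy_formula f (rho : R) z :
  (forall w, cmod w <= rho -> cdiff f w) -> cmod z < rho ->
  f z = real_complex R rho * circ_int (fun w => f w / (w - z)) 0 rho.
Proof.
move=> hf zr.
have rho0 : 0 < rho := le_lt_trans (cmod_ge0 z) zr.
pose F w := f w / (w - z).
have hF w : cmod w <= rho -> w != z -> cdiff F w.
  move=> wr wz; apply: cdiffM; first exact: hf.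
  by apply: cdiffV; [rewrite subr_eq0|apply: cdiffB; [exact: cdiff_id|exact: cdiff_cst]].
have key al : 0 < al -> al < rho - cmod z ->
    real_complex R rho * circ_int F 0 rho = cint (fun s => f (z + real_complex R al * ucirc s)).
  move=> al0 alr.
  rewrite (@circ_int_homotopy R F z 0 al rho); last first.
    move=> t s /andP[t0 t1] s01.
    have q0 : 0 < al + t * (rho - al) by apply: ltr_wpDr => //; apply: mulr_ge0 => //; have := cmod_ge0 z; lra.
    apply: hF.
      apply: (@le_trans _ _ ((1 - t) * cmod z + (al + t * (rho - al)))).
        apply: (le_trans (cmodD _ _)); apply: lerD.
          have -> : z + real_complex R t * (0 - z) = real_complex R (1 - t) * z.
            by rewrite rmorphB rmorph1; ring.
          by rewrite cmodM cmod_real ger0_norm//; lra.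
        by rewrite cmodM cmod_ucirc mulr1 cmod_real gtr0_norm.
      have : 0 <= (1 - t) * (rho - cmod z - al) by rewrite mulr_ge0//; lra.
      by lra.
    apply/eqP => E.
    have : cmod (real_complex R (al + t * (rho - al)) * ucirc s) = cmod (real_complex R t * z).
      by congr cmod; rewrite -[LHS](addKr (z + real_complex R t * (0 - z))) E; ring.
    rewrite !cmodM cmod_ucirc mulr1 !cmod_real gtr0_norm// ger0_norm//.
    have : 0 <= t * (rho - cmod z - al) by rewrite mulr_ge0//; lra.
    by nra.
  rewrite circ_intE -cintZ; last first.
    apply: ccontM; last exact: ccont_ucirc.
    apply: ccont_circle => w wz; apply: hF.
      have -> : w = (w - z) + z by rewrite subrK.
      apply: (le_trans (cmodD _ _)); rewrite wz gtr0_norm//; lra.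
    by apply/eqP => E; move: wz; rewrite E subrr cmod0 gtr0_norm//; lra.
  apply: eq_cint => s _; rewrite /F.
  rewrite (_ : z + real_complex R al * ucirc s - z = real_complex R al * ucirc s); last first.
    by rewrite addrC addKr.
  have u0 : ucirc s != 0 by rewrite -cmod_eq0 cmod_ucirc oner_eq0.
  have a0 : real_complex R al != 0 by rewrite -cmod_eq0 cmod_real gtr0_norm// gt_eqF.
  by field; rewrite a0 u0.
apply/eqP; rewrite -subr_eq0 -cmod_eq0; apply/eqP/le_anti; rewrite cmod_ge0 andbT.
apply/ler_addgt0Pr => e e0; rewrite add0r.
have e2 : 0 < e / 2 by rewrite divr_gt0.
have [del del0 hd] := cdiff_continuous (hf z (ltW zr)) e2.
pose al := Num.min (del / 2) ((rho - cmod z) / 2).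
have al0 : 0 < al by rewrite lt_min !divr_gt0//; lra.
have al1 : al < rho - cmod z.
  by apply: (@le_lt_trans _ _ ((rho - cmod z) / 2)); [rewrite ge_min lexx orbT|lra].
have al2 : al < del by apply: (@le_lt_trans _ _ (del / 2)); [rewrite ge_min lexx|lra].
rewrite -/F (key _ al0 al1) -[f z](cint_cst (f z)).
have cc : ccont (fun s => f (z + real_complex R al * ucirc s)).
  apply: ccont_circle => w wz; apply: hf.
  have -> : w = (w - z) + z by rewrite subrK.
  apply: (le_trans (cmodD _ _)); rewrite wz gtr0_norm//; lra.
rewrite -cintB//; last exact: ccont_cst.
have -> : e = 2 * (e / 2) by field.
apply: cmod_cint_le; first by apply: ccontB => //; exact: ccont_cst.
move=> s _; rewrite cmodB ltW//; apply: hd.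
by rewrite cmod_circle gtr0_norm.
Qed.

(** The Cauchy formula bounds |f z| by a constant times the maximum on the
    circle; applied to the powers of f, the constant becomes 1. *)
Theorem maximum_principle f (rho M : R) z :
  (forall w, cmod w <= rho -> cdiff f w) -> (forall w, cmod w = rho -> cmod (f w) <= M) ->
  cmod z <= rho -> cmod (f z) <= M.
Proof.
move=> hf hM; rewrite le_eqVlt => /orP[/eqP|zr]; first exact: hM.
have rho0 : 0 < rho := le_lt_trans (cmod_ge0 z) zr.
have M0 : 0 <= M.
  apply: le_trans (hM (real_complex R rho) _); first exact: cmod_ge0.
  by rewrite cmod_real gtr0_norm.
apply: (@exprn_le_bounded _ _ (rho * (2 / (rho - cmod z)))) => //; first exact: cmod_ge0.
move=> n; rewrite -cmodX (@cauchy_formula (fun w => f w ^+ n) rho)//; last first.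
  by move=> w wr; apply: cdiffX; exact: hf.
rewrite cmodM cmod_real gtr0_norm// -mulrA ler_wpM2l ?(ltW rho0)//.
have d0 : 0 < rho - cmod z by lra.
have -> : 2 / (rho - cmod z) * M ^+ n = 2 * (M ^+ n / (rho - cmod z)) by ring.
have dist w : cmod w = rho -> rho - cmod z <= cmod (w - z).
  by move=> <-; apply: le_trans (ler_norm _) _; exact: ler_distcmod.
have hF w : cmod (w - 0) = `|rho| -> cdiff (fun w => f w ^+ n / (w - z)) w.
  rewrite subr0 gtr0_norm// => wr.
  apply: cdiffM; first by apply: cdiffX; apply: hf; rewrite wr.
  apply: cdiffV; last by apply: cdiffB; [exact: cdiff_id|exact: cdiff_cst].
  by rewrite -cmod_gt0; apply: lt_le_trans (dist _ wr).
rewrite circ_intE; apply: cmod_cint_le.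
  apply: (@ccontM (fun s => f (0 + real_complex R rho * ucirc s) ^+ n / (0 + real_complex R rho * ucirc s - z)));
    [exact: (@ccont_circle (fun w => f w ^+ n / (w - z)) 0 rho)|exact: ccont_ucirc].
move=> s _; set w := 0 + _.
have wr : cmod w = rho by rewrite -[w]subr0 cmod_circle gtr0_norm.
rewrite !cmodM cmod_ucirc mulr1 cmodV cmodX; apply: ler_pM.
- by rewrite exprn_ge0// cmod_ge0.
- by rewrite invr_ge0 cmod_ge0.
- by apply: lerXn2r; rewrite ?nnegrE ?cmod_ge0 ?hM.
- by rewrite lef_pV2 ?posrE ?(lt_le_trans d0 (dist _ wr))// dist.
Qed.

End CauchyFormula.

(** * Zeros of entire functions *)

Section ZerosOfEntire.
Context {R : realType}.
Implicit Types (z w a b : R[i]) (f g : R[i] -> R[i]) (h : R -> R[i]).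
Local Notation Re := complex.Re.
Local Notation Im := complex.Im.

Lemma cmod_polar (t th : R) : 0 <= t -> cmod (polar t th) = t.
Proof.
move=> t0; rewrite /cmod /polar /= !exprMn -mulrDr cos2Dsin2 mulr1 sqrtr_sqr.
by rewrite ger0_norm.
Qed.

Lemma polarE (t th : R) : polar t th = real_complex R t * Complex (cos th) (sin th).
Proof. by apply/eqP; rewrite eq_complex cReM cImM /= !mul0r subr0 addr0 !eqxx. Qed.

Lemma polar_exists w : exists2 th : R, 0 <= th <= 2 * pi & w = polar (cmod w) th.
Proof.
have [->|w0] := eqVneq w 0.
  by exists 0; rewrite ?lexx ?mulr_ge0 ?pi_ge0// cmod0 /polar !mul0r.
have m0 : 0 < cmod w by rewrite cmod_gt0.
case: w w0 m0 => x y w0 m0; set m := cmod _ in m0 *.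
have hm : m ^+ 2 = x ^+ 2 + y ^+ 2 by rewrite cmod_sqr.
have xm : -1 <= x / m <= 1.
  have := ge_cmod_Re (Complex x y); rewrite ler_norml => /andP[x1 x2].
  by rewrite ler_pdivlMr// ler_pdivrMr// mulN1r mul1r x1.
have /andP[/andP[a0 a1] /eqP cosa] : (0 <= acos (x / m) <= pi) && (cos (acos (x / m)) == x / m).
  by have [-> ->] := acos_def xm; rewrite eqxx.
have sina : sin (acos (x / m)) = `|y| / m.
  have -> : `|y| / m = Num.sqrt ((`|y| / m) ^+ 2).
    by rewrite sqrtr_sqr normrM normr_id (gtr0_norm (x:=m^-1)) ?invr_gt0.
  rewrite sin_acos//; congr Num.sqrt; rewrite !expr_div_n real_normK ?num_real//.
  by rewrite -[in RHS](addrK (x ^+ 2) (y ^+ 2)) [y ^+ 2 + _]addrC -hm mulrBl divff// expf_neq0// gt_eqF.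
have mm (p : R) : m * (p / m) = p by rewrite mulrC divfK// gt_eqF.
have [y0|y0] := leP 0 y.
  exists (acos (x / m)); first by rewrite a0 (le_trans a1)// mulr_natl mulr2n lerDl pi_ge0.
  by rewrite /polar cosa sina ger0_norm// !mm.
exists (2 * pi - acos (x / m)).
  by rewrite subr_ge0 lerBlDr lerDl a0 andbT (le_trans a1)// mulr_natl mulr2n lerDl pi_ge0.
have p2 : 2 * pi = pi *+ 2 :> R by rewrite mulr_natl.
rewrite /polar cosB sinB p2 cos2pi sin2pi cosa sina ltr0_norm//.
by rewrite !mul0r !mul1r addr0 sub0r mulNr opprK !mm.
Qed.

Lemma polar_ucirc (t s : R) : polar t (2 * pi * s) = real_complex R t * ucirc s.
Proof. by rewrite polarE. Qed.

Lemma ucirc_exists c w : exists2 s : R, 0 <= s <= 1 & w = c + real_complex R (cmod (w - c)) * ucirc s.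
Proof.
have [th /andP[t0 t1] E] := polar_exists (w - c).
have pi20 : 0 < 2 * pi :> R by rewrite mulr_gt0// pi_gt0.
exists (th / (2 * pi)); first by rewrite divr_ge0 ?(ltW pi20)//= ler_pdivrMr// mul1r.
rewrite -polar_ucirc (_ : 2 * pi * (th / (2 * pi)) = th); first by rewrite -E addrC subrK.
by rewrite mulrC divfK// gt_eqF.
Qed.

Lemma icont_bounded (k : R -> R) : icont k 0 1 ->
  exists M, forall s, 0 <= s <= 1 -> `|k s| <= M.
Proof.
move=> ck.
have cn : icont (fun s => `|k s|) 0 1.
  move=> s s01; apply: (continuous_comp (f:=k) (g:=fun x : R => `|x|)); first exact: ck.
  exact (@norm_continuous R R^o (k s)).
have [c _ hc] := EVT_max ler01 (icont_within cn).
by exists (`|k c|) => s s01; apply: hc; rewrite in_itv.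
Qed.

Lemma circle_bounded f c (rho : R) : (forall w, cmod (w - c) = rho -> cdiff f w) ->
  exists2 M : R, 0 <= M & forall w, cmod (w - c) = rho -> cmod (f w) <= M.
Proof.
have [r0 hf|r0 _] := leP 0 rho; last first.
  by exists 0 => // w E; move: r0; rewrite -E ltNge cmod_ge0.
have [c1 c2] : ccont (fun s => f (c + real_complex R rho * ucirc s)).
  by apply: ccont_circle => w; rewrite ger0_norm //; exact: hf.
have [M1 h1] := icont_bounded c1; have [M2 h2] := icont_bounded c2.
have M10 := le_trans (normr_ge0 _) (h1 0 ltac:(by rewrite lexx ler01)).
have M20 := le_trans (normr_ge0 _) (h2 0 ltac:(by rewrite lexx ler01)).
exists (M1 + M2); first exact: addr_ge0.
move=> w E; have [s s01 ->] := ucirc_exists c w; rewrite E.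
by apply: (le_trans (cmod_le_ReIm _)); apply: lerD; [exact: h1|exact: h2].
Qed.

(** The difference quotient at a zero is again entire: by the Cauchy formula
    f z is a circle integral of a kernel whose Taylor expansion of order two at
    the origin has a remainder of size z^3. *)
Lemma entire_div0 f : (forall z, cdiff f z) -> f 0 = 0 ->
  exists2 g, (forall z, cdiff g z) & forall w, f w = w * g w.
Proof.
move=> hf f0.
pose u (s : R) : R[i] := 0 + real_complex R 1 * ucirc s.
have u1 s : cmod (u s) = 1 by rewrite -[u s]subr0 cmod_circle normr1.
have u0 s : u s != 0 by rewrite -cmod_gt0 u1.
have [M M0 hM] := circle_bounded (fun w (_ : cmod (w - 0) = 1) => hf w).
have ck (k : R[i] -> R[i]) : (forall w, cmod w = 1 -> cdiff k w) ->
    ccont (fun s => f (u s) * k (u s) * ucirc s).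
  move=> hk; apply: (@ccontM _ (fun s => f (u s) * k (u s))); last exact: ccont_ucirc.
  apply: (@ccont_circle _ (fun w => f w * k w)) => w; rewrite subr0 normr1 => w1.
  by apply: cdiffM; [exact: hf|exact: hk].
have ne0 w : cmod w = 1 -> w != 0 by move=> w1; rewrite -cmod_gt0 w1.
have cV n w : cmod w = 1 -> cdiff (fun w => (w ^+ n)^-1) w.
  move=> w1; apply: cdiffV; first by rewrite expf_neq0// ne0.
  by apply: cdiffX; exact: cdiff_id.
pose J n := cint (fun s => f (u s) * (u s ^+ n)^-1 * ucirc s).
pose g w := if w == 0 then J 2%N else f w / w.
exists g; last first.
  by move=> w; rewrite /g; case: eqP => [->|/eqP w0]; rewrite ?f0 ?mul0r// mulrC divfK.
move=> z; have [->|z0] := eqVneq z 0; last first.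
  apply: (near_cdiff (f:=fun w => f w / w)).
    apply/nearC_cmod; exists (cmod z); first by rewrite cmod_gt0.
    move=> w wz; rewrite /g; case: eqP => // w0; move: wz.
    by rewrite w0 sub0r cmodN ltxx.
  by apply: cdiffM => //; apply: cdiffV => //; exact: cdiff_id.
have J1 : J 1%N = 0.
  have := @cauchy_formula _ f 1 0 (fun w _ => hf w).
  rewrite cmod0 ltr01 f0 => /(_ isT); rewrite rmorph1 mul1r circ_intE => E.
  by rewrite [RHS]E; apply: eq_cint => s _; rewrite expr1 subr0.
have main z1 : cmod z1 < 1 / 2 -> cmod (f z1 - z1 * J 2%N - z1 ^+ 2 * J 3%N) <= 4 * M * cmod z1 ^+ 3.
  move=> z12; have z11 : cmod z1 < 1 by lra.
  have dist w : cmod w = 1 -> 1 / 2 <= cmod (w - z1).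
    move=> w1; have := ler_distcmod w z1; rewrite w1 ler_norml => /andP[_]; lra.
  have wz w : cmod w = 1 -> w - z1 != 0.
    by move=> w1; rewrite -cmod_gt0; apply: lt_le_trans (dist _ w1); lra.
  have cz w : cmod w = 1 -> cdiff (fun w => (w - z1)^-1) w.
    move=> w1; apply: cdiffV; first exact: wz.
    by apply: cdiffB; [exact: cdiff_id|exact: cdiff_cst].
  have fE : f z1 = cint (fun s => f (u s) * (u s - z1)^-1 * ucirc s).
    have := @cauchy_formula _ f 1 z1 (fun w _ => hf w) z11.
    by rewrite rmorph1 mul1r.
  have -> : f z1 - z1 * J 2%N - z1 ^+ 2 * J 3%N = f z1 - J 1%N - z1 * J 2%N - z1 ^+ 2 * J 3%N.
    by rewrite J1 subr0.
  have cJ n := ck _ (cV n).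
  have cB1 := ccontB (ck _ cz) (cJ 1%N).
  have cM2 := ccontM (ccont_cst z1) (cJ 2%N).
  have cM3 := ccontM (ccont_cst (z1 ^+ 2)) (cJ 3%N).
  rewrite fE /J -(cintZ z1 (cJ 2%N)) -(cintZ (z1 ^+ 2) (cJ 3%N)).
  rewrite -(cintB (ck _ cz) (cJ 1%N)) -(cintB cB1 cM2) -(cintB (ccontB cB1 cM2) cM3).
  have -> : 4 * M * cmod z1 ^+ 3 = 2 * (M * (cmod z1 ^+ 3 * 2)) by ring.
  apply: cmod_cint_le; first exact: ccontB (ccontB cB1 cM2) cM3.
  move=> s _.
  have -> : f (u s) * (u s - z1)^-1 * ucirc s - f (u s) * (u s ^+ 1)^-1 * ucirc s -
     z1 * (f (u s) * (u s ^+ 2)^-1 * ucirc s) - z1 ^+ 2 * (f (u s) * (u s ^+ 3)^-1 * ucirc s) =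
     f (u s) * (z1 ^+ 3 * (u s - z1)^-1 * ((u s)^-1 ^+ 3 * ucirc s)).
    by field; rewrite wz ?u1// u0.
  have e2 : cmod ((u s)^-1 ^+ 3 * ucirc s) = 1.
    by rewrite cmodM cmodX cmodV u1 invr1 expr1n cmod_ucirc mulr1.
  have e3 : cmod (u s - z1)^-1 <= 2.
    rewrite cmodV -[leRHS]invrK lef_pV2 ?posrE ?cmod_gt0 ?wz ?u1//.
    by rewrite -div1r; exact: dist.
  move: e2 (cmodX z1 3) e3; set v1 := _ * ucirc s; set v2 := z1 ^+ 3; set v3 := _^-1.
  move=> e2 e1 e3; rewrite cmodM [cmod (_ * v1)]cmodM [cmod (v2 * v3)]cmodM e2 e1 mulr1.
  apply: ler_pM; rewrite ?cmod_ge0//.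
  - by rewrite mulr_ge0 ?exprn_ge0 ?cmod_ge0.
  - by apply: hM; rewrite subr0.
  - by rewrite ler_wpM2l ?exprn_ge0 ?cmod_ge0.
exists (J 3%N) => e e0.
have D0 : 0 < 4 * M + 1 by lra.
exists (Num.min (1 / 2) (e / (4 * M + 1))); first by rewrite lt_min !divr_gt0.
move=> w; rewrite subr0 lt_min => /andP[w1]; rewrite ltr_pdivlMr// => w2.
have [->|w0] := eqVneq w 0; first by rewrite mulr0 subr0 subrr cmod0 mulr0.
rewrite /g eqxx (negbTE w0).
have m0 : 0 < cmod w by rewrite cmod_gt0.
rewrite -(ler_pM2l m0) -cmodM.
have -> : w * (f w / w - J 2%N - J 3%N * w) = f w - w * J 2%N - w ^+ 2 * J 3%N by field.
apply: (le_trans (main _ w1)).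
have -> : cmod w * (e * cmod w) = e * cmod w ^+ 2 by ring.
have -> : 4 * M * cmod w ^+ 3 = (cmod w * (4 * M)) * cmod w ^+ 2 by ring.
rewrite ler_wpM2r ?exprn_ge0 ?cmod_ge0//; apply: ltW; apply: le_lt_trans w2.
by rewrite ler_wpM2l ?cmod_ge0//; lra.
Qed.

Lemma entire_div f z0 : (forall z, cdiff f z) -> f z0 = 0 ->
  exists2 g, (forall z, cdiff g z) & forall w, f w = (w - z0) * g w.
Proof.
move=> hf f0.
have [||g hg gE] := @entire_div0 (fun w => f (w + z0)) _ _.
- move=> z; apply: (@cdiff_comp _ f (fun w => w + z0)) => //.
  by apply: cdiffD; [exact: cdiff_id|exact: cdiff_cst].
- by rewrite add0r.
exists (fun w => g (w - z0)) => [z|w].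
  apply: (@cdiff_comp _ g (fun w => w - z0)) => //.
  by apply: cdiffB; [exact: cdiff_id|exact: cdiff_cst].
by rewrite -gE subrK.
Qed.

(** A zero of infinite order would make |f| at most M (|w - z0| / rho)^n for
    all n, by the maximum principle for the quotients. *)
Lemma entire_zero_order f z0 : (forall z, cdiff f z) -> (exists z, f z <> 0) ->
  exists n g, [/\ (forall z, cdiff g z), g z0 <> 0 & forall w, f w = (w - z0) ^+ n * g w].
Proof.
move=> hf [z1 f1]; apply: contrapT => no; apply: f1.
have div n : exists2 g, (forall z, cdiff g z) & forall w, f w = (w - z0) ^+ n * g w.
  elim: n => [|n [g hg gE]]; first by exists f => // w; rewrite expr0 mul1r.
  have [g0|g0] := pselect (g z0 = 0); last by exfalso; apply: no; exists n, g.
  have [k hk kE] := entire_div hg g0.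
  by exists k => // w; rewrite gE kE exprSr mulrA.
pose rho := cmod (z1 - z0) + 1.
have rho0 : 0 < rho by rewrite ltr_wpDl// cmod_ge0.
have [M M0 hM] := circle_bounded (fun w (_ : cmod (w - z0) = rho) => hf w).
have bound n : cmod (f z1) * rho ^+ n <= M * cmod (z1 - z0) ^+ n.
  have [g hg gE] := div n.
  have : cmod (g (z1 - z0 + z0)) <= M / rho ^+ n.
    apply: (@maximum_principle _ (fun w => g (w + z0)) rho).
    - move=> w _; apply: (@cdiff_comp _ g (fun w => w + z0)) => //.
      by apply: cdiffD; [exact: cdiff_id|exact: cdiff_cst].
    - move=> w wr; rewrite ler_pdivlMr ?exprn_gt0// -wr -cmodX -cmodM mulrC.
      by have := gE (w + z0); rewrite addrK => <-; apply: hM; rewrite addrK.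
    - by rewrite /rho lerDl.
  rewrite subrK ler_pdivlMr ?exprn_gt0// => h.
  rewrite gE cmodM cmodX -mulrA mulrC; apply: ler_wpM2r h.
  by rewrite exprn_ge0// cmod_ge0.
apply/eqP; rewrite -cmod_eq0; apply/eqP/le_anti; rewrite cmod_ge0 andbT leNgt.
apply/negP => fp.
have : rho <= cmod (z1 - z0).
  apply: (@exprn_le_bounded _ _ _ (M / cmod (f z1))); [exact: ltW|exact: cmod_ge0|].
  by move=> n; rewrite mulrAC ler_pdivlMr// mulrC.
by rewrite /rho; lra.
Qed.

End ZerosOfEntire.

(** * Means of periodic functions *)

Section PeriodicMeans.
Context {R : realType}.
Implicit Types (k : R -> R).

Definition two_pi_periodic k := forall x, k (x + 2 * pi) = k x.

Definition cmean k : R := (2 * pi)^-1 * rint k 0 (2 * pi).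

Lemma pi2_gt0 : 0 < 2 * pi :> R. Proof. by rewrite mulr_gt0// pi_gt0. Qed.

Lemma continuous_icont k a b : continuous k -> icont k a b.
Proof. by move=> ck x _; exact: ck. Qed.

Lemma uniformly_continuous_segment k (a b e : R) : continuous k -> 0 < e ->
  exists2 d : R, 0 < d & forall p q, a <= p <= b -> `|p - q| < d -> `|k p - k q| < e.
Proof.
move=> ck e0.
have : \forall d \near 0^'+, `[a, b] `<=` [set p | forall q, `|p - q| < d -> `|k p - k q| < e].
  have /compact_near_coveringP := @segment_compact R a b; apply => x _.
  have /cvgrPdist_lt/(_ (e / 2)) := ck x; rewrite divr_gt0// => /(_ isT).
  move=> /nbhs_ballP[r /= r0 hr]; have r2 : 0 < r / 2 by rewrite divr_gt0.
  exists (ball x (r / 2), [set d | d < r / 2]) => /=.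
    by split; [exact: nbhsx_ballx|exact: nbhs_right_lt].
  move=> [p d] [/= xp dr] q pq; rewrite /ball /= in xp.
  have h1 : `|k x - k p| < e / 2 by apply: hr; rewrite /ball /=; lra.
  have h2 : `|k x - k q| < e / 2.
    by apply: hr; rewrite /ball /=; move: xp pq dr; rewrite !ltr_norml => /andP[? ?] /andP[? ?] ?; apply/andP; split; lra.
  by move: h1 h2; rewrite !ltr_norml => /andP[? ?] /andP[? ?]; apply/andP; split; lra.
move=> near_d; have [d [hd d0]] := @filter_ex _ (0^'+ : set_system R) _ _ (filterI near_d (nbhs_right_gt 0)).
by exists d => // p q pI; apply: hd; rewrite /= in_itv.
Qed.

Lemma rint_shift k a b (c : R) : a <= b -> continuous k ->
  rint (fun x => k (x + c)) a b = rint k (a + c) (b + c).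
Proof.
move=> ab ck.
have ab' : a + c <= b + c by rewrite lerD2r.
have [K hK] := primitive_exists ab' ck.
rewrite (rint_FTC ab' (@continuous_icont k _ _ ck) hK).
apply: (rint_FTC (F:=fun x => K (x + c))) => //.
  move=> x _; apply: (continuous_comp (f:=fun x => x + c) (g:=k)); last exact: ck.
  by apply: continuousD; [exact: cvg_id|exact: cst_continuous].
move=> x /andP[ax xb].
have H : is_derive (x + c) 1 K (k (x + c)) by apply: hK; rewrite !lerD2r ax xb.
have H2 : is_derive x 1 (fun x : R => x + c) 1 by apply: is_derive_eq; rewrite addr0.
by have := @is_derive1_comp _ K (fun x => x + c) x _ _ H H2; rewrite mulr1.
Qed.

Lemma rint_period k (c : R) : 0 <= c <= 2 * pi -> continuous k -> two_pi_periodic k ->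
  rint k c (c + 2 * pi) = rint k 0 (2 * pi).
Proof.
move=> /andP[c0 c1] ck pk; have p0 := pi2_gt0.
have ci a b := @continuous_icont k a b ck.
rewrite (@rint_cat _ k c (c + 2 * pi) (2 * pi))//; last by rewrite lerDr.
rewrite (@rint_cat _ k 0 (2 * pi) c)// addrC; congr (_ + _).
rewrite -{1}[2 * pi]add0r -rint_shift//.
by apply: eq_rint => x _; exact: pk.
Qed.

Lemma rint_cat_n k (a h : R) n : 0 <= h -> continuous k ->
  rint k a (a + n%:R * h) = \sum_(j < n) rint k (a + j%:R * h) (a + j.+1%:R * h).
Proof.
move=> h0 ck; elim: n => [|n IH].
  by rewrite mul0r addr0 big_ord0 /rint set_itv1 Rintegral_set1.
rewrite big_ord_recr /= -IH; apply: rint_cat; last exact: continuous_icont.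
  by rewrite lerDl mulr_ge0.
by rewrite lerD2l ler_wpM2r// ler_nat.
Qed.

(** Uniform continuity bounds the error on every arc, wherever the partition
    starts. *)
Lemma cmean_riemann k e : continuous k -> two_pi_periodic k -> 0 < e ->
  exists2 N : nat, (0 < N)%N & forall n al, (N <= n)%N -> 0 <= al <= 2 * pi ->
    `|\sum_(j < n) k (al + j%:R * (2 * pi / n%:R)) - n%:R * cmean k| <= n%:R * e.
Proof.
move=> ck pk e0; have p0 := pi2_gt0.
have [d d0 hd] := uniformly_continuous_segment 0 (2 * (2 * pi)) ck e0.
have [N hN] : exists N : nat, 2 * pi / d < N%:R.
  exists (Num.Def.archi_bound (2 * pi / d)); apply: archi_boundP.
  by rewrite divr_ge0// ltW.
exists (maxn N 1); first by rewrite leq_max orbT.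
move=> n al; rewrite geq_max => /andP[Nn n0] alI; have /andP[al0 al1] := alI.
have nR : 0 < n%:R :> R by rewrite ltr0n.
set h := 2 * pi / n%:R.
have h0 : 0 < h by rewrite divr_gt0.
have hdd : h < d.
  rewrite ltr_pdivrMr// [d * _]mulrC -ltr_pdivrMr//; apply: lt_le_trans hN _.
  by rewrite ler_nat.
have nh : n%:R * h = 2 * pi by rewrite /h mulrC divfK// gt_eqF.
have -> : n%:R * cmean k = h^-1 * \sum_(j < n) rint k (al + j%:R * h) (al + j.+1%:R * h).
  rewrite -rint_cat_n ?ltW// nh rint_period// /cmean /h.
  by rewrite invf_div mulrA.
rewrite -(ler_pM2l h0) -[X in X * `|_|](gtr0_norm h0) -normrM mulrBr mulrA divff ?gt_eqF// mul1r.
rewrite mulr_sumr -sumrB; apply: (le_trans (ler_norm_sum _ _ _)).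
have -> : h * (n%:R * e) = \sum_(j < n) (e * h).
  by rewrite sumr_const card_ord -mulr_natl; ring.
apply: ler_sum => j _.
have jn : j.+1%:R * h <= 2 * pi by rewrite -nh ler_wpM2r ?(ltW h0)// ler_nat ltn_ord.
have j0 : 0 <= j%:R * h by rewrite mulr_ge0// ltW.
have jh : j.+1%:R * h = j%:R * h + h by rewrite -natr1 mulrDl mul1r.
have -> : h * k (al + j%:R * h) = rint (fun=> k (al + j%:R * h)) (al + j%:R * h) (al + j.+1%:R * h).
  by rewrite rint_cst ?jh; [ring|lra].
rewrite -rintB; [|exact: icont_cst|exact: continuous_icont].
have -> : e * h = e * (al + j.+1%:R * h - (al + j%:R * h)) by rewrite jh; ring.
apply: rint_norm_le; first by rewrite jh; lra.
  by apply: icontB; [exact: icont_cst|exact: continuous_icont].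
move=> x /andP[x1 x2]; apply/ltW/hd; last by rewrite ltr_norml; apply/andP; split; lra.
by apply/andP; split; lra.
Qed.

Lemma le_cmean k1 k2 : continuous k1 -> continuous k2 -> (forall x, k1 x <= k2 x) ->
  cmean k1 <= cmean k2.
Proof.
move=> c1 c2 h; rewrite ler_pM2l ?invr_gt0 ?pi2_gt0//.
by apply: le_rint => // x xI; [exact: c1|exact: c2].
Qed.

Lemma cmean_cst (c : R) : cmean (fun=> c) = c.
Proof.
by rewrite /cmean rint_cst ?(ltW pi2_gt0)// subr0 mulrC mulfK// gt_eqF ?pi2_gt0.
Qed.

End PeriodicMeans.

(** * The sub-mean-value inequality for the logarithm of the modulus *)

Section Submean.
Context {R : realType}.
Implicit Types (z w a b : R[i]) (f g : R[i] -> R[i]).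

(** max (ln x) (- M), written so as to be continuous at x = 0; M = 0 gives the
    positive part of the logarithm. *)
Definition tlog (M x : R) : R := ln (Num.max x (expR (- M))).

Lemma tlog_geN M x : - M <= tlog M x.
Proof.
rewrite -[leLHS]expRK ler_ln ?posrE ?expR_gt0// ?lt_max ?expR_gt0 ?orbT//.
by rewrite le_max lexx orbT.
Qed.

Lemma tlog_gt0 (M x : R) : 0 < Num.max x (expR (- M)).
Proof. by rewrite lt_max expR_gt0 orbT. Qed.

Lemma expR_tlog M x : x <= expR (tlog M x).
Proof. by rewrite lnK ?posrE ?tlog_gt0// le_max lexx. Qed.

Lemma le_tlog M x y : x <= y -> tlog M x <= tlog M y.
Proof.
move=> xy; rewrite ler_ln ?posrE ?tlog_gt0// ge_max !le_max lexx orbT xy.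
by [].
Qed.

Lemma ln_le_tlog M x : 0 < x -> ln x <= tlog M x.
Proof. by move=> x0; rewrite ler_ln ?posrE ?tlog_gt0// le_max lexx. Qed.

Lemma tlogE M x : expR (- M) <= x -> tlog M x = ln x.
Proof. by move=> h; rewrite /tlog max_l. Qed.

Lemma tlog0_ge0 (x : R) : 0 <= tlog 0 x.
Proof. by have := tlog_geN 0 x; rewrite oppr0. Qed.

Lemma continuous_tlog M (h : R -> R) s : {for s, continuous h} ->
  {for s, continuous (fun p => tlog M (h p))}.
Proof.
move=> ch; apply: (continuous_comp (f:=fun p => Num.max (h p) (expR (- M))) (g:=@ln R)).
  by apply: (@continuous_max R R h (fun=> expR (- M)) s) => //; exact: cst_continuous.
by apply: continuous_ln; exact: tlog_gt0.
Qed.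

Lemma continuous_cmod_path f (x y : R -> R) s : cdiff f (Complex (x s) (y s)) ->
  {for s, continuous x} -> {for s, continuous y} ->
  {for s, continuous (fun p => cmod (f (Complex (x p) (y p))))}.
Proof.
move=> hf cx cy; have [c1 c2] := continuous_cdiff_path hf cx cy.
apply/cvgrPdist_lt => e e0; have e2 : 0 < e / 2 by rewrite divr_gt0.
move/cvgrPdist_lt : c1 => /(_ _ e2) n1; move/cvgrPdist_lt : c2 => /(_ _ e2) n2.
near=> p; apply: (le_lt_trans (ler_distcmod _ _)).
apply: (le_lt_trans (cmod_le_ReIm _)); rewrite cReD cImD cReN cImN [e]splitr.
by apply: ltrD; near: p.
Unshelve. all: by end_near. Qed.

Lemma polar_cos_continuous (t : R) : continuous (fun th : R => t * cos th) /\
  continuous (fun th : R => t * sin th).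
Proof.
split=> th.
  apply: (is_derive_cont (d:=- (t * sin th))).
  by apply: is_derive_eq; rewrite /GRing.scale /=; ring.
exact: (is_derive_cont (d:=t * cos th)).
Qed.

Lemma continuous_cmod_polar f (t : R) : 0 <= t -> (forall w, cmod w = t -> cdiff f w) ->
  continuous (fun th => cmod (f (polar t th))).
Proof.
move=> t0 hf th; have [c1 c2] := polar_cos_continuous t.
apply: continuous_cmod_path; [|exact: c1|exact: c2].
by apply: hf; exact: cmod_polar.
Qed.

Lemma polar_periodic t (th : R) : polar t (th + 2 * pi) = polar t th.
Proof. by rewrite /polar mulr_natl cosD2pi sinD2pi. Qed.

Lemma polarD (t a b : R) : polar t (a + b) = polar 1 a * polar t b.
Proof.
apply/eqP; rewrite eq_complex cReM cImM /= cosD sinD; apply/andP; split; apply/eqP; ring.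
Qed.

Definition logcirc M f t := fun th : R => tlog M (cmod (f (polar t th))).

Lemma logcirc_continuous M f t : 0 <= t -> (forall w, cmod w = t -> cdiff f w) ->
  continuous (logcirc M f t).
Proof.
by move=> t0 hf th; apply: continuous_tlog; exact: continuous_cmod_polar.
Qed.

Lemma logcirc_periodic M f t : two_pi_periodic (logcirc M f t).
Proof. by move=> th; rewrite /logcirc polar_periodic. Qed.

(** The product of the rotates of f by the n-th roots of unity is holomorphic;
    the maximum principle for it turns a supremum of Riemann sums of log|f| on
    the circle into a bound inside. *)
Lemma log_product_bound M f (t e : R) : 0 < t -> (forall w, cmod w <= t -> cdiff f w) ->
  0 < e -> exists2 N : nat, (0 < N)%N & forall n z, (N <= n)%N -> cmod z <= t ->
    \prod_(j < n) cmod (f (polar 1 (j%:R * (2 * pi / n%:R)) * z)) <=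
    expR (n%:R * (cmean (logcirc M f t) + e)).
Proof.
move=> t0 hf e0.
have ck : continuous (logcirc M f t).
  by apply: logcirc_continuous; [exact: ltW|move=> w wt; apply: hf; rewrite wt].
have [N N0 hN] := cmean_riemann ck (@logcirc_periodic M f t) e0.
exists N => // n z Nn zt.
rewrite -cmod_prod.
apply: (@maximum_principle _ (fun z => \prod_(j < n) f (polar 1 (j%:R * (2 * pi / n%:R)) * z)) t) => //.
  move=> w wt; apply: cdiff_prod => j _ _.
  apply: (@cdiff_comp _ f (fun w => polar 1 (j%:R * (2 * pi / n%:R)) * w)).
    by apply: cdiffM; [exact: cdiff_cst|exact: cdiff_id].
  by apply: hf; rewrite cmodM cmod_polar ?mul1r.
move=> w wt; have [al alI wE] := polar_exists w.
rewrite cmod_prod; apply: (@le_trans _ _ (\prod_(j < n) expR (logcirc M f t (al + j%:R * (2 * pi / n%:R))))).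
  apply: ler_prod => j _; rewrite cmod_ge0/= /logcirc addrC polarD -wt -wE.
  exact: expR_tlog.
rewrite -expR_sum ler_expR [n%:R * (_ + e)]mulrDr.
by have := hN n al Nn alI; rewrite ler_norml => /andP[_]; rewrite lerBlDl.
Qed.

(** At the centre the product of the n rotates is the n-th power of f 0; let n
    tend to infinity. *)
Lemma submean_centre M f (t : R) : 0 < t -> (forall w, cmod w <= t -> cdiff f w) ->
  cmod (f 0) <= expR (cmean (logcirc M f t)).
Proof.
move=> t0 hf.
have step e : 0 < e -> cmod (f 0) <= expR (cmean (logcirc M f t) + e).
  move=> e0; have [N N0 hN] := log_product_bound M t0 hf e0.
  have := hN N 0 (leqnn N); rewrite cmod0 => /(_ (ltW t0)).
  under eq_bigr do rewrite mulr0.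
  rewrite prodr_const card_ord expRM_natl.
  by rewrite ler_pXn2r ?nnegrE ?cmod_ge0 ?expR_ge0.
have [f0|f0] := eqVneq (f 0) 0; first by rewrite f0 cmod0 expR_ge0.
have fp : 0 < cmod (f 0) by rewrite cmod_gt0.
rewrite -[cmod (f 0)]lnK ?posrE// ler_expR; apply/ler_addgt0Pr => e e0.
by rewrite -ler_expR lnK ?posrE//; exact: step.
Qed.

End Submean.

(** * A Harnack inequality for the logarithm of the modulus *)

Section Harnack.
Context {R : realType}.
Implicit Types (z w : R[i]) (f : R[i] -> R[i]).

Section BoundaryMap.
Variables (a : R).
Hypotheses (a0 : 0 <= a) (a1 : a < 1).

(** Argument of the boundary value at e^(i th) of the disc automorphism
    w |-> (w + a) / (1 + a w); its derivative is the Poisson kernel. *)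
Definition moebius_arg (th : R) : R := th - 2 * atan (a * sin th / (1 + a * cos th)).

Let acos (th : R) : `|a * cos th| <= a.
Proof. by rewrite normrM ger0_norm// ler_piMr// ler_norml cos_geN1 cos_le1. Qed.

Lemma moebius_den_gt0 (th : R) : 0 < 1 + a * cos th.
Proof. by have := acos th; move: a1; set c := _ * cos th; rewrite ler_norml => ? /andP[? _]; lra. Qed.

Lemma moebius_normsq (th : R) :
  (1 + a * cos th) ^+ 2 + (a * sin th) ^+ 2 = 1 + 2 * a * cos th + a ^+ 2.
Proof.
rewrite sqrrD expr1n !exprMn -addrA -mulrDr cos2Dsin2; ring.
Qed.

Lemma moebius_normsq_gt0 (th : R) : 0 < 1 + 2 * a * cos th + a ^+ 2.
Proof.
rewrite -moebius_normsq ltr_wpDr ?sqr_ge0// exprn_gt0//; exact: moebius_den_gt0.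
Qed.

Lemma moebius_arg_derive (th : R) :
  is_derive th 1 moebius_arg ((1 - a ^+ 2) / (1 + 2 * a * cos th + a ^+ 2)).
Proof.
have x0 := moebius_den_gt0 th; have D0 := moebius_normsq_gt0 th.
have x1 : 1 + a * cos th != 0 by rewrite gt_eqF.
have dq : is_derive th 1 (fun th => a * sin th / (1 + a * cos th))
    ((a * cos th + a ^+ 2) / (1 + a * cos th) ^+ 2).
  apply: is_derive_eq; rewrite /GRing.scale /=.
  have := cos2Dsin2 th; move: x1; set c := cos th; set s := sin th => x1 cs.
  have -> : a * cos th + a ^+ 2 = a * c + a ^+ 2 * (c ^+ 2 + s ^+ 2) by rewrite cs mulr1.
  by field.
have H := @is_derive1_comp _ atan (fun th => a * sin th / (1 + a * cos th)) th _ _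
   (is_derive1_atan _) dq.
rewrite /moebius_arg; apply: is_derive_eq; rewrite /GRing.scale /=.
have N := moebius_normsq th.
have E : (1 + (a * sin th / (1 + a * cos th)) ^+ 2)^-1 =
    (1 + a * cos th) ^+ 2 / (1 + 2 * a * cos th + a ^+ 2).
  have D1 := D0; rewrite -N in D1 *.
  by field; rewrite x1 (lt0r_neq0 D1).
by rewrite E; field; rewrite x1 (lt0r_neq0 D0).
Qed.

Lemma moebius_arg_polar (th : R) :
  polar 1 (moebius_arg th) * (1 + real_complex R a * polar 1 th) = polar 1 th + real_complex R a.
Proof.
have x0 := moebius_den_gt0 th.
have x1 : 1 + a * cos th != 0 by rewrite gt_eqF.
pose q := a * sin th / (1 + a * cos th).
have q0 : 0 < 1 + q ^+ 2 by rewrite ltr_pwDl// sqr_ge0.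
have c2 : cos (atan q) ^+ 2 = (1 + q ^+ 2)^-1.
  by rewrite cos_atan exprVn sqr_sqrtr// ltW.
have c0 : cos (atan q) != 0 by rewrite gt_eqF// cos_atan invr_gt0 sqrtr_gt0.
have sE : sin (atan q) = q * cos (atan q).
  by rewrite -{2}(atanK q) /tan divfK.
have C2 : cos (2 * atan q) = (1 - q ^+ 2) / (1 + q ^+ 2).
  have -> : 2 * atan q = atan q + atan q by ring.
  by rewrite cosD sE -expr2 -c2; ring.
have S2 : sin (2 * atan q) = 2 * q / (1 + q ^+ 2).
  have -> : 2 * atan q = atan q + atan q by ring.
  by rewrite sinD sE -c2; ring.
have -> : polar 1 (moebius_arg th) = polar 1 th * polar 1 (- (2 * atan q)).
  by rewrite -polarD.
have cs := cos2Dsin2 th.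
have P : polar 1 (- (2 * atan q)) * (1 + real_complex R a * polar 1 th) =
    Complex (1 + a * cos th) (- (a * sin th)).
  have qE : a * sin th = q * (1 + a * cos th) by rewrite /q divfK.
  have q1 : 1 + q ^+ 2 != 0 by rewrite gt_eqF.
  apply/eqP; rewrite eq_complex cReM cImM !(cReD, cImD, cReM, cImM) /= cosN sinN C2 S2.
  rewrite !mul1r !mul0r subr0 addr0 add0r qE; by apply/andP; split; apply/eqP; field.
rewrite -mulrA P; apply/eqP; rewrite eq_complex cReM cImM cReD cImD /= !mul1r addr0.
apply/andP; split; apply/eqP; last ring.
have -> : cos th + a = cos th + a * (cos th ^+ 2 + sin th ^+ 2) by rewrite cs mulr1.
ring.
Qed.

Lemma moebius_arg_range (th : R) : th - pi <= moebius_arg th <= th + pi.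
Proof.
have := atan_gtNpi2 (a * sin th / (1 + a * cos th)).
have := atan_ltpi2 (a * sin th / (1 + a * cos th)).
rewrite /moebius_arg; set A := atan _; set p := pi => h1 h2; apply/andP; split; lra.
Qed.

Lemma moebius_arg0 : moebius_arg 0 = 0.
Proof. by rewrite /moebius_arg sin0 mulr0 mul0r atan0 mulr0 subr0. Qed.

Lemma moebius_arg2pi : moebius_arg (2 * pi) = 2 * pi.
Proof.
have -> : 2 * pi = pi *+ 2 :> R by rewrite mulr_natl.
by rewrite /moebius_arg sin2pi mulr0 mul0r atan0 mulr0 subr0.
Qed.

(** Change of variables along the boundary map: the Poisson kernel is at least
    (1 - a) / (1 + a). *)
Lemma cmean_moebius (k : R -> R) (eta : R) : 0 <= eta <= 2 * pi -> continuous k ->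
  two_pi_periodic k -> (forall x, 0 <= k x) ->
  cmean (fun th => k (eta + moebius_arg th)) <= (1 + a) / (1 - a) * cmean k.
Proof.
move=> etaI ck pk k0; have p0 := @pi2_gt0 R.
rewrite /cmean mulrCA ler_pM2l ?invr_gt0// -(@rint_period _ k eta etaI)//.
have /andP[eta0 eta1] := etaI.
have pp : 0 < pi :> R := pi_gt0 R.
have c8 : - (2 * pi) <= 6 * pi :> R by move: pp; set p := pi; lra.
have [K hK] := primitive_exists c8 ck.
have dens : continuous (fun th => (1 - a ^+ 2) / (1 + 2 * a * cos th + a ^+ 2)).
  move=> th; apply: (@continuousM _ _ (fun=> 1 - a ^+ 2) (fun th : R => (1 + 2 * a * cos th + a ^+ 2)^-1));
    first exact: cst_continuous.
  apply: (@continuousV _ _ (fun th : R => 1 + 2 * a * cos th + a ^+ 2)); first by rewrite gt_eqF// moebius_normsq_gt0.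
  apply: (is_derive_cont (d:=- (2 * a * sin th))).
  by apply: is_derive_eq; rewrite /GRing.scale /=; ring.
have cal : continuous (fun th => k (eta + moebius_arg th)).
  move=> th; apply: (continuous_comp (f:=fun th => eta + moebius_arg th) (g:=k)); last exact: ck.
  apply: continuousD; first exact: cst_continuous.
  exact: (is_derive_cont (moebius_arg_derive th)).
have dK (th : R) : 0 <= th <= 2 * pi -> is_derive th 1 (fun th => K (eta + moebius_arg th))
    (k (eta + moebius_arg th) * ((1 - a ^+ 2) / (1 + 2 * a * cos th + a ^+ 2))).
  move=> /andP[t0 t1].
  have H2 : is_derive th 1 (fun th => eta + moebius_arg th)
      ((1 - a ^+ 2) / (1 + 2 * a * cos th + a ^+ 2)).
    have := is_deriveD (is_derive_cst eta th 1) (moebius_arg_derive th).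
    by rewrite add0r.
  have H1 : is_derive (eta + moebius_arg th) 1 K (k (eta + moebius_arg th)).
    apply: hK; have := moebius_arg_range th; move: pp eta0 eta1 t0 t1.
    by set p := pi; set m := moebius_arg _ => ? ? ? ? ? /andP[? ?]; apply/andP; split; lra.
  exact: (@is_derive1_comp _ K (fun th => eta + moebius_arg th) th _ _ H1 H2).
have kprod : continuous (fun th =>
    k (eta + moebius_arg th) * ((1 - a ^+ 2) / (1 + 2 * a * cos th + a ^+ 2))).
  by move=> th; apply: (@continuousM _ _ (fun th => k (eta + moebius_arg th))); [exact: cal|exact: dens].
have E : rint k eta (eta + 2 * pi) = rint (fun th =>
    k (eta + moebius_arg th) * ((1 - a ^+ 2) / (1 + 2 * a * cos th + a ^+ 2))) 0 (2 * pi).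
  rewrite (rint_FTC (ltW p0) (@continuous_icont _ _ _ _ kprod) dK).
  rewrite moebius_arg0 moebius_arg2pi addr0; apply: rint_FTC.
  - by rewrite lerDl ltW.
  - exact: continuous_icont.
  - move=> x /andP[x1 x2]; apply: hK; move: pp eta0 eta1 x1 x2.
    by set p := pi => ? ? ? ? ?; apply/andP; split; lra.
have a10 : 0 < 1 - a by rewrite subr_gt0.
rewrite E -rintZ; last exact: continuous_icont.
apply: le_rint; first exact: continuous_icont.
  apply: icontM; [exact: icont_cst|exact: continuous_icont].
move=> th _; rewrite mulrCA ler_peMr//.
have D0 := moebius_normsq_gt0 th.
rewrite mulrA ler_pdivlMr// mul1r.
have -> : (1 + a) / (1 - a) * (1 - a ^+ 2) = (1 + a) ^+ 2.
  by field; rewrite gt_eqF.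
have := acos th; rewrite ler_norml => /andP[_].
have -> : (1 + a) ^+ 2 = 1 + 2 * a + a ^+ 2 by ring.
have -> : 2 * a * cos th = 2 * (a * cos th) by ring.
by set c := a * cos th; lra.
Qed.

End BoundaryMap.

(** Harnack-type bound for the subharmonic function log+|f|, obtained by moving
    the point to the centre with a disc automorphism. *)
Lemma harnack_log f (rho : R) z : (forall w, cmod w <= rho -> cdiff f w) -> cmod z < rho ->
  tlog 0 (cmod (f z)) <= (rho + cmod z) / (rho - cmod z) * cmean (logcirc 0 f rho).
Proof.
move=> hf zr; have rho0 : 0 < rho := le_lt_trans (cmod_ge0 z) zr.
pose a := cmod z / rho.
have a0 : 0 <= a by rewrite divr_ge0 ?cmod_ge0// ltW.
have a1 : a < 1 by rewrite ltr_pdivrMr// mul1r.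
have [eta etaI zE] := polar_exists z.
pose cr x := real_complex R x.
pose phi w := polar 1 eta * (cr rho * (w + cr (a * rho)) / (cr rho + cr a * w)).
have den w : cmod w <= rho -> cr rho + cr a * w != 0.
  move=> wr; rewrite -cmod_gt0.
  have := cmodD (cr rho + cr a * w) (- (cr a * w)).
  rewrite addrK cmodN cmodM !cmod_real !ger0_norm ?(ltW rho0)// => h.
  have : a * cmod w <= a * rho by rewrite ler_wpM2l.
  have : 0 < (1 - a) * rho by rewrite mulr_gt0// subr_gt0.
  by lra.
have dphi w : cmod w <= rho -> cdiff phi w.
  move=> wr; apply: cdiffM; first exact: cdiff_cst.
  apply: cdiffM.
    by apply: cdiffM; [exact: cdiff_cst|apply: cdiffD; [exact: cdiff_id|exact: cdiff_cst]].
  apply: cdiffV; first exact: den.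
  by apply: cdiffD; [exact: cdiff_cst|apply: cdiffM; [exact: cdiff_cst|exact: cdiff_id]].
have phir w : cmod w <= rho -> cmod (phi w) <= rho.
  move=> wr; rewrite !cmodM cmod_polar// mul1r cmodV ler_pdivrMr ?cmod_gt0 ?den//.
  rewrite cmod_real ger0_norm ?(ltW rho0)// ler_wpM2l ?(ltW rho0)//.
  rewrite -(ler_pXn2r (n:=2)) ?nnegrE ?cmod_ge0// !cmod_sqr.
  have : cmod w ^+ 2 <= rho ^+ 2 by apply: lerXn2r; rewrite ?nnegrE ?cmod_ge0 ?(ltW rho0).
  rewrite cmod_sqr; case: w wr => x y _ /=.
  rewrite !mul0r !subr0 !addr0 !add0r => h.
  have : 0 <= (1 - a ^+ 2) * (rho ^+ 2 - (x ^+ 2 + y ^+ 2)).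
    by rewrite mulr_ge0 ?subr_ge0// expr_le1// ltW.
  by lra.
have phi0 : phi 0 = z.
  rewrite /phi add0r mulr0 addr0 mulrAC divff ?mul1r; last by rewrite -cmod_gt0 cmod_real normr_gt0 gt_eqF.
  have -> : a * rho = cmod z by rewrite /a divfK// gt_eqF.
  have <- : polar (cmod z) 0 = cr (cmod z) by rewrite /polar cos0 sin0 mulr1 mulr0.
  by rewrite -polarD addr0 -zE.
have bd th : phi (polar rho th) = polar rho (eta + moebius_arg a th).
  rewrite polarD /phi; congr (_ * _).
  have pr (x : R) : polar rho x = cr rho * polar 1 x by rewrite [LHS]polarE [polar 1 x]polarE rmorph1 mul1r.
  have d0 := den (polar rho th); rewrite cmod_polar ?(ltW rho0)// lexx in d0.
  have {}d0 := d0 isT.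
  apply: (mulIf d0); rewrite divfK// !pr.
  have -> : cr rho * polar 1 (moebius_arg a th) * (cr rho + cr a * (cr rho * polar 1 th)) =
     cr rho * (cr rho * (polar 1 (moebius_arg a th) * (1 + cr a * polar 1 th))) by ring.
  by rewrite moebius_arg_polar// /cr rmorphM; ring.
have dg w : cmod w <= rho -> cdiff (fun w => f (phi w)) w.
  by move=> wr; apply: (@cdiff_comp _ f phi); [exact: dphi|apply: hf; exact: phir].
have := submean_centre 0 rho0 dg; rewrite phi0 => h.
have lE : logcirc 0 (fun w => f (phi w)) rho = fun th => logcirc 0 f rho (eta + moebius_arg a th).
  by apply/funext => th; rewrite /logcirc bd.
have ck : continuous (logcirc 0 f rho).
  by apply: logcirc_continuous; [exact: ltW|move=> w wr; apply: hf; rewrite wr].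
have := cmean_moebius a0 a1 etaI ck (@logcirc_periodic _ _ _ _) (fun x => tlog0_ge0 _).
rewrite -lE; set m := cmean _ in h * => hm.
have -> : (rho + cmod z) / (rho - cmod z) = (1 + a) / (1 - a).
  by rewrite /a; field; rewrite (lt0r_neq0 rho0) (@lt0r_neq0 _ (rho - cmod z)) ?subr_gt0.
apply: le_trans hm; have m0 : 0 <= m.
  rewrite -(cmean_cst 0); apply: le_cmean; first exact: cst_continuous.
    rewrite lE => th; apply: (continuous_comp (f:=fun th => eta + moebius_arg a th) (g:=logcirc 0 f rho)); last exact: ck.
    apply: (@continuousD _ _ _ (fun=> eta)); first exact: cst_continuous.
    exact: (is_derive_cont (moebius_arg_derive a0 a1 th)).
  by move=> th; exact: tlog0_ge0.
apply: (le_trans (le_tlog 0 h)); rewrite tlogE ?expRK//.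
by rewrite ler_expR oppr0.
Qed.

End Harnack.

(** * Poles of meromorphic functions *)

Section Poles.
Context {R : realType}.
Local Notation C := (R[i])^o.
Implicit Types (z w b : R[i]) (f g H : R[i] -> R[i]) (F : R[i] -> option R[i]).

Lemma cdiff_zero_limit h z (d : R) : cdiff h z -> 0 < d ->
  (forall w, w != z -> cmod (w - z) < d -> h w = 0) -> h z = 0.
Proof.
move=> /cdiff_continuous ch d0 hd; apply/eqP; rewrite -cmod_eq0; apply/eqP/le_anti.
rewrite cmod_ge0 andbT; apply/ler_addgt0Pr => e e0; rewrite add0r.
have [del del0 hdel] := ch _ e0.
pose x := Num.min d del / 2.
have x0 : 0 < x by rewrite divr_gt0// lt_min d0.
have xm : x < Num.min d del by rewrite /x ltr_pdivrMr// ltr_pMr ?lt_min ?d0// ltr1n.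
have wz : cmod (z + real_complex R x - z) = x.
  by rewrite addrC addKr cmod_real gtr0_norm.
have := hdel (z + real_complex R x); rewrite wz (lt_le_trans xm) ?ge_min ?lexx ?orbT// => /(_ isT).
rewrite hd ?wz//; last by rewrite (lt_le_trans xm)// ge_min lexx.
  by rewrite sub0r cmodN => /ltW.
by rewrite -subr_eq0 -cmod_eq0 wz gt_eqF.
Qed.

Lemma pole_order_radius F z n : pole_order F z n -> exists g (d : R),
  [/\ 0 < d, forall w, cmod (w - z) < d -> cdiff g w, ((0 < n)%N -> g z <> 0) &
   forall w, cmod (w - z) < d ->
     F w = if (w == z) && (0 < n)%N then None else Some (g w / (w - z) ^+ n)].
Proof.
move=> [g [/nearC_cmod[d1 d10 h1] gz /nearC_cmod[d2 d20 h2]]].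
exists g, (Num.min d1 d2); split => //; first by rewrite lt_min d10.
  by move=> w; rewrite lt_min => /andP[+ _] => /h1/holo_cdiff.
by move=> w; rewrite lt_min => /andP[_ /h2].
Qed.

Lemma pole_order_uniq F z n m : pole_order F z n -> pole_order F z m -> n = m.
Proof.
wlog nm : n m / (n <= m)%N.
  by move=> h; have [/h//|/ltnW/h h2 a b] := leqP n m; rewrite (h2 b a).
move=> /pole_order_radius[g1 [d1 [d10 c1 n1 e1]]] /pole_order_radius[g2 [d2 [d20 c2 n2 e2]]].
apply/eqP; move: nm; rewrite leq_eqVlt => /orP[//|nm]; exfalso.
have m0 : (0 < m)%N by apply: leq_ltn_trans nm.
apply: (n2 m0).
have z1 : cmod (z - z) < d1 by rewrite subrr cmod0.
have z2 : cmod (z - z) < d2 by rewrite subrr cmod0.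
have H : cdiff (fun w => g2 w - g1 w * (w - z) ^+ (m - n)) z.
  apply: cdiffB; first exact: c2.
  apply: cdiffM; first exact: c1.
  by apply: cdiffX; apply: cdiffB; [exact: cdiff_id|exact: cdiff_cst].
have d0 : 0 < Num.min d1 d2 by rewrite lt_min d10.
have := cdiff_zero_limit H d0; rewrite subrr expr0n subn_eq0 leqNgt nm mulr0 subr0; apply.
move=> w wz; rewrite lt_min => /andP[/e1 E1 /e2]; rewrite E1 (negbTE wz) /= => -[E].
have wz0 : w - z != 0 by rewrite subr_eq0.
apply/eqP; rewrite subr_eq0; apply/eqP.
apply: (mulIf (x:=(w - z) ^- m)); first by rewrite invr_eq0 expf_neq0.
have mE : (w - z) ^+ m = (w - z) ^+ (m - n) * (w - z) ^+ n by rewrite -exprD subnK ?(ltnW nm).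
by rewrite -E mE; field; rewrite !expf_neq0.
Qed.

Lemma pole_multE F z n : pole_order F z n -> pole_mult F z = n.
Proof. by move=> hn; rewrite /pole_mult; case: xgetP => [m _ hm|/(_ n)//]; exact: pole_order_uniq hm hn. Qed.

Lemma pole_multP F z : meromorphic F -> pole_order F z (pole_mult F z).
Proof. by move=> /(_ z)[n hn]; rewrite (pole_multE hn). Qed.

Lemma poles_isolated F z : meromorphic F -> exists2 d : R, 0 < d &
  forall w, w != z -> cmod (w - z) < d -> pole_mult F w = 0%N.
Proof.
move=> /(pole_multP z)/pole_order_radius[g [d [d0 cg _ FE]]]; exists d => // w wz wd.
apply: pole_multE; exists (fun v => g v / (v - z) ^+ pole_mult F z).
have e0 : 0 < Num.min (d - cmod (w - z)) (cmod (w - z)).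
  by rewrite lt_min subr_gt0 wd cmod_gt0 subr_eq0.
have near_ v : cmod (v - w) < Num.min (d - cmod (w - z)) (cmod (w - z)) -> cmod (v - z) < d /\ v != z.
  rewrite lt_min => /andP[v1 v2]; split.
    have -> : v - z = (v - w) + (w - z) by ring.
    by apply: (le_lt_trans (cmodD _ _)); rewrite -ltrBrDr.
  by apply/eqP => vz; move: v2; rewrite vz cmodB ltxx.
split => //.
  apply/nearC_cmod; exists (Num.min (d - cmod (w - z)) (cmod (w - z))) => // v /near_[vd vz].
  apply/holo_cdiff; apply: cdiffM; first exact: cg.
  apply: cdiffV; first by rewrite expf_neq0// subr_eq0.
  by apply: cdiffX; apply: cdiffB; [exact: cdiff_id|exact: cdiff_cst].
apply/nearC_cmod; exists (Num.min (d - cmod (w - z)) (cmod (w - z))) => // v /near_[vd vz].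
by rewrite (FE _ vd) (negbTE vz) andbF /= expr0 divr1.
Qed.

(** Poles are isolated, so finiteness holds on small squares; a union of four
    finite sets being finite, bisection extends it to large ones. *)
Lemma finite_poles F (rho : R) : meromorphic F -> exists2 S : seq R[i], uniq S &
  forall z, (z \in S) = (cmod z <= rho) && (0 < pole_mult F z)%N.
Proof.
move=> mF; suff [s hs] : exists s : seq R[i], forall z, cmod z <= rho -> (0 < pole_mult F z)%N -> z \in s.
  exists (undup [seq z <- s | (cmod z <= rho) && (0 < pole_mult F z)%N]); first exact: undup_uniq.
  move=> z; rewrite mem_undup mem_filter; apply/andP/andP => [[/andP//]|[a b]].
  by rewrite a b hs.
pose P (x y h : R) := exists s : seq R[i], forall z, x <= complex.Re z <= x + h ->
  y <= complex.Im z <= y + h -> (0 < pole_mult F z)%N -> z \in s.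
suff [s hs] : P (- (`|rho| + 1)) (- (`|rho| + 1)) (2 * (`|rho| + 1)).
  exists s => z zr; have r0 := le_trans zr (ler_norm rho).
  have := le_trans (ge_cmod_Re z) r0; have := le_trans (ge_cmod_Im z) r0.
  by rewrite !ler_norml => /andP[? ?] /andP[? ?]; apply: hs; apply/andP; split; lra.
apply: bisection; first by rewrite mulr_gt0// ltr_wpDl.
  move=> x y h h0 [s1 h1] [s2 h2] [s3 h3] [s4 h4]; exists (s1 ++ s2 ++ s3 ++ s4).
  move=> z /andP[x1 x2] /andP[y1 y2] pz; rewrite !mem_cat.
  have [zx|/ltW zx] := leP (complex.Re z) (x + h / 2); have [zy|/ltW zy] := leP (complex.Im z) (y + h / 2).
  - by rewrite h1// ?x1 ?y1.
  - by rewrite h3 ?orbT//; apply/andP; split; lra.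
  - by rewrite h2 ?orbT//; apply/andP; split; lra.
  - by rewrite h4 ?orbT//; apply/andP; split; lra.
move=> x y _ _; have [d d0 hd] := poles_isolated (Complex x y) mF.
exists (d / 2); first by rewrite divr_gt0.
move=> x' y' h' h0 h'd /andP[x1 x2] /andP[y1 y2]; exists [:: Complex x y].
move=> z /andP[z1 z2] /andP[z3 z4] pz; rewrite inE; apply/negPn/negP => nz.
move: pz; rewrite hd//; apply: (le_lt_trans (cmod_le_ReIm _)).
rewrite cReD cImD cReN cImN /=.
have : `|complex.Re z - x| <= h' by rewrite ler_norml; apply/andP; split; lra.
have : `|complex.Im z - y| <= h' by rewrite ler_norml; apply/andP; split; lra.
by lra.
Qed.

(** Multiplying by the polynomial with the poles as roots leaves a holomorphic
    function on the closed disc; its value at a pole is that of the local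
    numerator, so it does not vanish there. *)
Lemma clear_poles F (rho : R) (S : seq R[i]) : meromorphic F -> uniq S ->
  (forall z, (z \in S) = (cmod z <= rho) && (0 < pole_mult F z)%N) ->
  exists H, [/\ forall z, cmod z <= rho -> cdiff H z, forall z, z \in S -> H z <> 0 &
    forall z, cmod z <= rho ->
      F z = if z \in S then None else Some (H z / \prod_(b <- S) (z - b) ^+ pole_mult F b)].
Proof.
move=> mF uS hS.
have loc z : exists gd : (R[i] -> R[i]) * R, [/\ 0 < gd.2,
   forall w, cmod (w - z) < gd.2 -> cdiff gd.1 w, ((0 < pole_mult F z)%N -> gd.1 z <> 0),
   forall w, cmod (w - z) < gd.2 ->
     F w = if (w == z) && (0 < pole_mult F z)%N then None else Some (gd.1 w / (w - z) ^+ pole_mult F z) &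
   forall w, w != z -> cmod (w - z) < gd.2 -> pole_mult F w = 0%N].
  have [g [d [d0 cg gz FE]]] := pole_order_radius (pole_multP z mF).
  have [e e0 he] := poles_isolated z mF.
  exists (g, Num.min d e); split => //=; first by rewrite lt_min d0.
  - by move=> w; rewrite lt_min => /andP[/cg].
  - by move=> w; rewrite lt_min => /andP[/FE].
  - by move=> w wz; rewrite lt_min => /andP[_ /(he _ wz)].
have [gd gdP] := choice loc.
have at0 z : cmod (z - z) < (gd z).2 by rewrite subrr cmod0; have [] := gdP z.
exists (fun w => (gd w).1 w * \prod_(b <- S | b != w) (w - b) ^+ pole_mult F b).
have prodS z : z \in S -> forall w, \prod_(b <- S) (w - b) ^+ pole_mult F b =
    (w - z) ^+ pole_mult F z * \prod_(b <- S | b != z) (w - b) ^+ pole_mult F b.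
  by move=> zS w; rewrite (bigD1_seq z).
have prodN z w : z \notin S -> \prod_(b <- S | b != z) (w - b) ^+ pole_mult F b =
    \prod_(b <- S) (w - b) ^+ pole_mult F b.
  move=> zS; rewrite big_seq_cond [RHS]big_seq_cond; apply: eq_bigl => b.
  by case bS : (b \in S) => //=; apply/eqP => bz; move: zS; rewrite -bz bS.
have nopole z : cmod z <= rho -> z \notin S -> pole_mult F z = 0%N.
  by move=> zr; rewrite hS zr /= -eqn0Ngt => /eqP.
split.
- move=> z zr; have [d0 cg gz FE iso] := gdP z.
  apply: (near_cdiff (f:=fun w => (gd z).1 w * \prod_(b <- S | b != z) (w - b) ^+ pole_mult F b)).
    apply/nearC_cmod; exists (gd z).2 => // w wd; have [->//|wz] := eqVneq w z.
    have w0 := iso _ wz wd; have wS : w \notin S by rewrite hS w0 ltnn andbF.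
    have [_ _ _ FEw _] := gdP w.
    move: (FEw w (at0 w)); rewrite (FE w wd) (negbTE wz) /= w0 ltnn andbF expr0 divr1 => -[<-].
    rewrite (prodN w w wS); have [zS|zS] := boolP (z \in S).
      by rewrite (prodS z zS) mulrA divfK// expf_neq0// subr_eq0.
    by rewrite (nopole z zr zS) expr0 divr1 (prodN z w zS).
  apply: cdiffM; first exact/cg/at0.
  apply: cdiff_prod => b _ _.
  by apply: cdiffX; apply: cdiffB; [exact: cdiff_id|exact: cdiff_cst].
- move=> z zS; have := zS; rewrite hS => /andP[_ pz]; have [_ _ gz _ _] := gdP z.
  apply/eqP; rewrite mulf_neq0//; first exact/eqP/gz.
  rewrite -cmod_gt0 cmod_prod; apply: prodr_gt0 => b bz.
  by rewrite cmodX exprn_gt0// cmod_gt0 subr_eq0 eq_sym.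
- move=> z zr; have [_ _ _ FE _] := gdP z; rewrite (FE z (at0 z)) eqxx /=.
  have [zS|zS] := boolP (z \in S); first by move: zS; rewrite hS zr /= => ->.
  rewrite (nopole z zr zS) ltnn expr0 divr1 (prodN z z zS) mulfK//.
  rewrite -cmod_gt0 cmod_prod big_seq; apply: prodr_gt0 => b bS.
  rewrite cmodX exprn_gt0// cmod_gt0 subr_eq0; apply/eqP => zb; move: zS.
  by rewrite zb bS.
Qed.

End Poles.

(** * The counting function of poles *)

Section CountingFunctions.
Context {R : realType}.
Implicit Types (z w b : R[i]) (F : R[i] -> option R[i]).

(** The integral of a nonnegative function is defined as a supremum over the simple
    functions below it, for arbitrary functions. *)
Lemma ge0_le_integral_any d (T : measurableType d) (mu : {measure set T -> \bar R})
    (D : set T) (f g : T -> \bar R) :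
  (forall x, D x -> 0 <= f x)%E -> (forall x, D x -> f x <= g x)%E ->
  (\int[mu]_(x in D) f x <= \int[mu]_(x in D) g x)%E.
Proof.
move=> f0 fg; rewrite !ge0_integralE//; last first.
  by move=> x Dx; exact: le_trans (f0 _ Dx) (fg _ Dx).
apply: le_ereal_sup => _ [h hf <-]; exists h => // x.
apply: le_trans (hf x) _; rewrite !patchE; case: ifPn => // /set_mem Dx; exact: fg.
Qed.

Lemma rint_EFin (h : R -> R) (a b : R) : icont h a b ->
  (\int[@lebesgue_measure R]_(x in `[a, b]) (h x)%:E = (rint h a b)%:E)%E.
Proof.
move=> hc; rewrite /rint /Rintegral fineK//.
by apply: integrable_fin_num => //; exact: icont_integrable.
Qed.

Lemma continuous_inv_pos (x : R) : 0 < x -> {for x, continuous (@GRing.inv R)}.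
Proof. by move=> x0; apply: (@continuousV _ _ id); rewrite ?gt_eqF//; exact: cvg_id. Qed.

Lemma inv_fromE (be : R) : (fun x : R => if be <= x then x^-1 else 0) =
  (fun x : R => x^-1) \_ `[be, +oo[.
Proof. by apply/funext => x; rewrite patchE mem_setE in_itv /= andbT; case: ifP. Qed.

Lemma measurable_inv_from (be t : R) : 0 <= be ->
  measurable_fun `]0%R, t] (fun x : R => if be <= x then x^-1 else 0).
Proof.
move=> b0; rewrite inv_fromE; apply/measurable_restrict => //.
have mi : measurable_fun `](0 : R), +oo[ (fun x : R => x^-1).
  apply: open_continuous_measurable_fun => [|x]; first exact: interval_open.
  by rewrite inE /= in_itv /= andbT => x0; exact: continuous_inv_pos.
apply: measurable_funS mi => //.
by move=> x /= []; rewrite !in_itv /= => /andP[-> _].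
Qed.

Lemma integral_inv_from (be t : R) : 0 < be -> 0 < t ->
  (\int[@lebesgue_measure R]_(x in `]0%R, t]) (if be <= x then x^-1 else 0%R)%:E =
   (ln (Num.max t be) - ln be)%:E)%E.
Proof.
move=> b0 t0.
have -> : (fun x : R => (if be <= x then x^-1 else 0)%:E) = (fun x : R => (x^-1)%:E) \_ `[be, +oo[.
  by apply/funext => x; rewrite patchE mem_setE in_itv /= andbT; case: ifP.
rewrite -integral_mkcondr (_ : _ `&` _ = `[be, t]%classic); last first.
  rewrite eqEsubset; split=> x /=; rewrite !in_itv/= ?andbT.
    by move=> [/andP[_ ->] ->].
  by move=> /andP[bx ->]; rewrite (lt_le_trans b0 bx) bx.
have [bt|tb] := leP be t; last first.
  rewrite set_itv_ge ?bnd_simp -?ltNge// integral_set0.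
  by rewrite subrr.
have ic : icont (@GRing.inv R) be t.
  by move=> x /andP[bx _]; apply: continuous_inv_pos; exact: lt_le_trans bx.
have dl (x : R) : be <= x <= t -> is_derive x 1 (@ln R) x^-1.
  by move=> /andP[bx _]; apply: is_derive1_ln; exact: lt_le_trans bx.
by rewrite rint_EFin// (rint_FTC bt ic dl).
Qed.

Section PoleSet.
Variables (F : R[i] -> option R[i]) (rho : R) (S : seq R[i]).
Hypothesis uS : uniq S.
Hypothesis SE : forall z, (z \in S) = (cmod z <= rho) && (0 < pole_mult F z)%N.

Lemma npolesE t : t <= rho ->
  npoles t F = (\sum_(b <- S | cmod b <= t) (pole_mult F b)%:R)%:E.
Proof.
move=> tr; rewrite /npoles (esumID [set` [seq b <- S | cmod b <= t]])//.
rewrite [X in (_ + X)%E]esum1; last first.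
  move=> z [/= zt /negP]; rewrite mem_filter zt /= SE (le_trans zt tr) /=.
  by rewrite lt0n negbK => /eqP ->.
rewrite adde0 setIidr; last first.
  by move=> z /=; rewrite mem_filter => /andP[].
rewrite esum_fset; [|exact: finite_seq|by move=> z _; rewrite lee_fin].
by rewrite -fsbig_seq ?filter_uniq// big_filter sumEFin.
Qed.

(** Each pole contributes an integral of 1/x from its modulus on; with the
    convention ln 0 = 0 the formula also covers a pole at the origin. *)
Lemma NpolesE t : 0 < t -> t <= rho ->
  Npoles t F = (\sum_(b <- S) (pole_mult F b)%:R * (ln (Num.max t (cmod b)) - ln (cmod b)))%:E.
Proof.
move=> t0 tr; rewrite /Npoles (npolesE (le_trans (ltW t0) tr)).
pose S' := [seq b <- S | b != 0].
have E1 x : x \in `]0%R, t]%classic -> ((npoles x F - (\sum_(b <- S | cmod b <= 0) (pole_mult F b)%:R)%:E) * (x^-1)%:E =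
    \sum_(b <- S') (((pole_mult F b)%:R)%:E * ((if cmod b <= x then x^-1 else 0)%R)%:E))%E.
  rewrite inE /= in_itv /= => /andP[x0 xt]; rewrite (npolesE (le_trans xt tr)).
  rewrite -EFinB -EFinM big_filter.
  under [RHS]eq_bigr do rewrite -EFinM.
  rewrite sumEFin; congr EFin.
  rewrite (bigID (fun b => b == 0)) /=.
  have -> : \sum_(i <- S | (cmod i <= x) && (i == 0)) (pole_mult F i)%:R =
     \sum_(b <- S | cmod b <= 0) (pole_mult F b)%:R :> R.
    apply: eq_bigl => b; rewrite -[cmod b <= 0]andbT; have [->|b0] := eqVneq b 0.
      by rewrite cmod0 lexx ltW.
    by rewrite andbF andbT leNgt cmod_gt0 b0.
  rewrite [X in (X - _) * _]addrC addrK mulr_suml big_mkcond [RHS]big_mkcond; apply: eq_bigr => b _.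
  by case: (cmod b <= x); case: (b != 0); rewrite //= mulr0.
under eq_integral => x xI do rewrite (E1 x xI).
rewrite ge0_integral_sum//; last 2 first.
- move=> b; apply: measurable_funeM; apply/measurable_EFinP.
  apply: measurable_inv_from; exact: cmod_ge0.
- move=> b x /=; rewrite in_itv /= => /andP[x0 _]; apply: mule_ge0; rewrite lee_fin//.
  by case: ifP => // _; rewrite invr_ge0 ltW.
have E2 b : b \in S' -> (\int[@lebesgue_measure R]_(x in `]0%R, t])
   (((pole_mult F b)%:R)%:E * ((if cmod b <= x then x^-1 else 0)%R)%:E) =
   ((pole_mult F b)%:R * (ln (Num.max t (cmod b)) - ln (cmod b)))%:E)%E.
  rewrite mem_filter => /andP[b0 _].
  rewrite ge0_integralZl_EFin//; last 2 first.
  - by move=> x /=; rewrite in_itv /= => /andP[x0 _]; rewrite lee_fin; case: ifP => // _; rewrite invr_ge0 ltW.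
  - apply/measurable_EFinP; apply: measurable_inv_from; exact: cmod_ge0.
  by rewrite integral_inv_from ?cmod_gt0// EFinM.
rewrite big_seq (eq_bigr _ E2) -big_seq sumEFin -EFinM -EFinD; congr EFin.
rewrite big_filter [RHS](bigID (fun b => b != 0)) /=; congr (_ + _).
rewrite mulr_suml; apply: congr_big => //.
  by move=> b; rewrite negbK -cmod_eq0 eq_le cmod_ge0 andbT.
move=> b b0; have -> : cmod b = 0 by apply/le_anti; rewrite b0 cmod_ge0.
by rewrite max_l ?(ltW t0)// (ln0 (lexx 0)) subr0.
Qed.

End PoleSet.
End CountingFunctions.

(** * The Poisson-Jensen inequality *)

Section PoissonJensen.
Context {R : realType}.
Implicit Types (z w b : R[i]) (F : R[i] -> option R[i]).
Local Notation cr := (real_complex R).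

Lemma lnp_tlog (x : R) : 0 <= x -> lnp x%:E = (tlog 0 x)%:E.
Proof.
rewrite /lnp /tlog oppr0 expR0 le_eqVlt => /predU1P[<-|x0].
  by rewrite (max_r (@ler01 R)) ln1 le0_lneNy// max_l// leNye.
rewrite lne_EFin//; have [x1|x1] := leP x 1.
  by rewrite max_l ?ln1// lee_fin ln_le0.
by rewrite max_r// lee_fin ln_ge0// ltW.
Qed.

Lemma lnp_ge0 (x : \bar R) : (0 <= lnp x)%E.
Proof. by rewrite /lnp le_max lexx. Qed.

Lemma lnp_pinfty : lnp (+oo%E : \bar R) = +oo%E.
Proof. by rewrite /lnp /= max_r// leey. Qed.

Lemma tlog0M_le (x y : R) : 0 <= x -> 1 <= y -> tlog 0 (x * y) <= tlog 0 x + ln y.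
Proof.
move=> x0 y1; have y0 : 0 < y := lt_le_trans ltr01 y1.
have m0 : 0 < Num.max x 1 by rewrite lt_max ltr01 orbT.
rewrite /tlog oppr0 expR0 -lnM ?posrE// ler_ln ?posrE ?mulr_gt0//; last first.
  by rewrite lt_max ltr01 orbT.
rewrite ge_max; apply/andP; split; first by rewrite ler_wpM2r ?(ltW y0)// le_max lexx.
by rewrite -[leLHS]mulr1; apply: ler_pM => //; rewrite le_max lexx orbT.
Qed.

(** The disc automorphism of the disc of radius rho sending b to 0, normalized
    to have modulus 1 on the boundary, split as (w - b) times a unit. *)
Definition blaschke_unit (rho : R) b w : R[i] := cr rho / (cr (rho ^+ 2) - conjc b * w).
Definition blaschke (rho : R) b w : R[i] := (w - b) * blaschke_unit rho b w.

Lemma blaschke_identity (rho : R) b w :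
  cmod (cr (rho ^+ 2) - conjc b * w) ^+ 2 - rho ^+ 2 * cmod (w - b) ^+ 2 =
  (rho ^+ 2 - cmod w ^+ 2) * (rho ^+ 2 - cmod b ^+ 2).
Proof.
case: b w => [b1 b2] [w1 w2]; rewrite !cmod_sqr.
by rewrite !(cReD, cImD, cReN, cImN) !(cReM, cImM) /=; ring.
Qed.

Section Factor.
Variables (rho : R) (b : R[i]).
Hypotheses (rho0 : 0 < rho) (b_rho : cmod b < rho).

Lemma blaschke_den w : cmod w <= rho -> cr (rho ^+ 2) - conjc b * w != 0.
Proof.
move=> wr; rewrite -cmod_gt0.
have := cmodD (cr (rho ^+ 2) - conjc b * w) (conjc b * w).
rewrite subrK cmod_real cmodM cmod_conj ger0_norm ?sqr_ge0// => h.
have : cmod b * cmod w <= cmod b * rho by rewrite ler_wpM2l ?cmod_ge0.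
have : 0 < (rho - cmod b) * rho by rewrite mulr_gt0// subr_gt0.
by lra.
Qed.

Lemma cdiff_blaschke_unit w : cmod w <= rho -> cdiff (blaschke_unit rho b) w.
Proof.
move=> wr; apply: cdiffM; first exact: cdiff_cst.
apply: cdiffV; first exact: blaschke_den.
by apply: cdiffB; [exact: cdiff_cst|apply: cdiffM; [exact: cdiff_cst|exact: cdiff_id]].
Qed.

Lemma blaschke_unit_neq0 w : cmod w <= rho -> blaschke_unit rho b w != 0.
Proof.
move=> wr; rewrite mulf_neq0 ?invr_eq0 ?blaschke_den//.
by rewrite -cmod_gt0 cmod_real normr_gt0 gt_eqF.
Qed.

Lemma cmod_blaschke w : cmod (blaschke rho b w) =
  rho * cmod (w - b) / cmod (cr (rho ^+ 2) - conjc b * w).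
Proof. by rewrite !cmodM cmodV cmod_real gtr0_norm// mulrCA mulrA. Qed.

Lemma cmod_blaschke_le1 w : cmod w <= rho -> cmod (blaschke rho b w) <= 1.
Proof.
move=> wr; rewrite cmod_blaschke ler_pdivrMr ?cmod_gt0 ?blaschke_den// mul1r.
rewrite -(ler_pXn2r (n:=2)) ?nnegrE ?mulr_ge0 ?cmod_ge0 ?(ltW rho0)// exprMn -subr_ge0.
rewrite blaschke_identity mulr_ge0// subr_ge0; apply: lerXn2r;
  rewrite ?nnegrE ?cmod_ge0 ?(ltW rho0) ?(ltW b_rho)//.
Qed.

Lemma cmod_blaschke_circle w : cmod w = rho -> cmod (blaschke rho b w) = 1.
Proof.
move=> wr; have den0 : cr (rho ^+ 2) - conjc b * w != 0 by apply: blaschke_den; rewrite wr.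
rewrite cmod_blaschke; suff -> : cmod (cr (rho ^+ 2) - conjc b * w) = rho * cmod (w - b).
  rewrite divff// mulf_neq0// ?(gt_eqF rho0)// cmod_eq0 subr_eq0.
  by apply/eqP => wb; move: b_rho; rewrite -wb wr ltxx.
apply/eqP; rewrite -(eqrXn2 (n:=2)) ?mulr_ge0 ?cmod_ge0 ?(ltW rho0)// exprMn -subr_eq0.
by rewrite blaschke_identity wr subrr mul0r.
Qed.

Lemma blaschke_eq0 w : cmod w <= rho -> (blaschke rho b w == 0) = (w == b).
Proof.
by move=> wr; rewrite mulf_eq0 (negbTE (blaschke_unit_neq0 wr)) orbF subr_eq0.
Qed.

Lemma cdiff_blaschke w : cmod w <= rho -> cdiff (blaschke rho b) w.
Proof.
move=> wr; apply: cdiffM; last exact: cdiff_blaschke_unit.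
by apply: cdiffB; [exact: cdiff_id|exact: cdiff_cst].
Qed.

End Factor.

(** The disc of radius |b| lies on the side of b of the bisector of b and s b; so
    scaling b pushes a pole off the circle while increasing distances. *)
Lemma cmod_sub_scale (s : R) b w : 1 <= s -> cmod w <= cmod b ->
  cmod (w - b) <= cmod (w - cr s * b).
Proof.
move=> s1 wb; rewrite -(ler_pXn2r (n:=2)) ?nnegrE ?cmod_ge0//.
have : cmod w ^+ 2 <= cmod b ^+ 2 by apply: lerXn2r; rewrite ?nnegrE ?cmod_ge0.
rewrite !cmod_sqr; case: b w {wb} => [b1 b2] [w1 w2].
rewrite !(cReD, cImD, cReN, cImN) !(cReM, cImM) /= => h.
have q1 : 0 <= (s - 1) * ((b1 - w1) ^+ 2 + (b2 - w2) ^+ 2).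
  by rewrite mulr_ge0 ?subr_ge0// addr_ge0// sqr_ge0.
have q2 : 0 <= (s - 1) * (b1 ^+ 2 + b2 ^+ 2 - (w1 ^+ 2 + w2 ^+ 2)).
  by rewrite mulr_ge0 ?subr_ge0.
have q3 : 0 <= (s - 1) ^+ 2 * (b1 ^+ 2 + b2 ^+ 2).
  by rewrite mulr_ge0 ?sqr_ge0// addr_ge0// sqr_ge0.
by lra.
Qed.

Lemma prox_ge_cmean F (g : R[i] -> R[i]) (rho : R) : 0 < rho ->
  (forall w, cmod w = rho -> cdiff g w) ->
  (forall w, cmod w = rho -> ((cmod (g w))%:E <= smod (F w))%E) ->
  ((cmean (logcirc 0 g rho))%:E <= prox rho F)%E.
Proof.
move=> rho0 hg gF; rewrite /cmean /prox /circ_mean EFinM.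
apply: lee_wpmul2l; first by rewrite lee_fin invr_ge0 ltW// pi2_gt0.
rewrite -rint_EFin; last by apply: continuous_icont; apply: logcirc_continuous => //; exact: ltW.
apply: ge0_le_integral_any => th _; first by rewrite lee_fin tlog0_ge0.
have wr : cmod (polar rho th) = rho by rewrite cmod_polar// ltW.
have := gF _ wr; rewrite /logcirc -lnp_tlog ?cmod_ge0//.
case: (F _) => [w|] /=; last by rewrite lnp_pinfty !leey.
by rewrite lee_fin !lnp_tlog ?cmod_ge0// lee_fin; exact: le_tlog.
Qed.

Lemma ln_prod_pow (S : seq R[i]) (h : R[i] -> R) (p : R[i] -> nat) :
  (forall b, b \in S -> 0 < h b) ->
  0 < \prod_(b <- S) h b ^+ p b /\
  ln (\prod_(b <- S) h b ^+ p b) = \sum_(b <- S) (p b)%:R * ln (h b).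
Proof.
elim: S => [_|b S IH hS]; first by rewrite !big_nil ltr01 ln1.
have [|pos E] := IH; first by move=> c cS; apply: hS; rewrite inE cS orbT.
have hb : 0 < h b by apply: hS; rewrite mem_head.
rewrite !big_cons mulr_gt0 ?exprn_gt0//; split => //.
by rewrite lnM ?posrE ?exprn_gt0// E lnXn// mulr_natl.
Qed.

Lemma prod_le1 (S : seq R[i]) (h : R[i] -> R) :
  (forall b, b \in S -> 0 <= h b <= 1) -> \prod_(b <- S) h b <= 1.
Proof.
move=> hS; suff /andP[] : 0 <= \prod_(b <- S) h b <= 1 by [].
rewrite big_seq; elim/big_ind: _ => [|x y /andP[x0 x1] /andP[y0 y1]|b /hS//].
  by rewrite ler01 lexx.
by rewrite mulr_ge0//= mulr_ile1.
Qed.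

Lemma prod_ge1 (S : seq R[i]) (h : R[i] -> R) :
  (forall b, b \in S -> 1 <= h b) -> 1 <= \prod_(b <- S) h b.
Proof.
move=> hS; rewrite big_seq; elim/big_ind: _ => [//|x y x1 y1|b /hS//].
exact: mulr_ege1.
Qed.

(** A holomorphic factor by which (w - b)^-1 is to be replaced in order to cancel
    a pole at b in the disc of radius rho.  For s = 1 its modulus on the boundary
    is that of (w - b)^-1; with s > 1 it is also holomorphic on the boundary. *)
Definition pole_factor (s rho : R) b : R[i] -> R[i] :=
  if cmod b < rho then blaschke_unit rho b else fun w => (w - cr s * b)^-1.

Lemma sub_scale_neq0 (s rho : R) b w : 1 < s -> 0 < rho -> rho <= cmod b -> cmod w <= rho ->
  w - cr s * b != 0.
Proof.
move=> s1 rho0 br wr; rewrite subr_eq0; apply/eqP => E; move: wr.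
rewrite E cmodM cmod_real gtr0_norm ?(lt_trans ltr01 s1)// leNgt; move/negP; apply.
by apply: (le_lt_trans br); rewrite ltr_pMl// (lt_le_trans rho0).
Qed.

Lemma pole_factor_neq0 (s rho : R) b w : 1 < s -> 0 < rho -> cmod w <= rho ->
  pole_factor s rho b w != 0.
Proof.
move=> s1 rho0 wr; rewrite /pole_factor; case: (ltP (cmod b) rho) => br.
  exact: blaschke_unit_neq0.
by rewrite invr_eq0 (sub_scale_neq0 s1 rho0).
Qed.

Lemma cdiff_pole_factor (s rho : R) b w : 1 < s -> 0 < rho -> cmod w <= rho ->
  cdiff (pole_factor s rho b) w.
Proof.
move=> s1 rho0 wr; rewrite /pole_factor; case: (ltP (cmod b) rho) => br.
  exact: cdiff_blaschke_unit.
apply: cdiffV; first exact: (sub_scale_neq0 s1 rho0).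
by apply: cdiffB; [exact: cdiff_id|exact: cdiff_cst].
Qed.

Lemma pole_factor_le1 (s rho : R) b w : 1 < s -> 0 < rho -> cmod w <= rho ->
  cmod (w - b) * cmod (pole_factor s rho b w) <= 1.
Proof.
move=> s1 rho0 wr; rewrite -cmodM /pole_factor; case: (ltP (cmod b) rho) => br.
  exact: cmod_blaschke_le1.
rewrite cmodM cmodV ler_pdivrMr ?mul1r; last by rewrite cmod_gt0 (sub_scale_neq0 s1 rho0).
by apply: cmod_sub_scale; [exact: ltW|exact: le_trans br].
Qed.

Lemma cmod_prodX (S : seq R[i]) (h : R[i] -> R[i]) (p : R[i] -> nat) :
  cmod (\prod_(b <- S) h b ^+ p b) = \prod_(b <- S) cmod (h b) ^+ p b.
Proof. by rewrite cmod_prod; apply: eq_bigr => b _; rewrite cmodX. Qed.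

(** Replacing every (w - b)^-1 by its factor only decreases the modulus, and the
    result G is holomorphic up to the boundary of the disc of radius r. *)
Lemma pole_free_mean F H (rho r s : R) (S : seq R[i]) (p : R[i] -> nat) :
  0 < r -> r <= rho -> 1 < s -> (forall w, cmod w <= rho -> cdiff H w) ->
  (forall w, cmod w <= rho -> F w =
     if w \in S then None else Some (H w / \prod_(b <- S) (w - b) ^+ p b)) ->
  let G w := H w * \prod_(b <- S) pole_factor s r b w ^+ p b in
  (forall w, cmod w <= r -> cdiff G w) /\
  ((cmean (logcirc 0 G r))%:E <= prox r F)%E.
Proof.
move=> r0 rr s1 cH FE G.
have cG w : cmod w <= r -> cdiff G w.
  move=> wr; apply: cdiffM; first by apply: cH; exact: le_trans rr.
  by apply: cdiff_prod => b bS _; apply: cdiffX; exact: cdiff_pole_factor.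
split => //; apply: prox_ge_cmean => // w wr; first by apply: cG; rewrite wr.
have wr' : cmod w <= rho by rewrite wr.
rewrite (FE _ wr'); case: ifPn => wS; first by rewrite leey.
have wb b : b \in S -> 0 < cmod (w - b).
  by move=> bS; rewrite cmod_gt0 subr_eq0; apply: contraNneq wS => ->.
rewrite /= lee_fin !cmodM cmodV !cmod_prodX ler_wpM2l ?cmod_ge0//.
have [P0 _] := ln_prod_pow p wb.
rewrite -[leRHS]mul1r ler_pdivlMr// -big_split /=.
apply: prod_le1 => b bS; rewrite -exprMn exprn_ge0 ?mulr_ge0 ?cmod_ge0//=.
rewrite exprn_ile1 ?mulr_ge0 ?cmod_ge0//.
by rewrite mulrC; apply: pole_factor_le1 => //; rewrite wr.
Qed.

(** [harnack_log] applies to F with its poles cancelled; each cancelling factor,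
    evaluated at z, costs a Green function. *)
Lemma poisson_jensen_le F (rho P : R) (S : seq R[i]) z : meromorphic F -> uniq S ->
  (forall b, (b \in S) = (cmod b <= rho) && (0 < pole_mult F b)%N) ->
  cmod z < rho -> z \notin S -> prox rho F = P%:E ->
  (lnp (smod (F z)) <= ((rho + cmod z) / (rho - cmod z) * P +
     \sum_(b <- S | cmod b < rho) (pole_mult F b)%:R * - ln (cmod (blaschke rho b z)))%:E)%E.
Proof.
move=> mF uS SE zr zS PE; have rho0 : 0 < rho := le_lt_trans (cmod_ge0 z) zr.
set p := pole_mult F; have zr' := ltW zr.
have C0 : 0 <= (rho + cmod z) / (rho - cmod z).
  by rewrite divr_ge0 ?subr_ge0// addr_ge0 ?cmod_ge0// ltW.
have [H [cH _ FE]] := clear_poles mF uS SE.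
have zb b : b \in S -> 0 < cmod (z - b).
  by move=> bS; rewrite cmod_gt0 subr_eq0; apply: contraNneq zS => ->.
have Sr b : b \in S -> ~~ (cmod b < rho) -> cmod b = rho.
  by rewrite SE => /andP[b1 _]; rewrite -leNgt => b2; apply/le_anti; rewrite b1 b2.
pose K := \sum_(b <- S) (p b)%:R * (rho / (rho - cmod z)).
have K0 : 0 <= K.
  by apply: sumr_ge0 => b _; rewrite mulr_ge0// divr_ge0 ?(ltW rho0)// subr_ge0.
apply/lee_addgt0Pr => e e0.
(* with this s, moving the poles off the boundary costs at most e *)
pose s := 1 + e / (K + 1).
have K1 : 0 < K + 1 by rewrite ltr_wpDl.
have s1 : 1 < s by rewrite /s ltrDl divr_gt0.
have [cG] := pole_free_mean rho0 (lexx _) s1 cH FE.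
set G := (G in logcirc 0 G); rewrite PE lee_fin -/p in cG * => GP.
rewrite (FE _ zr') (negbTE zS) /= lnp_tlog ?cmod_ge0//.
pose m := pole_factor s rho.
have hpos b : b \in S -> 0 < cmod (z - b) * cmod (m b z).
  by move=> bS; rewrite mulr_gt0 ?zb// cmod_gt0 pole_factor_neq0.
pose h b := (cmod (z - b) * cmod (m b z))^-1.
have h0 b : b \in S -> 0 < h b by move=> bS; rewrite invr_gt0 hpos.
have [Y0 YE] := ln_prod_pow p h0.
have Y1 : 1 <= \prod_(b <- S) h b ^+ p b.
  by apply: prod_ge1 => b bS; rewrite exprn_ege1// invf_ge1 ?hpos// pole_factor_le1.
have vE : cmod (H z / \prod_(b <- S) (z - b) ^+ p b) = cmod (G z) * \prod_(b <- S) h b ^+ p b.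
  rewrite !cmodM cmodV !cmod_prodX -mulrA; congr (_ * _).
  have [P0 _] := ln_prod_pow p zb.
  apply: (mulIf (lt0r_neq0 P0)); rewrite mulVf ?(lt0r_neq0 P0)// -!big_split /=.
  rewrite big_seq big1// => b bS; rewrite -!exprMn /h.
  rewrite [X in X ^+ _](_ : _ = 1) ?expr1n//.
  have := hpos _ bS; have := zb _ bS; set x := cmod (z - b); set y := cmod _ => x0 xy0.
  have y0 : y != 0 by apply/eqP => y0; move: xy0; rewrite y0 mulr0 ltxx.
  by field; rewrite y0 (lt0r_neq0 x0).
rewrite vE; apply: le_trans (_ : ((tlog 0 (cmod (G z)) + \sum_(b <- S) (p b)%:R * ln (h b))%:E <= _)%E).
  by rewrite lee_fin -YE; apply: tlog0M_le => //; exact: cmod_ge0.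
rewrite -EFinD lee_fin -addrA; apply: lerD.
  by apply: (le_trans (harnack_log cG zr)); rewrite ler_wpM2l.
rewrite (bigID (fun b => cmod b < rho)) /=; apply: lerD.
  rewrite big_seq_cond [leRHS]big_seq_cond; apply: ler_sum => b /andP[bS br].
  have := hpos b bS; rewrite /h /m /pole_factor br -cmodM => hb.
  by rewrite lnV ?posrE.
apply: (@le_trans _ _ (\sum_(b <- S | ~~ (cmod b < rho)) (p b)%:R * (rho / (rho - cmod z)) * (s - 1))).
  rewrite big_seq_cond [leRHS]big_seq_cond; apply: ler_sum => b /andP[bS br].
  rewrite -mulrA ler_wpM2l// /h /m /pole_factor (negbTE br) cmodV invf_div.
  have br' := Sr _ bS br.
  have d1 : rho - cmod z <= cmod (z - b).
    by rewrite cmodB -br'; apply: le_trans (ler_norm _) _; exact: ler_distcmod.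
  have d0 : 0 < rho - cmod z by rewrite subr_gt0.
  have d2 : 0 < cmod (z - b) := lt_le_trans d0 d1.
  have t1 : cmod (z - cr s * b) <= cmod (z - b) + (s - 1) * rho.
    have -> : z - cr s * b = (z - b) - cr (s - 1) * b by rewrite rmorphB rmorph1; ring.
    apply: (le_trans (cmodD _ _)); rewrite lerD2l cmodN cmodM cmod_real br'.
    by rewrite gtr0_norm// subr_gt0.
  have x0 : 0 < (s - 1) * rho by rewrite mulr_gt0// subr_gt0.
  apply: (@le_trans _ _ (ln (1 + (s - 1) * rho / cmod (z - b)))).
    rewrite ler_ln ?posrE; last 2 first.
    - by rewrite divr_gt0// cmod_gt0 (sub_scale_neq0 s1 rho0)// br'.
    - by rewrite ltr_pwDl// divr_ge0 ?ltW.
    by rewrite ler_pdivrMr// mulrDl mul1r divfK// gt_eqF.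
  apply: (le_trans (le_ln1Dx _)).
    by rewrite (lt_trans (ltrN10 _))// divr_gt0.
  by rewrite [leRHS]mulrC mulrA ler_pM2l// lef_pV2 ?posrE.
have -> : s - 1 = e / (K + 1) by rewrite /s addrC addKr.
rewrite -mulr_suml mulrA ler_pdivrMr// mulrC ler_wpM2l ?(ltW e0)//.
apply: (@le_trans _ _ K); last by rewrite lerDl.
rewrite /K [leRHS](bigID (fun b => cmod b < rho)) /= lerDr.
by apply: sumr_ge0 => b _; rewrite mulr_ge0// divr_ge0 ?(ltW rho0)// subr_ge0.
Qed.

End PoissonJensen.

(** * Truncated Green functions and their circular means *)

Section Truncation.
Import HBSimple HBNNSimple.
Context {R : realType}.
Implicit Types (z w b : R[i]) (F : R[i] -> option R[i]).
Local Notation cr := (real_complex R).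

(** Simple functions are bounded, so an integral is the supremum of those of the
    truncations of the integrand, measurable or not. *)
Lemma integral_le_trunc d (T : measurableType d) (mu : {measure set T -> \bar R})
    (D : set T) (f : T -> \bar R) (c : \bar R) :
  (forall x, D x -> 0 <= f x)%E ->
  (forall M : R, (0 <= M)%R -> \int[mu]_(x in D) mine (f x) M%:E <= c)%E ->
  (\int[mu]_(x in D) f x <= c)%E.
Proof.
move=> f0 fM; rewrite ge0_integralE//; apply: ge_ereal_sup => _ [h hf <-].
have [M [_ hM]] := simple_bounded h.
have M1 : M < `|M| + 1 by rewrite (le_lt_trans (ler_norm _))// ltrDl.
have M0 : 0 <= `|M| + 1 by rewrite addr_ge0.
apply: le_trans (fM _ M0); rewrite ge0_integralE; last first.
  by move=> x Dx; rewrite le_min f0// lee_fin.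
apply: ereal_sup_ubound; exists h => // x.
have := hf x; rewrite !patchE; case: ifPn => // _ hx.
rewrite le_min hx lee_fin (le_trans (ler_norm _))//.
exact: (hM _ M1 x).
Qed.

Lemma circ_mean_le_trunc (v : R[i] -> \bar R) (t X : R) : (forall z, 0 <= v z)%E ->
  (forall M : R, (0 <= M)%R -> \int[@lebesgue_measure R]_(phi in `[0%R, (2 * pi)%R])
     mine (v (polar t phi)) M%:E <= (2 * pi * X)%:E)%E ->
  (circ_mean v t <= X%:E)%E.
Proof.
move=> v0 vM; have p0 := @pi2_gt0 R.
have H : (\int[@lebesgue_measure R]_(phi in `[0%R, (2 * pi)%R]) v (polar t phi) <= (2 * pi * X)%:E)%E.
  by apply: integral_le_trunc => // phi _.
have := lee_wpmul2l (_ : (0 <= ((2 * pi)^-1)%:E)%E) H.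
rewrite lee_fin invr_ge0 (ltW p0) => /(_ isT) /le_trans; apply.
by rewrite -EFinM mulrA mulVf ?mul1r// gt_eqF.
Qed.

Lemma integral_null d (T : measurableType d) (mu : {measure set T -> \bar R})
    (D : set T) (f : T -> \bar R) : measurable D -> mu D = 0%E ->
  (forall x, D x -> 0 <= f x)%E -> (\int[mu]_(x in D) f x = 0)%E.
Proof.
move=> mD D0 f0; apply/le_anti/andP; split; last exact: integral_ge0.
apply: (@le_trans _ _ (\int[mu]_(x in D) (cst +oo x))%E).
  by apply: ge0_le_integral_any => // x _; exact: leey.
by rewrite integral_cst// D0 mule0.
Qed.

Lemma cmeanD k1 k2 : continuous k1 -> continuous k2 ->
  cmean (fun x => k1 x + k2 x) = cmean k1 + cmean k2 :> R.
Proof.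
by move=> c1 c2; rewrite /cmean -mulrDr rintD//; apply: continuous_icont.
Qed.

Lemma cmeanZ (c : R) k : continuous k -> cmean (fun x => c * k x) = c * cmean k.
Proof.
move=> ck; rewrite /cmean (rintZ c (@continuous_icont R k 0 (2 * pi) ck)).
by set u := (2 * pi)^-1; ring.
Qed.

Lemma cmean_lin_sum (I : eqType) (S : seq I) (P : pred I) (A : R) (p : I -> R) (k : I -> R -> R) :
  (forall i, i \in S -> P i -> continuous (k i)) ->
  continuous (fun x => A + \sum_(i <- S | P i) p i * k i x) /\
  cmean (fun x => A + \sum_(i <- S | P i) p i * k i x) = A + \sum_(i <- S | P i) p i * cmean (k i).
Proof.
elim: S => [_|i S IH hk].
  have -> : (fun x : R => A + \sum_(i <- [::] | P i) p i * k i x) = fun=> A.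
    by apply/funext => x; rewrite big_nil addr0.
  by rewrite cmean_cst big_nil addr0; split => //; exact: cst_continuous.
have [|cS E] := IH; first by move=> i0 cS; apply: hk; rewrite inE cS orbT.
case Pb : (P i); last first.
  have -> : (fun x => A + \sum_(j <- i :: S | P j) p j * k j x) = (fun x => A + \sum_(i <- S | P i) p i * k i x).
    by apply/funext => x; rewrite big_cons Pb.
  by rewrite big_cons Pb.
have ckb : continuous (fun x => p i * k i x).
  move=> x; apply: (@continuousM _ _ (fun=> p i)); first exact: cst_continuous.
  by apply: hk => //; rewrite mem_head.
have -> : (fun x => A + \sum_(j <- i :: S | P j) p j * k j x) =
    (fun x => p i * k i x + (A + \sum_(i <- S | P i) p i * k i x)).
  by apply/funext => x; rewrite big_cons Pb addrCA.
split; first by move=> x; exact: (continuousD (ckb x) (cS x)).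
have ki : continuous (k i) by apply: hk => //; rewrite mem_head.
rewrite (cmeanD ckb cS) E (cmeanZ (p i) ki) big_cons Pb.
by rewrite [LHS]addrCA.
Qed.

(** The Green function truncated at height M. *)
Definition greenT (M rho : R) b z : R := - tlog M (cmod (blaschke rho b z)).

Lemma greenT_ge0 (M rho : R) b z : 0 <= M -> 0 < rho -> cmod b < rho -> cmod z <= rho ->
  0 <= greenT M rho b z.
Proof.
move=> M0 r0 br zr; rewrite oppr_ge0 ln_le0// ge_max cmod_blaschke_le1//=.
by rewrite -[leRHS]expR0 ler_expR oppr_le0.
Qed.

(** At a point where some Green function exceeds M, a pole for instance, that
    Green function alone dominates the truncated left-hand side. *)
Lemma poisson_jensen_trunc F (rho P M : R) (S : seq R[i]) z : meromorphic F -> uniq S ->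
  (forall b, (b \in S) = (cmod b <= rho) && (0 < pole_mult F b)%N) -> cmod z < rho ->
  prox rho F = P%:E -> 0 <= P -> 0 <= M ->
  (mine (lnp (smod (F z))) M%:E <= ((rho + cmod z) / (rho - cmod z) * P +
     \sum_(b <- S | cmod b < rho) (pole_mult F b)%:R * greenT M rho b z)%:E)%E.
Proof.
move=> mF uS SE zr PE P0 M0; have rho0 : 0 < rho := le_lt_trans (cmod_ge0 z) zr.
have zr' := ltW zr.
have A0 : 0 <= (rho + cmod z) / (rho - cmod z) * P.
  by rewrite mulr_ge0// divr_ge0 ?subr_ge0// addr_ge0 ?cmod_ge0// ltW.
have t0 b : cmod b < rho -> 0 <= (pole_mult F b)%:R * greenT M rho b z.
  by move=> br; rewrite mulr_ge0// greenT_ge0.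
have [[b [bS br Bb]]|no] := pselect (exists b, [/\ b \in S, cmod b < rho &
    cmod (blaschke rho b z) < expR (- M)]).
  rewrite ge_min; apply/orP; right; rewrite lee_fin -[leLHS]add0r; apply: lerD => //.
  rewrite big_mkcond (bigD1_seq b)//= br.
  apply: (@le_trans _ _ ((pole_mult F b)%:R * greenT M rho b z)).
    rewrite /greenT /tlog max_r ?(ltW Bb)// expRK opprK ler_peMl// ler1n.
    by move: bS; rewrite SE => /andP[].
  by rewrite lerDl; apply: sumr_ge0 => c _; case: ifP => // /t0.
rewrite ge_min; apply/orP; left.
have Bb b : b \in S -> cmod b < rho -> expR (- M) <= cmod (blaschke rho b z).
  by move=> bS br; rewrite leNgt; apply/negP => h; apply: no; exists b.
have zS : z \notin S.
  apply/negP => zS; have := Bb z zS zr.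
  by rewrite /blaschke subrr mul0r cmod0 leNgt expR_gt0.
apply: (le_trans (poisson_jensen_le mF uS SE zr zS PE)); rewrite lee_fin lerD2l.
rewrite big_seq_cond [leRHS]big_seq_cond; apply: ler_sum => b /andP[bS br].
by rewrite ler_wpM2l// /greenT tlogE// Bb.
Qed.

(** Both bounds are the sub-mean-value inequality at the centre: for the Blaschke
    factor itself, and, when |b| < x, for the holomorphic function without zeros
    having the same modulus on the circle of radius x. *)
Lemma cmean_greenT (M rho x : R) b : 0 < x -> x < rho -> cmod b < rho -> 0 <= M ->
  continuous (fun th => greenT M rho b (polar x th)) /\
  cmean (fun th => greenT M rho b (polar x th)) <= ln rho - ln (Num.max x (cmod b)).
Proof.
move=> x0 xr br M0; have rho0 := lt_trans x0 xr.
have cB w : cmod w <= x -> cdiff (blaschke rho b) w.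
  by move=> wx; apply: cdiff_blaschke => //; exact: le_trans wx (ltW xr).
have cl : continuous (logcirc M (blaschke rho b) x).
  by apply: logcirc_continuous; [exact: ltW|move=> w wx; apply: cB; rewrite wx].
have cN : continuous (fun th => greenT M rho b (polar x th)).
  by move=> th; exact: (continuousN (cl th)).
split => //.
have -> : cmean (fun th => greenT M rho b (polar x th)) = - cmean (logcirc M (blaschke rho b) x).
  rewrite -[RHS]mulN1r -cmeanZ//; congr cmean; apply/funext => th.
  by rewrite mulN1r.
have crho : cr (rho ^+ 2) != 0 by rewrite -cmod_gt0 cmod_real normr_gt0 expf_neq0// gt_eqF.
have main g (y : R) : 0 < y -> (forall w, cmod w <= x -> cdiff g w) -> cmod (g 0) = y / rho ->
    (forall w, cmod w = x -> cmod (g w) = cmod (blaschke rho b w)) ->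
    - cmean (logcirc M (blaschke rho b) x) <= ln rho - ln y.
  move=> y0 cg g0 gB; have := submean_centre M x0 cg.
  have -> : logcirc M g x = logcirc M (blaschke rho b) x.
    by apply/funext => th; rewrite /logcirc gB// cmod_polar// ltW.
  rewrite g0 lerNl opprB -ln_div ?posrE// => h.
  by rewrite -ler_expR lnK// posrE divr_gt0.
have [xb|bx] := leP x (cmod b).
  apply: (main (blaschke rho b)) => //; first exact: lt_le_trans xb.
  rewrite cmod_blaschke// sub0r cmodN mulr0 subr0 cmod_real ger0_norm ?sqr_ge0//.
  by field; rewrite gt_eqF.
pose g w := (cr x - conjc b / cr x * w) * blaschke_unit rho b w.
have xx : cr x != 0 by rewrite -cmod_gt0 cmod_real normr_gt0 gt_eqF.
apply: (main g) => //.
- move=> w wx; apply: cdiffM; last by apply: cdiff_blaschke_unit => //; exact: le_trans wx (ltW xr).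
  by apply: cdiffB; [exact: cdiff_cst|apply: cdiffM; [exact: cdiff_cst|exact: cdiff_id]].
- rewrite /g /blaschke_unit !mulr0 !subr0 !cmodM cmodV !cmod_real !gtr0_norm// ?exprn_gt0//.
  by field; rewrite gt_eqF.
- move=> w wx; rewrite !cmodM; congr (_ * _).
  have -> : cr x - conjc b / cr x * w = (cr (x ^+ 2) - conjc b * w) / cr x.
    by rewrite rmorphXn; field.
  have -> : cmod (w - b) = x * cmod (w - b) / x by field; rewrite gt_eqF.
  rewrite cmodM cmodV cmod_real gtr0_norm//; congr (_ / _).
  apply/eqP; rewrite -(eqrXn2 (n:=2)) ?mulr_ge0 ?cmod_ge0 ?(ltW x0)// exprMn -subr_eq0.
  by rewrite blaschke_identity wx subrr mul0r.
Qed.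


End Truncation.

(** * The mean proximity function *)

Section MeanProximity.
Context {R : realType}.
Implicit Types (z w b : R[i]) (F : R[i] -> option R[i]) (S : seq R[i]).

Definition pole_set F (rho : R) S := uniq S /\
  (forall b, (b \in S) = (cmod b <= rho) && (0 < pole_mult F b)%N).

Lemma prox_ge0 F (t : R) : (0 <= prox t F)%E.
Proof.
apply: mule_ge0; first by rewrite lee_fin invr_ge0 ltW// pi2_gt0.
by apply: integral_ge0 => x _; exact: lnp_ge0.
Qed.

Lemma rint_cmean (k : R -> R) : rint k 0 (2 * pi) = 2 * pi * cmean k.
Proof.
by rewrite /cmean mulrA divff ?mul1r// gt_eqF// pi2_gt0.
Qed.

Lemma poisson_kernel_le (k r y : R) : 0 < r -> 1 < k -> y <= r ->
  (k * r + y) / (k * r - y) <= (k + 1) / (k - 1).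
Proof.
move=> r0 k1 yr; have k0 : 0 < k := lt_trans ltr01 k1.
have rr : r < k * r by rewrite ltr_pMl.
rewrite ler_pdivrMr ?subr_gt0 ?(le_lt_trans yr)// mulrAC ler_pdivlMr ?subr_gt0//.
have : 0 <= k * (r - y) by rewrite mulr_ge0 ?subr_ge0// ltW.
by lra.
Qed.

(** The mean of [poisson_jensen_trunc] over the circle of radius x. *)
Lemma prox_mean_le F (rho P x : R) S : meromorphic F -> pole_set F rho S ->
  0 < x -> x < rho -> prox rho F = P%:E -> 0 <= P ->
  (prox x F <= ((rho + x) / (rho - x) * P +
     \sum_(b <- S | cmod b < rho) (pole_mult F b)%:R * (ln rho - ln (Num.max x (cmod b))))%:E)%E.
Proof.
move=> mF [uS SE] x0 xr PE P0; set X := _ + _.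
have p0 := @pi2_gt0 R.
apply: circ_mean_le_trunc => [z|M M0]; first exact: lnp_ge0.
pose Q phi := (rho + x) / (rho - x) * P +
  \sum_(b <- S | cmod b < rho) (pole_mult F b)%:R * greenT M rho b (polar x phi).
have cg b : cmod b < rho -> continuous (fun th => greenT M rho b (polar x th)) /\
    cmean (fun th => greenT M rho b (polar x th)) <= ln rho - ln (Num.max x (cmod b)).
  by move=> br; exact: cmean_greenT.
have [cQ EQ] := @cmean_lin_sum R _ S (fun b => cmod b < rho) ((rho + x) / (rho - x) * P)
  (fun b => (pole_mult F b)%:R) (fun b th => greenT M rho b (polar x th))
  (fun b _ br => (cg b br).1).
apply: (@le_trans _ _ (\int[@lebesgue_measure R]_(phi in `[0%R, (2 * pi)%R]) (Q phi)%:E)%E).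
  apply: ge0_le_integral_any => phi _; first by rewrite le_min lnp_ge0 lee_fin.
  have cp : cmod (polar x phi) = x by rewrite cmod_polar// ltW.
  have := @poisson_jensen_trunc R F rho P M S (polar x phi) mF uS SE.
  by rewrite cp => /(_ xr PE P0 M0).
rewrite rint_EFin; last exact: continuous_icont.
rewrite lee_fin rint_cmean ler_pM2l// EQ lerD2l; apply: ler_sum => b br.
by rewrite ler_wpM2l//; exact: (cg b br).2.
Qed.

Lemma nevT_sub_Npoles F (rho r0 : R) S : pole_set F rho S -> 0 < r0 -> r0 < rho ->
  (nevT rho F - Npoles r0 F = prox rho F +
    (\sum_(b <- S) (pole_mult F b)%:R * (ln rho - ln (Num.max r0 (cmod b))))%:E)%E.
Proof.
move=> [uS SE] r00 r0r; rewrite /nevT (NpolesE uS SE (lt_trans r00 r0r) (lexx _)).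
rewrite (NpolesE uS SE r00 (ltW r0r)) -addeA -EFinB; congr (_ + _%:E)%E.
rewrite -sumrB big_seq [RHS]big_seq; apply: eq_bigr => b bS.
rewrite -mulrBr; congr (_ * _); rewrite max_l; first ring.
by move: bS; rewrite SE => /andP[].
Qed.

Lemma pole_weights_le F (rho r0 r : R) S : pole_set F rho S -> 0 < r0 -> r0 <= r -> r <= rho ->
  0 <= \sum_(b <- S | cmod b < rho) (pole_mult F b)%:R * (ln rho - ln (Num.max r (cmod b))) <=
    \sum_(b <- S) (pole_mult F b)%:R * (ln rho - ln (Num.max r0 (cmod b))).
Proof.
move=> [uS SE] r00 r0r rr; have rho0 : 0 < rho by apply: lt_le_trans rr; exact: lt_le_trans r0r.
have mpos (x : R) b : 0 < x -> 0 < Num.max x (cmod b) by move=> x0; rewrite lt_max x0.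
have rp : 0 < r := lt_le_trans r00 r0r.
apply/andP; split.
  apply: sumr_ge0 => b br; rewrite mulr_ge0// subr_ge0 ler_ln ?posrE ?(mpos r)//.
  by rewrite ge_max rr (ltW br).
rewrite -[X in X <= _]addr0 [X in _ + _ <= X](bigID (fun b => cmod b < rho)) /=; apply: lerD.
  apply: ler_sum => b br; rewrite ler_wpM2l// lerD2l lerN2 ler_ln ?posrE ?(mpos r) ?(mpos r0)//.
  by rewrite ge_max !le_max r0r lexx orbT.
rewrite big_seq_cond; apply: sumr_ge0 => b /andP[bS _]; rewrite mulr_ge0// subr_ge0.
rewrite ler_ln ?posrE ?(mpos r0)// ge_max (le_trans r0r rr).
by move: bS; rewrite SE => /andP[].
Qed.

Lemma ln_ge_1subV (x : R) : 0 < x -> 1 - x^-1 <= ln x.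
Proof.
move=> x0; have h : -1 < x^-1 - 1 by rewrite ltrBrDr addrC subrr invr_gt0.
have := le_ln1Dx h; rewrite (_ : 1 + (x^-1 - 1) = x^-1); last by ring.
by rewrite lnV ?posrE// lerNl opprB.
Qed.

Lemma prox2_le_linear F (r al be : R) : 0 < r ->
  (forall x : R, (0 <= x <= r)%R -> prox x F * x%:E <= (al * x + be * (r - x))%:E)%E ->
  (prox2 r F <= (al + be)%:E)%E.
Proof.
move=> r0 bound; rewrite /prox2.
have H : (\int[@lebesgue_measure R]_(x in `[0%R, r]) (prox x F * x%:E) <=
   ((al + be) * (r ^+ 2 / 2))%:E)%E.
  pose g x := al * x + be * (r - x).
  pose G x := al * (x ^+ 2 / 2) + be * (r * x - x ^+ 2 / 2).
  have dG (x : R) : 0 <= x <= r -> is_derive x 1 G (g x).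
    move=> _; rewrite /G; apply: is_derive_eq; rewrite /g /GRing.scale /=; by field.
  have cg : icont g 0 r.
    move=> x _; apply: (is_derive_cont (d:=al - be)).
    by rewrite /g; apply: is_derive_eq; rewrite /GRing.scale /=; ring.
  apply: (@le_trans _ _ (\int[@lebesgue_measure R]_(x in `[0%R, r]) (g x)%:E)%E).
    apply: ge0_le_integral_any => x /=; rewrite in_itv /= => xI; last exact: bound.
    apply: mule_ge0; first exact: prox_ge0.
    by rewrite lee_fin; case/andP: xI.
  rewrite rint_EFin// (rint_FTC (ltW r0) cg dG) lee_fin /G.
  by rewrite le_eqVlt; apply/orP; left; apply/eqP; field.
have := @lee_wpmul2l _ (2 / r ^+ 2)%:E _ _ _ H.
rewrite lee_fin divr_ge0 ?exprn_ge0 ?(ltW r0)// => /(_ isT) /le_trans; apply.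
rewrite -EFinM lee_fin le_eqVlt; apply/orP; left; apply/eqP.
by field; rewrite gt_eqF.
Qed.

(** Averaging the Green function of a pole b over circles of radius x costs
    ln (r / x) <= r / x - 1 beyond ln (rho / r) when |b| < r, and this is
    absorbed because k ln k / (k - 1) is at least 1. *)
Lemma prox2_le F (r0 r k : R) : meromorphic F -> 0 < r0 -> r0 < r -> 1 < k ->
  (prox2 r F <= (4 * k / (k - 1))%:E * (nevT (k * r) F - Npoles r0 F))%E.
Proof.
move=> mF r00 r0r k1; have rp : 0 < r := lt_trans r00 r0r.
set rho := k * r.
have rrho : r < rho by rewrite /rho ltr_pMl.
have rho0 : 0 < rho := lt_trans rp rrho.
have [S uS SE] := finite_poles rho mF.
have PS : pole_set F rho S by split.
rewrite (nevT_sub_Npoles PS r00 (lt_trans r0r rrho)).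
have k10 : 0 < k - 1 by rewrite subr_gt0.
have k0 : 0 < k by lra.
have c0 : 0 < 4 * k / (k - 1) by rewrite divr_gt0// mulr_gt0.
have /andP[V0 VW] := pole_weights_le PS r00 (ltW r0r) (ltW rrho).
set W := \sum_(b <- S) _ in VW *; set V := \sum_(b <- S | _) _ in V0 VW *.
case PE : (prox rho F) (prox_ge0 F rho) => [P| |] // P0; last first.
  by rewrite addye// gt0_muley ?lte_fin// leey.
rewrite lee_fin in P0.
pose q b := k / (k - 1) * (ln rho - ln (Num.max r (cmod b))).
pose Vq := \sum_(b <- S | cmod b < rho) (pole_mult F b)%:R * q b.
have VqE : Vq = k / (k - 1) * V.
  by rewrite /Vq /V mulr_sumr; apply: eq_bigr => b _; rewrite /q mulrCA.
have kk1 : 1 <= k / (k - 1) by rewrite ler_pdivlMr// mul1r gerBl.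
pose C := (k + 1) / (k - 1).
have C0 : 0 <= C by rewrite divr_ge0 ?ltW// addr_gt0.
have Vq0 : 0 <= Vq by rewrite VqE mulr_ge0// ltW// divr_gt0.
have lne_r : ln rho = ln k + ln r by rewrite lnM ?posrE.
have bound x : 0 <= x <= r -> (prox x F * x%:E <= ((C * P + V) * x + Vq * (r - x))%:E)%E.
  move=> /andP[]; rewrite le_eqVlt => /predU1P[<- _|x0 xr].
    by rewrite mule0 lee_fin mulr0 add0r subr0 mulr_ge0// ltW.
  have xrho := le_lt_trans xr rrho.
  have := prox_mean_le mF PS x0 xrho PE P0.
  move=> /(@lee_wpmul2r _ x%:E); rewrite lee_fin => /(_ (ltW x0)) /le_trans; apply.
  rewrite -EFinM lee_fin mulrDl [(C * P + V) * x]mulrDl -addrA; apply: lerD.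
    by rewrite ler_wpM2r ?(ltW x0)// ler_wpM2r// poisson_kernel_le.
  rewrite /V /Vq !mulr_suml -big_split /=; apply: ler_sum => b br.
  rewrite -[X in X <= _]mulrA -(mulrA _ (ln rho - ln (Num.max r _))) -(mulrA _ (q b)) -mulrDr ler_wpM2l//.
  have mpos (y : R) : 0 < y -> 0 < Num.max y (cmod b) by move=> y0; rewrite lt_max y0.
  have ell0 : 0 <= ln rho - ln (Num.max r (cmod b)).
    by rewrite subr_ge0 ler_ln ?posrE ?(mpos r)// ge_max (ltW rrho) (ltW br).
  have q0 : 0 <= q b by rewrite mulr_ge0 ?divr_ge0 ?(ltW k0) ?(ltW k10)//.
  have [rb|bcr] := leP r (cmod b).
    rewrite (max_r (le_trans xr rb)) (max_r rb) in ell0 *.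
    by rewrite lerDl (mulr_ge0 q0)// subr_ge0.
  have q1 : 1 <= q b.
    rewrite /q max_l ?(ltW bcr)// lne_r addrK.
    have h : k / (k - 1) * (1 - k^-1) <= k / (k - 1) * ln k.
      by rewrite ler_pM2l ?divr_gt0//; exact: ln_ge_1subV.
    apply: le_trans h; rewrite le_eqVlt; apply/orP; left; apply/eqP.
    by field; rewrite (lt0r_neq0 k10) (lt0r_neq0 k0).
  have lx : ln r - ln (Num.max x (cmod b)) <= r / x - 1.
    apply: (@le_trans _ _ (ln r - ln x)).
      by rewrite lerD2l lerN2 ler_ln ?posrE ?mpos// le_max lexx.
    have := ln_ge_1subV (divr_gt0 x0 rp); rewrite ln_div ?posrE// invf_div; lra.
  rewrite (max_l (ltW bcr)) in ell0 *.
  have e1 : (r / x - 1) * x = r - x by field; rewrite gt_eqF.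
  have e2 : (ln r - ln (Num.max x (cmod b))) * x <= r - x by rewrite -e1 ler_pM2r.
  have e3 : r - x <= q b * (r - x) by rewrite ler_peMl// subr_ge0.
  by move: e2 e3; rewrite !mulrBl; lra.
apply: (le_trans (prox2_le_linear rp bound)); rewrite -EFinD -!EFinM lee_fin.
have -> : 4 * k / (k - 1) * (P + W) = 4 * (k / (k - 1) * P) + 4 * (k / (k - 1) * W) by ring.
have C2 : C * P <= 2 * (k / (k - 1) * P).
  have -> : 2 * (k / (k - 1) * P) = (2 * k) / (k - 1) * P by ring.
  by rewrite ler_wpM2r// ler_pM2r ?invr_gt0//; lra.
have V1 : V <= k / (k - 1) * V by rewrite ler_peMl.
have V2 : k / (k - 1) * V <= k / (k - 1) * W by rewrite ler_wpM2l// ltW// divr_gt0.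
have P2 : 0 <= k / (k - 1) * P by rewrite mulr_ge0 ?divr_ge0 ?(ltW k0) ?(ltW k10)//.
have W0 : 0 <= k / (k - 1) * W by apply: le_trans V2; rewrite mulr_ge0 ?divr_ge0 ?(ltW k0) ?(ltW k10)//.
by rewrite VqE; lra.
Qed.

End MeanProximity.

(** * Majorants of Green functions *)

Section IntegralBounds.
Context {R : realType} d (T : measurableType d) (mu : {measure set T -> \bar R}).
Local Open Scope ereal_scope.

(** Upper bounds for integrals of nonnegative functions, closed under the
    operations that build the majorant of the integrand. *)
Definition integral_bound (E : set T) (f : T -> \bar R) (c : \bar R) :=
  [/\ measurable_fun E f, forall x, 0 <= f x & \int[mu]_(x in E) f x <= c].

Variable E : set T.
Hypothesis mE : measurable E.

Lemma integral_bound_cst (k : R) : (0 <= k)%R -> integral_bound E (fun=> k%:E) (k%:E * mu E).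
Proof.
move=> k0; split; [exact: measurable_cst|by move=> x; rewrite lee_fin|].
by have -> := integral_cst mu mE k%:E.
Qed.

Lemma integral_bound_indic (D : set T) : measurable D ->
  integral_bound E (fun x => (\1_D x)%:E) (mu D).
Proof.
move=> mD; split.
- by apply/measurable_EFinP; exact: measurable_indic.
- by move=> x; rewrite lee_fin.
- rewrite integral_indic//; apply: le_measure; rewrite ?inE//.
  exact: measurableI.
Qed.

Lemma integral_boundD f g a b : integral_bound E f a -> integral_bound E g b ->
  integral_bound E (fun x => f x + g x) (a + b).
Proof.
move=> [mf f0 fa] [mg g0 gb]; split; first exact: emeasurable_funD.
  by move=> x; exact: adde_ge0.
by rewrite ge0_integralD//; exact: leeD.
Qed.

Lemma integral_boundZ (k : R) f a : (0 <= k)%R -> integral_bound E f a ->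
  integral_bound E (fun x => k%:E * f x) (k%:E * a).
Proof.
move=> k0 [mf f0 fa]; split; first exact: measurable_funeM.
  by move=> x; apply: mule_ge0; rewrite ?lee_fin.
by rewrite ge0_integralZl_EFin//; apply: lee_wpmul2l; rewrite ?lee_fin.
Qed.

Lemma integral_bound_sum (I : Type) (s : seq I) (P : pred I) (f : I -> T -> \bar R) (c : I -> \bar R) :
  (forall i, P i -> integral_bound E (f i) (c i)) ->
  integral_bound E (fun x => \sum_(i <- s | P i) f i x) (\sum_(i <- s | P i) c i).
Proof.
move=> h; elim: s => [|i s IH].
  under [X in integral_bound _ X _]eq_fun do rewrite big_nil.
  by rewrite big_nil; have := integral_bound_cst (lexx 0%R); rewrite mul0e.
under [X in integral_bound _ X _]eq_fun do rewrite big_cons.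
rewrite big_cons; case Pi : (P i) => //.
by apply: integral_boundD => //; exact: h.
Qed.

End IntegralBounds.

Section PlaneSquares.
Context {R : realType}.
Implicit Types (z w b : R[i]).

Definition square b (h : R) : set (R * R) :=
  `](complex.Re b - h), (complex.Re b + h)[%classic `*` `](complex.Im b - h), (complex.Im b + h)[%classic.

Lemma square_measurable b h : measurable (square b h).
Proof. exact: measurableX. Qed.

Lemma square_cara b h :
  ((@lebesgue_measure R \x @lebesgue_measure R)%E^*)%mu.-cara.-measurable (square b h).
Proof. apply: caratheodory_measurable_mu_ext; exact: square_measurable. Qed.

Lemma leb2_square b (h : R) : 0 <= h -> leb2 (square b h) = (4 * h ^+ 2)%:E.
Proof.
move=> h0; rewrite /leb2 /completed_measure_extension measurable_mu_extE; last exact: square_measurable.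
transitivity (@lebesgue_measure R `](complex.Re b - h)%R, (complex.Re b + h)%R[%classic *
    @lebesgue_measure R `](complex.Im b - h)%R, (complex.Im b + h)%R[%classic)%E.
  exact: product_measure1E.
rewrite !lebesgue_measure_itv /= !lte_fin.
have [h1|h1] := eqVneq h 0; first by rewrite h1 !subr0 !addr0 !ltxx mul0e expr0n/= mulr0.
have hp : 0 < h by rewrite lt_def h1.
have lt_ (x : R) : x - h < x + h by rewrite ltrD2l gtrN.
rewrite !lt_ -!EFinD -EFinM; congr EFin; ring.
Qed.

(** The number of j < n with y < s / 2 ^ j, a staircase dominating the truncated
    logarithm of s / y. *)
Fixpoint stair (s y : R) n : nat :=
  if n is n'.+1 then ((y < s / 2 ^+ n')%R + stair s y n')%N else 0%N.

Lemma stairP (s y : R) n : 0 <= s -> (stair s y n <= n)%N /\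
  (stair s y n = n \/ s / 2 ^+ stair s y n <= y).
Proof.
move=> s0; elim: n => [|n [le_n IH]] /=; first by split => //; left.
have [yn|ny] := ltP y (s / 2 ^+ n).
  rewrite add1n; split => //; case: IH => [-> |h]; first by left.
  left; congr S; apply/eqP; rewrite eqn_leq le_n /= leqNgt; apply/negP => lt_n.
  have := le_lt_trans h yn; rewrite ltNge; apply/negP; rewrite negbK.
  by rewrite ler_wpM2l// lef_pV2 ?posrE ?exprn_gt0// ler_weXn2l// ler1n.
rewrite add0n; split; first exact: leqW.
by right; case: IH => // ->.
Qed.

Lemma stair_sum (s y : R) n : (stair s y n)%:R = \sum_(j < n) (nat_of_bool (y < s / 2 ^+ j)%R)%:R :> R.
Proof.
elim: n => [|n IH]; first by rewrite big_ord0.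
by rewrite big_ord_recr /= natrD IH addrC.
Qed.

Lemma tlog_stair_le (M c s y : R) n : 0 < s -> s <= c -> 0 <= y -> M <= n%:R * ln 2 ->
  - tlog M (y / c) <= ln (c / s) + ln 2 * (stair s y n)%:R.
Proof.
move=> s0 sc y0 Mn; have c0 := lt_le_trans s0 sc.
have lcs : 0 <= ln (c / s) by rewrite ln_ge0// ler_pdivlMr// mul1r.
have [_ [->|sy]] := stairP y n (ltW s0).
  rewrite [X in _ + X]mulrC; have := tlog_geN M (y / c).
  by move: Mn lcs; set t := tlog _ _; set L := _ * ln 2; set l := ln _ => ? ? ?; lra.
set N := stair s y n in sy *.
have p2 : 0 < 2 ^+ N :> R by rewrite exprn_gt0.
have yp : 0 < y by apply: lt_le_trans sy; rewrite divr_gt0.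
apply: (@le_trans _ _ (- ln (y / c))); first by rewrite lerN2 ln_le_tlog// divr_gt0.
have -> : ln 2 * N%:R = ln (2 ^+ N) :> R by rewrite lnXn// mulr_natr.
have cy : 0 < c / y by rewrite divr_gt0.
have cs0 : 0 < c / s by rewrite divr_gt0.
rewrite -lnV ?posrE ?divr_gt0// invf_div -(lnM (x:=c / s)) ?posrE//.
rewrite ler_ln ?posrE ?(mulr_gt0 cs0)//.
rewrite ler_pdivrMr// -!mulrA ler_peMr ?(ltW c0)// mulrC ler_pdivlMr// mul1r mulrC.
by rewrite -ler_pdivrMr.
Qed.

Lemma cmod_lt_square b z (h : R) : cmod (z - b) < h ->
  square b h (complex.Re z, complex.Im z).
Proof.
move=> zh; have := le_lt_trans (ge_cmod_Re _) zh; have := le_lt_trans (ge_cmod_Im _) zh.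
rewrite cReD cImD cReN cImN !ltr_norml /square /= !in_itv /= => /andP[? ?] /andP[? ?].
by split; apply/andP; split; lra.
Qed.

End PlaneSquares.

Section GreenBounds.
Context {R : realType}.
Implicit Types (z w b : R[i]).
Variables (rho r : R).
Hypotheses (r0 : 0 < r) (r_rho : r < rho).
Let rho0 : 0 < rho := lt_trans r0 r_rho.

Lemma blaschke_lower_near b z : cmod b < rho -> cmod z <= r ->
  cmod (z - b) / (rho + r) <= cmod (blaschke rho b z).
Proof.
move=> br zr; have zrho := le_trans zr (ltW r_rho).
rewrite cmod_blaschke// ler_pdivlMr ?cmod_gt0 ?blaschke_den//.
rewrite -mulrA [leRHS]mulrC ler_wpM2l ?cmod_ge0// mulrC ler_pdivrMr ?addr_gt0//.
apply: (le_trans (cmodD _ _)).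
rewrite cmodN cmodM cmod_conj cmod_real ger0_norm ?sqr_ge0// mulrDr expr2 lerD2l.
by apply: ler_pM; rewrite ?cmod_ge0// ltW.
Qed.

(** Among points at given distances from the centre, the Green function is
    largest when they lie on the same radius. *)
Lemma green_aligned b z : cmod b < rho -> cmod z < cmod b ->
  - ln (cmod (blaschke rho b z)) <=
  (rho - cmod b) * (rho + cmod z) / (rho * (cmod b - cmod z)).
Proof.
move=> br zb; have zrho := le_trans (ltW zb) (ltW br).
have zneb : z != b by apply: contraTneq zb => ->; rewrite ltxx.
have B0 : 0 < cmod (blaschke rho b z) by rewrite cmod_gt0 blaschke_eq0.
have d0 : 0 < cmod b - cmod z by rewrite subr_gt0.
pose t := (rho ^+ 2 - cmod b * cmod z) / (rho * (cmod b - cmod z)).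
have num0 : 0 < rho ^+ 2 - cmod b * cmod z.
  rewrite subr_gt0 expr2; apply: (@le_lt_trans _ _ (cmod b * rho)).
    by rewrite ler_wpM2l ?cmod_ge0.
  by rewrite ltr_pM2r.
have t0 : 0 < t by rewrite divr_gt0// mulr_gt0.
have Bt : (cmod (blaschke rho b z))^-1 <= t.
  rewrite cmod_blaschke// invf_div.
  have dist : cmod b - cmod z <= cmod (z - b).
    by rewrite cmodB; apply: le_trans (ler_norm _) _; exact: ler_distcmod.
  have zb0 : 0 < cmod (z - b) := lt_le_trans d0 dist.
  have T0 : 0 <= t * (rho * cmod (z - b)).
    by apply: mulr_ge0; [exact: ltW|rewrite mulr_ge0 ?cmod_ge0 ?(ltW rho0)].
  rewrite ler_pdivrMr ?mulr_gt0// -(ler_pXn2r (n:=2)) ?nnegrE ?cmod_ge0 ?T0//.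
  have := blaschke_identity rho b z => id.
  have -> : cmod (real_complex R (rho ^+ 2) - conjc b * z) ^+ 2 =
    rho ^+ 2 * cmod (z - b) ^+ 2 + (rho ^+ 2 - cmod z ^+ 2) * (rho ^+ 2 - cmod b ^+ 2).
    by rewrite -id; ring.
  have t2 : t ^+ 2 = 1 + (rho ^+ 2 - cmod z ^+ 2) * (rho ^+ 2 - cmod b ^+ 2) /
      (rho ^+ 2 * (cmod b - cmod z) ^+ 2).
    by rewrite /t; field; rewrite (lt0r_neq0 rho0) (lt0r_neq0 d0).
  set Q := (rho ^+ 2 - _) * _ in t2 *.
  have Q0 : 0 <= Q.
    by rewrite mulr_ge0// subr_ge0; apply: lerXn2r; rewrite ?nnegrE ?cmod_ge0 ?(ltW rho0) ?(ltW br).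
  have -> : (t * (rho * cmod (z - b))) ^+ 2 =
      rho ^+ 2 * cmod (z - b) ^+ 2 + Q * (cmod (z - b) ^+ 2 / (cmod b - cmod z) ^+ 2).
    rewrite (exprMn 2 t) t2; move: Q {Q0 t2 id} => Q.
    by field; rewrite (lt0r_neq0 rho0) (lt0r_neq0 d0).
  rewrite lerD2l ler_peMr// ler_pdivlMr ?exprn_gt0// mul1r.
  by apply: lerXn2r; rewrite ?nnegrE ?cmod_ge0 ?(ltW d0).
rewrite -lnV ?posrE//; apply: (@le_trans _ _ (ln t)).
  by rewrite ler_ln ?posrE ?invr_gt0.
have t1 : t = 1 + (t - 1) by rewrite addrC subrK.
rewrite t1; apply: (le_trans (le_ln1Dx _)); first by rewrite ltrBrDr addrC subrr.
rewrite le_eqVlt; apply/orP; left; apply/eqP; rewrite /t.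
by field; rewrite (lt0r_neq0 rho0) (lt0r_neq0 d0).
Qed.

Lemma green_weight_ge b : cmod b < rho ->
  rho - Num.max r (cmod b) <= rho * (ln rho - ln (Num.max r (cmod b))).
Proof.
move=> br; set m := Num.max _ _.
have m0 : 0 < m by rewrite lt_max r0.
have := ln_ge_1subV (divr_gt0 rho0 m0); rewrite ln_div ?posrE// invf_div.
rewrite -(ler_pM2l rho0); apply: le_trans.
by rewrite mulrBr mulr1 mulrCA divff ?mulr1// gt_eqF.
Qed.

(** Seen from the disc of radius r, the Green function of a pole close to the
    outer circle is everywhere comparable to the weight of the pole. *)
Lemma greenT_far (M : R) b z : cmod b < rho -> cmod z <= r -> 2 * (rho - cmod b) <= rho - r ->
  greenT M rho b z <= 4 * (rho / (rho - r) * (ln rho - ln (Num.max r (cmod b)))).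
Proof.
move=> br zr far; have d0 : 0 < rho - r by rewrite subr_gt0.
have rb : r < cmod b by lra.
have zb : cmod z < cmod b := le_lt_trans zr rb.
have zneb : z != b by apply: contraTneq zb => ->; rewrite ltxx.
have zrho : cmod z <= rho by apply: le_trans zr (ltW r_rho).
apply: le_trans (le_trans (green_aligned br zb) _).
  by rewrite lerN2 ln_le_tlog// cmod_gt0 blaschke_eq0.
have := green_weight_ge br; rewrite max_r ?(ltW rb)// => w.
apply: (@le_trans _ _ (4 * ((rho - cmod b) / (rho - r)))); last first.
  by rewrite ler_pM2l// mulrAC ler_pM2r ?invr_gt0.
have -> : 4 * ((rho - cmod b) / (rho - r)) = (rho - cmod b) * (4 / (rho - r)) by ring.
rewrite -mulrA; apply: ler_wpM2l; first by rewrite subr_ge0 ltW.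
have d1 : 0 < cmod b - cmod z by rewrite subr_gt0.
rewrite ler_pdivrMr ?mulr_gt0// mulrAC ler_pdivlMr//.
have h1 : 0 <= (cmod b - cmod z - (rho - r) / 2) * rho by rewrite mulr_ge0 ?(ltW rho0)//; lra.
have h2 : 0 <= (rho - cmod z) * (rho - r) by rewrite mulr_ge0 ?(ltW d0)// subr_ge0.
by lra.
Qed.

(** The weight of a pole away from the outer circle is bounded below, so it can
    pay for the logarithmic singularity. *)
Lemma green_weight_near b : cmod b < rho -> rho - r < 2 * (rho - cmod b) ->
  1 <= 2 * (rho / (rho - r) * (ln rho - ln (Num.max r (cmod b)))).
Proof.
move=> br nr; have d0 : 0 < rho - r by rewrite subr_gt0.
have w := green_weight_ge br.
have -> : 2 * (rho / (rho - r) * (ln rho - ln (Num.max r (cmod b)))) =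
   2 * (rho * (ln rho - ln (Num.max r (cmod b)))) / (rho - r) by ring.
rewrite ler_pdivlMr// mul1r.
have [rb|bcr] := leP r (cmod b).
  by move: w; rewrite max_r//; set L := ln rho - _; lra.
by move: w; rewrite max_l ?(ltW bcr)//; set L := ln rho - _; lra.
Qed.

End GreenBounds.

(** * Planar integrals of Green functions *)

Section PlanarIntegral.
Context {R : realType}.
Implicit Types (z w b : R[i]) (F : R[i] -> option R[i]) (S : seq R[i]) (E : set R[i]).

Lemma sum_quarter_squares (s : R) n : \sum_(j < n) (4 * (s / 2 ^+ j) ^+ 2) <= 16 / 3 * s ^+ 2.
Proof.
have -> : \sum_(j < n) (4 * (s / 2 ^+ j) ^+ 2) = 16 / 3 * s ^+ 2 * (1 - (1 / 4) ^+ n).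
  elim: n => [|n IH]; first by rewrite big_ord0 expr0 subrr mulr0.
  rewrite big_ord_recr /= IH [(1 / 4) ^+ n.+1]exprS.
  have -> : (s / 2 ^+ n) ^+ 2 = s ^+ 2 * (1 / 4) ^+ n.
    have e : (2 ^+ n) ^+ 2 = 4 ^+ n :> R by rewrite -exprM mulnC exprM; congr (_ ^+ n); ring.
    by rewrite !expr_div_n e expr1n mul1r.
  by set X := (1 / 4) ^+ n; field.
have e0 : 0 <= (1 / 4) ^+ n :> R by rewrite exprn_ge0 ?divr_ge0.
have s20 : 0 <= 16 / 3 * s ^+ 2 by rewrite mulr_ge0 ?sqr_ge0 ?divr_ge0.
by apply: ler_piMr => //; move: e0; set X := _ ^+ n; lra.
Qed.

Lemma ln2_bounds : 1 / 2 <= ln (2 : R) <= 1.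
Proof.
apply/andP; split.
  by apply: le_trans (ln_ge_1subV (ltr0Sn R 1)); lra.
have := @le_ln1Dx R 1; rewrite (_ : 1 + 1 = 2)//; apply; lra.
Qed.

Lemma log_size_ge2 (k r lam : R) : 0 < r -> 1 < k -> 0 < lam -> lam <= 25 / 4 * r ^+ 2 ->
  2 <= ln (100 * k * r ^+ 2 / lam).
Proof.
move=> r0 k1 lam0 lam_le; have /andP[l2 _] := ln2_bounds.
have k0 : 0 < k by lra.
apply: (@le_trans _ _ (ln (2 ^+ 4))); first by rewrite lnXn// -[ln _ *+ _]mulr_natl; lra.
rewrite ler_ln ?posrE ?divr_gt0 ?mulr_gt0 ?exprn_gt0//.
rewrite ler_pdivlMr//; have : r ^+ 2 <= k * r ^+ 2.
  by rewrite ler_peMl ?sqr_ge0// ltW.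
have -> : (2 : R) ^+ 4 = 16 by ring.
by lra.
Qed.

Section Bound.
Variables (r k : R) (E : set R[i]).
Hypotheses (r0 : 0 < r) (k1 : 1 < k).
Hypotheses (hE : E `<=` cdisc r) (mE : plane_measurable E).
Let rho := k * r.
Let E' := @plane_pt R @^-1` E.

(* the right-hand side is the area of a square of half-side 5 / 4 r *)
Lemma area_le : (area E <= (25 / 4 * r ^+ 2)%:E)%E.
Proof.
have -> : 25 / 4 * r ^+ 2 = 4 * (5 / 4 * r) ^+ 2 by field.
rewrite -(leb2_square 0); last by rewrite mulr_ge0// ltW.
apply: le_measure; rewrite ?inE//; first exact: square_cara.
move=> p /hE hp; have rr : r < 5 / 4 * r by have := r0; lra.
have := @cmod_lt_square R 0 (plane_pt p) (5 / 4 * r); rewrite subr0.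
by case: p hp => x y hp; apply; exact: le_lt_trans hp rr.
Qed.

Lemma area_ge0 : (0 <= area E)%E.
Proof. exact: measure_ge0. Qed.

Variables (lam : R).
Hypotheses (lamE : area E = lam%:E) (lam0 : 0 < lam).
Let L := ln (100 * k * r ^+ 2 / lam).
(* [square b s] has the area of E *)
Let s := Num.sqrt lam / 2.

Let lam_le : lam <= 25 / 4 * r ^+ 2.
Proof. by rewrite -lee_fin -lamE area_le. Qed.
Let s0 : 0 < s. Proof. by rewrite divr_gt0// sqrtr_gt0. Qed.
Let s2 : s ^+ 2 = lam / 4.
Proof. by rewrite /s expr_div_n sqr_sqrtr ?ltW//; congr (_ / _); ring. Qed.
Let s_r : s <= 5 / 4 * r.
Proof.
rewrite -(ler_pXn2r (n:=2)) ?nnegrE ?(ltW s0) ?mulr_ge0 ?(ltW r0)// s2.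
by have := lam_le; lra.
Qed.
Let k0 : 0 < k. Proof. exact: lt_trans k1. Qed.
Let rho_r : r < rho. Proof. by rewrite /rho ltr_pMl. Qed.

Let L_ge2 : 2 <= L.
Proof. exact: log_size_ge2. Qed.

Let c := rho + r.
Let s_c : s <= c.
Proof. by apply: (le_trans s_r); rewrite /c; have := rho_r; have := r0; lra. Qed.

(* 4 / 3 is the sum of the areas of the nested squares, relative to the first *)
Let L_near : ln (c / s) + 4 / 3 <= L.
Proof.
have c0 : 0 < c := lt_le_trans s0 s_c.
have cs0 : 0 < c / s by rewrite divr_gt0.
have l3 : 4 / 3 <= ln (3 ^+ 2) :> R.
  rewrite lnXn// -[ln _ *+ _]mulr_natl; have := @ln_ge_1subV R 3 ltac:(by []); lra.
apply: (@le_trans _ _ (ln (c / s) + ln (3 ^+ 2))); first by rewrite lerD2l.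
have p1 : 0 < c / s * 3 ^+ 2 by rewrite mulr_gt0// exprn_gt0.
have p2 : 0 < 100 * k * r ^+ 2 / lam by rewrite divr_gt0// mulr_gt0 ?exprn_gt0// mulr_gt0.
rewrite -lnM ?posrE ?exprn_gt0// ler_ln ?posrE//.
rewrite ler_pdivlMr//.
have -> : c / s * 3 ^+ 2 * lam = 36 * (c * s).
  have -> : lam = 4 * s ^+ 2 by rewrite s2; field.
  by field; rewrite (lt0r_neq0 s0).
have h1 : c * s <= (2 * (k * r)) * (5 / 4 * r).
  apply: ler_pM => //; rewrite ?(ltW c0) ?(ltW s0)//.
  by rewrite /c; have := rho_r; rewrite /rho; lra.
have h2 : 0 <= k * r ^+ 2 by rewrite mulr_ge0 ?sqr_ge0// ltW.
by apply: (le_trans (ler_wpM2l _ h1)) => //; lra.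
Qed.

Let q b := rho / (rho - r) * (ln rho - ln (Num.max r (cmod b))).

(** A majorant of the truncated Green function on the disc of radius r, with
    integral controlled by its weight: constant for a pole close to the outer
    circle, otherwise a staircase of squares around the pole. *)
Lemma green_majorant (M : R) n b : cmod b < rho -> M <= n%:R * ln 2 ->
  exists g : R * R -> \bar R,
    integral_bound (@leb2 R) E' g (2 * q b * lam * L)%:E /\
    forall p, E' p -> ((greenT M rho b (plane_pt p))%:E <= g p)%E.
Proof.
move=> br Mn; have L0 : 0 <= L by apply: le_trans L_ge2.
have mE' : measurable (E' : set (caratheodory_type _)) := mE.
have lamE' : leb2 E' = lam%:E by exact: lamE.
have q0 : 0 <= q b.
  rewrite /q mulr_ge0//; first by rewrite divr_ge0 ?subr_ge0 ?(ltW rho_r)// ltW// (lt_trans r0).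
  rewrite subr_ge0 ler_ln ?posrE ?lt_max ?r0// ?(lt_trans r0 rho_r)//.
  by rewrite ge_max (ltW rho_r) (ltW br).
have [far|near_] := leP (2 * (rho - cmod b)) (rho - r).
  exists (fun=> (4 * q b)%:E); split.
    have [m1 m2 m3] := @integral_bound_cst R _ _ (@leb2 R) E' mE' (4 * q b) (mulr_ge0 (ler0n _ 4) q0).
    split => //; apply: (le_trans m3); rewrite [X in (_ * X <= _)%E](_ : _ = lam%:E)// -EFinM lee_fin.
    have : 0 <= q b * lam * (L - 2) by rewrite mulr_ge0 ?subr_ge0// mulr_ge0// ltW.
    by clear m1 m2 m3 mE' lamE'; lra.
  by move=> p Ep; rewrite lee_fin; apply: greenT_far => //; exact: hE.
exists (fun p => (ln (c / s))%:E + (ln 2)%:E * \sum_(j < n) (\1_(square b (s / 2 ^+ j)) p)%:E)%E.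
have lcs : 0 <= ln (c / s) by rewrite ln_ge0// ler_pdivlMr// mul1r.
have /andP[l20 l21] := ln2_bounds.
have ln20 : 0 <= ln 2 :> R by lra.
have sq j : 0 <= s / 2 ^+ j by rewrite divr_ge0 ?(ltW s0)// exprn_ge0.
split.
  have [m1 m2 m3] := @integral_boundD R _ _ (@leb2 R) E' mE' _ _ _ _
    (@integral_bound_cst R _ _ (@leb2 R) E' mE' _ lcs)
    (@integral_boundZ R _ _ (@leb2 R) E' mE' _ _ _ ln20 (@integral_bound_sum R _ _ (@leb2 R) E' mE' _ (index_enum 'I_n) predT _ _
       (fun j _ => @integral_bound_indic R _ _ (@leb2 R) E' mE' _ (square_cara b (s / 2 ^+ j))))).
  split => //; apply: (le_trans m3).
  rewrite (eq_bigr (fun j : 'I_n => (4 * (s / 2 ^+ j) ^+ 2)%:E)); last first.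
    by move=> j _; exact: leb2_square.
  rewrite sumEFin [X in (_ * X + _ <= _)%E](_ : _ = lam%:E)// -!EFinM -EFinD lee_fin.
  have S1 := sum_quarter_squares s n; rewrite s2 in S1.
  set Sg := \sum_(j < n) _ in S1 *.
  have Sg0 : 0 <= Sg by apply: sumr_ge0 => j _; rewrite mulr_ge0// sqr_ge0.
  have S2 : ln 2 * Sg <= 4 / 3 * lam.
    apply: (@le_trans _ _ (1 * Sg)); first by rewrite ler_wpM2r.
    by clear m1 m2 m3 mE' lamE'; rewrite mul1r; lra.
  have q1 : 1 <= 2 * q b by exact: green_weight_near.
  apply: (@le_trans _ _ (lam * L)).
    have : 0 <= (L - (ln (c / s) + 4 / 3)) * lam by rewrite mulr_ge0 ?subr_ge0 ?L_near// ltW.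
    by clear m1 m2 m3 mE' lamE'; lra.
  by rewrite -mulrA ler_peMl// mulr_ge0// ltW.
move=> p Ep; have pr : cmod (plane_pt p) <= r := hE Ep.
rewrite sumEFin -EFinM -EFinD lee_fin.
apply: (@le_trans _ _ (- tlog M (cmod (plane_pt p - b) / c))).
  by rewrite lerN2 le_tlog//; exact: blaschke_lower_near.
apply: (le_trans (tlog_stair_le s0 s_c (cmod_ge0 _) Mn)).
rewrite lerD2l ler_wpM2l// stair_sum; apply: ler_sum => j _.
have [yj|_] := ltP; last by [].
rewrite indicE; have := cmod_lt_square yj; case: p {Ep pr yj} => x y /= h.
by rewrite mem_set.
Qed.

End Bound.
End PlanarIntegral.

(** * Planar integrals of the positive logarithm *)

Section PlanarLogIntegral.
Context {R : realType}.
Implicit Types (z w b : R[i]) (F : R[i] -> option R[i]) (S : seq R[i]) (E : set R[i]).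

Lemma xlog_EFin (c s : R) : 0 < c -> 0 < s -> xlog c s%:E = (s * ln (c / s))%:E.
Proof.
move=> c0 s0; rewrite /xlog eqe gt_eqF// inver gt_eqF// -EFinM lne_EFin ?divr_gt0//.
Qed.

Lemma area_fin E (r : R) : 0 < r -> E `<=` cdisc r -> plane_measurable E ->
  exists2 lam : R, 0 <= lam & area E = lam%:E.
Proof.
move=> r0 hE mE; have := area_le r0 hE mE; have := area_ge0 E.
by case: (area E) => // a; rewrite lee_fin => a0 _; exists a.
Qed.

(** In the Poisson-Jensen inequality each Green function is integrated through its
    majorant, at a cost of (2 k / (k - 1)) |E| ln (100 k r^2 / |E|) times the weight
    ln rho - ln max (r, |b|) of the pole, and the weights sum to at most the
    increment of the counting function.  The constant A makes room for a bounded
    summand of the integrand. *)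
Lemma plane_integral_log_le F (r0 r k A : R) E : meromorphic F -> 0 < r0 -> r0 < r -> 1 < k ->
  0 <= A -> E `<=` cdisc r -> plane_measurable E ->
  (plane_integral E (fun z => A%:E + lnp (smod (F z))) <= A%:E * area E +
    (2 * k / (k - 1))%:E * (nevT (k * r) F - Npoles r0 F) * xlog (100 * k * r ^+ 2) (area E))%E.
Proof.
move=> mF r00 r0r k1 A0 hE mE; have rp : 0 < r := lt_trans r00 r0r.
set rho := k * r.
have rrho : r < rho by rewrite /rho ltr_pMl.
have rho0 : 0 < rho := lt_trans rp rrho.
have [S uS SE] := finite_poles rho mF.
have PS : pole_set F rho S by split.
rewrite (nevT_sub_Npoles PS r00 (lt_trans r0r rrho)).
have k10 : 0 < k - 1 by rewrite subr_gt0.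
have k0 : 0 < k by lra.
have /andP[V0 VW] := pole_weights_le PS r00 (ltW r0r) (ltW rrho).
set W := \sum_(b <- S) _ in VW *; set V := \sum_(b <- S | _) _ in V0 VW.
have [lam lam0 lamE] := area_fin rp hE mE.
move: lam0; rewrite le_eqVlt => /predU1P[lam0|lam0].
  rewrite lamE -lam0 /xlog eqxx !mule0 adde0 /plane_integral.
  rewrite (@integral_null _ _ _ (@leb2 R))//; first by rewrite [LHS]lamE -lam0.
  by move=> x _; rewrite adde_ge0 ?lnp_ge0// lee_fin.
have c0 : 0 < 100 * k * r ^+ 2 by rewrite mulr_gt0 ?exprn_gt0// mulr_gt0.
rewrite lamE xlog_EFin//; set L := ln _.
have lam_le : lam <= 25 / 4 * r ^+ 2 by rewrite -lee_fin -lamE; exact: area_le.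
have L2 : 2 <= L by exact: log_size_ge2.
have lamL : 0 < lam * L by rewrite mulr_gt0//; lra.
have cc0 : 0 < 2 * k / (k - 1) by rewrite divr_gt0// mulr_gt0.
case PE : (prox rho F) (prox_ge0 F rho) => [P| |] // P0; last first.
  by rewrite addye// gt0_muley ?lte_fin// gt0_mulye ?lte_fin// addey// leey.
rewrite lee_fin in P0; rewrite -(EFinD P) -!EFinM -EFinD.
pose C := (k + 1) / (k - 1).
have C0 : 0 <= C by rewrite divr_ge0 ?(ltW k10)// addr_ge0// ltW.
pose p := pole_mult F.
pose q b := rho / (rho - r) * (ln rho - ln (Num.max r (cmod b))).
rewrite /plane_integral; apply: integral_le_trunc => [x _|M M0].
  by rewrite adde_ge0 ?lnp_ge0// lee_fin.
have ln20 : 0 < ln 2 :> R by rewrite ln_gt0// ltr1n.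
have [n Mn] : exists n : nat, M <= n%:R * ln 2.
  exists (Num.Def.archi_bound (M / ln 2)); rewrite -ler_pdivrMr// ltW//.
  by apply: archi_boundP; rewrite divr_ge0 ?(ltW ln20).
have maj b : exists g : R * R -> \bar R, cmod b < rho ->
    integral_bound (@leb2 R) (@plane_pt R @^-1` E) g (2 * q b * lam * L)%:E /\
    forall x, E (plane_pt x) -> ((greenT M rho b (plane_pt x))%:E <= g x)%E.
  have [br|nbr] := boolP (cmod b < rho); last by exists (fun=> 0%E) => br.
  have [g gP] := green_majorant rp k1 hE mE lamE lam0 br Mn.
  by exists g => _; exact: gP.
have [g gP] := choice maj.
pose f (x : R * R) : \bar R := ((A + C * P)%:E + \sum_(b <- S | (cmod b < rho)%R) ((p b)%:R)%:E * g b x)%E.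
have mE' : measurable ((@plane_pt R @^-1` E) : set (caratheodory_type _)) := mE.
have fb : integral_bound (@leb2 R) (@plane_pt R @^-1` E) f
    ((A + C * P)%:E * lam%:E + \sum_(b <- S | (cmod b < rho)%R) ((p b)%:R)%:E * (2 * q b * lam * L)%:E)%E.
  apply: (@integral_boundD R _ _ (@leb2 R) _ mE').
    rewrite -lamE; apply: (@integral_bound_cst R _ _ (@leb2 R) _ mE').
    by rewrite addr_ge0// mulr_ge0.
  apply: (@integral_bound_sum R _ _ (@leb2 R) _ mE') => b br.
  by apply: (@integral_boundZ R _ _ (@leb2 R) _ mE') => //; have [] := gP b br.
have [_ f0 fI] := fb.
apply: (@le_trans _ _ (\int[@leb2 R]_(x in @plane_pt R @^-1` E) f x)%E).
  apply: ge0_le_integral_any => x Ex; first by rewrite le_min adde_ge0 ?lnp_ge0 ?lee_fin.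
  have xr : cmod (plane_pt x) <= r := hE _ Ex.
  have xrho := le_lt_trans xr rrho.
  apply: (@le_trans _ _ (A%:E + mine (lnp (smod (F (plane_pt x)))) M%:E)%E).
    have [_|_] := leP (lnp _) M%:E; rewrite ge_min ?lexx//.
    by rewrite leeDr ?lee_fin ?orbT.
  rewrite /f EFinD -addeA leeD2l//.
  apply: (le_trans (poisson_jensen_trunc mF uS SE xrho PE P0 M0)).
  rewrite EFinD; apply: leeD.
    by rewrite lee_fin ler_wpM2r// poisson_kernel_le.
  rewrite -sumEFin; apply: lee_sum => b br; rewrite EFinM; apply: lee_wpmul2l.
    by rewrite lee_fin.
  by have [_] := gP b br; apply.
apply: (le_trans fI).
have -> : (\sum_(b <- S | (cmod b < rho)%R) ((p b)%:R)%:E * (2 * q b * lam * L)%:E)%E =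
    (2 * k / (k - 1) * V * (lam * L))%:E.
  under eq_bigr do rewrite -EFinM.
  rewrite sumEFin; congr EFin; rewrite /V mulr_sumr mulr_suml; apply: eq_bigr => b br.
  have -> : q b = k / (k - 1) * (ln rho - ln (Num.max r (cmod b))).
    rewrite /q; congr (_ * _); rewrite /rho; field.
    rewrite !(@lt0r_neq0 _ (_ - _))//= ?(gt_eqF rp)//.
    by rewrite subr_gt0 -/rho.
  by rewrite -/p; set l := ln rho - _; set kk := k - 1; ring.
rewrite -EFinM -EFinD lee_fin mulrDl -addrA lerD2l mulrDr mulrDl; apply: lerD; last first.
  by rewrite ler_wpM2r ?(ltW lamL)// ler_wpM2l// ltW.
rewrite -[leRHS]mulrA; have -> : C * P * lam = C * (P * lam) by ring.
have -> : P * (lam * L) = (P * lam) * L by ring.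
have Pl : 0 <= P * lam by rewrite mulr_ge0// ltW.
apply: ler_pM => //.
  by rewrite /C ler_pM2r ?invr_gt0//; clear -k1; lra.
by rewrite ler_peMr//; clear -L2; lra.
Qed.

End PlanarLogIntegral.

(** * Jensen's formula for the reciprocal of an entire function *)

Section Jensen.
Context {R : realType}.
Implicit Types (z w b : R[i]) (f g : R[i] -> R[i]) (F : R[i] -> option R[i]) (S : seq R[i]).
Local Notation cr := (real_complex R).

Definition recip f := inv_sphere (to_sphere f).

Lemma recip_meromorphic f : entire f -> (exists z, f z <> 0) -> meromorphic (recip f).
Proof.
move=> hf f0 z; have cf w : cdiff f w by apply/holo_cdiff.
have [n [g [cg gz fE]]] := entire_zero_order z cf f0.
have gz0 : 0 < cmod (g z) by rewrite cmod_gt0; exact/eqP.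
have [d d0 hd] := cdiff_continuous (cg z) gz0.
have gn w : cmod (w - z) < d -> g w != 0.
  by move=> /hd; apply: contraTneq => ->; rewrite sub0r cmodN ltxx.
exists n, (fun w => (g w)^-1); split.
- by apply/nearC_cmod; exists d => // w /gn gw; apply/holo_cdiff/cdiffV.
- by move=> _; apply/eqP; rewrite invr_eq0; exact/eqP.
apply/nearC_cmod; exists d => // w /gn gw.
rewrite /recip /inv_sphere /to_sphere fE mulf_eq0 (negbTE gw) orbF expf_eq0 subr_eq0 andbC.
by case: ifP => // _; rewrite invfM mulrC.
Qed.

Lemma lnp_recip f z : lnp (smod (recip f z)) = negpart (lnmod f) z.
Proof.
rewrite /recip /inv_sphere /to_sphere /negpart /pospart /lnmod; case: eqP => [->|/eqP f0].
  by rewrite cmod0 /smod lnp_pinfty le0_lneNy//= max_r ?leey.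
have c0 : 0 < cmod (f z) by rewrite cmod_gt0.
by rewrite /lnp /smod cmodV !lne_EFin ?invr_gt0// lnV ?posrE.
Qed.

Lemma abse_lnmod f z :
  `|lnmod f z|%E = (lnp (smod (to_sphere f z)) + lnp (smod (recip f z)))%E.
Proof.
rewrite lnp_recip; have split_abs (y : \bar R) : (`|y| = maxe 0 y + maxe 0 (- y))%E.
  case: y => [x| |].
  - have [x0|x0] := leP 0 x.
      by rewrite [in RHS]max_r ?lee_fin// max_l ?oppe_le0 ?lee_fin// adde0 /=  ger0_norm.
    rewrite max_l ?lee_fin ?(ltW x0)// max_r ?oppe_ge0 ?lee_fin ?(ltW x0)//.
    by rewrite add0e /=  ltr0_norm.
  - by rewrite max_r ?leey// max_l ?adde0// leNye.
  - by rewrite max_l ?leNye// max_r ?add0e// leey.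
exact: split_abs.
Qed.

Lemma lnp_recip_trunc f z (M : R) : 0 <= M ->
  mine (lnp (smod (recip f z))) M%:E = (tlog 0 (cmod (f z)) - tlog M (cmod (f z)))%:E.
Proof.
move=> M0; have e1 : expR (- M) <= 1 by rewrite -[leRHS]expR0 ler_expR oppr_le0.
rewrite lnp_recip /negpart /pospart /lnmod /tlog oppr0 expR0; set x := cmod _.
have : 0 <= x by exact: cmod_ge0.
rewrite le_eqVlt => /predU1P[<-|x0].
  rewrite le0_lneNy//= max_r ?leey// min_r ?leey// !max_r ?ler01 ?expR_ge0//.
  by rewrite ln1 expRK sub0r opprK.
rewrite lne_EFin// -EFinN -!EFin_max -EFin_min; congr EFin.
have [x1|x1] := leP 1 x.
  rewrite (max_l (le_trans e1 x1)) subrr max_l ?min_l// oppr_le0.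
  by rewrite ln_ge0.
rewrite ln1 sub0r max_r; last by rewrite oppr_ge0 ln_le0// ltW.
have [xM|xM] := leP x (expR (- M)).
  by rewrite expRK opprK min_r// lerNr -[leRHS]expRK ler_ln ?posrE ?expR_gt0.
by rewrite min_l// lerNl -[leLHS]expRK ler_ln ?posrE ?expR_gt0// ltW.
Qed.

(** Sub-mean-value inequality at the centre, read as an upper bound for the mean
    of the positive part of -ln|f|. *)
Lemma prox_recip_le f g (rho : R) : 0 < rho -> (forall z, cdiff f z) ->
  (forall w, cmod w <= rho -> cdiff g w) -> g 0 != 0 ->
  (forall w, cmod w = rho -> cmod (g w) = cmod (f w)) ->
  (prox rho (recip f) <= (cmean (logcirc 0 f rho) - ln (cmod (g 0)))%:E)%E.
Proof.
move=> rho0 cf cg g0 gf; set X := _ - _; have p0 := @pi2_gt0 R.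
have cl M : continuous (logcirc M f rho) by apply: logcirc_continuous => //; exact: ltW.
apply: circ_mean_le_trunc => [z|M M0]; first exact: lnp_ge0.
under eq_integral do rewrite lnp_recip_trunc//.
rewrite rint_EFin; last first.
  by apply: continuous_icont => th; exact: (continuousB (cl 0 th) (cl M th)).
have -> : rint (fun th => tlog 0 (cmod (f (polar rho th))) - tlog M (cmod (f (polar rho th)))) 0 (2 * pi)
    = 2 * pi * (cmean (logcirc 0 f rho) - cmean (logcirc M f rho)).
  rewrite mulrBr -!rint_cmean; apply: (rintB (f:=logcirc 0 f rho) (g:=logcirc M f rho));
    exact: continuous_icont.
rewrite lee_fin ler_pM2l// lerD2l lerN2.
have := submean_centre M rho0 cg.
have -> : logcirc M g rho = logcirc M f rho.
  by apply/funext => th; rewrite /logcirc gf// cmod_polar// ltW.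
by move=> h; rewrite -ler_expR lnK// posrE cmod_gt0.
Qed.

(** Jensen's formula as an inequality.  Removing the poles of 1/f from the disc
    of radius rho by factors of modulus 1 on its boundary, and from the disc of
    radius r0 likewise, leaves two holomorphic functions, whose values at 0
    differ by the counting functions. *)
Lemma jensen_le f (r0 rho : R) : entire f -> (exists z, f z <> 0) -> 0 < r0 -> r0 < rho ->
  (nevT rho (recip f) - Npoles r0 (recip f) <=
    (cmean (logcirc 0 f rho))%:E + prox r0 (recip f))%E.
Proof.
move=> hf f0 r00 r0r; have rho0 : 0 < rho := lt_trans r00 r0r.
have mF := recip_meromorphic hf f0.
have cf w : cdiff f w by apply/holo_cdiff.
have [S uS SE] := finite_poles rho mF.
have PS : pole_set (recip f) rho S by split.
rewrite (nevT_sub_Npoles PS r00 r0r).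
set p := pole_mult _ in SE *; set W := \sum_(b <- S) _.
have [H [cH HS FE]] := clear_poles mF uS SE; rewrite -/p in FE.
have fE w : cmod w <= rho -> H w != 0 /\ H w * f w = \prod_(b <- S) (w - b) ^+ p b.
  move=> wr; have := FE _ wr; rewrite /recip /inv_sphere /to_sphere.
  have [wS|wS] := boolP (w \in S).
    case: eqP => // fw _; split; first exact/eqP/HS.
    rewrite fw mulr0 (bigD1_seq w)//= subrr expr0n gtn_eqF ?mul0r//.
    by move: wS; rewrite SE => /andP[].
  case: eqP => // /eqP fw -[E].
  have P0 : \prod_(b <- S) (w - b) ^+ p b != 0.
    rewrite prodf_seq_neq0; apply/allP => b bS; rewrite implyTb expf_neq0// subr_eq0.
    by apply: contraNneq wS => ->.
  move: E; set P := \prod_(_ <- _) _ in P0 * => E; clearbody P.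
  have HE : H w = P / f w by rewrite E; field.
  by rewrite HE divfK// mulf_neq0// invr_eq0.
have Sr b : b \in S -> cmod b <= rho by rewrite SE => /andP[].
(* g has no zeros inside the disc of radius rho, and |g| = |f| on its boundary *)
pose u b := if cmod b < rho then fun w => (blaschke_unit rho b w)^-1 else fun w => w - b.
have cu b w : cmod w <= rho -> cdiff (u b) w.
  move=> wr; rewrite /u; case: ifP => br; last by apply: cdiffB; [exact: cdiff_id|exact: cdiff_cst].
  by apply: cdiffV; [exact: blaschke_unit_neq0|exact: cdiff_blaschke_unit].
have u0 b : b \in S -> cmod (u b 0) = rho.
  move=> bS; rewrite /u; case: ifPn => br.
    rewrite /blaschke_unit mulr0 subr0 !cmodV !cmodM cmodV !cmod_real !gtr0_norm ?exprn_gt0//.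
    by field; rewrite gt_eqF.
  by rewrite sub0r cmodN; apply/le_anti; rewrite Sr// leNgt.
pose g w := (H w)^-1 * \prod_(b <- S) u b w ^+ p b.
have [U0 UE] := @ln_prod_pow R S (fun b => cmod (u b 0)) p ltac:(by move=> b /u0 ->).
have g0E : cmod (g 0) = (cmod (H 0))^-1 * \prod_(b <- S) cmod (u b 0) ^+ p b.
  by rewrite cmodM cmodV cmod_prodX.
have H00 : 0 < cmod (H 0) by rewrite cmod_gt0; apply: (fE 0 _).1; rewrite cmod0 ltW.
have g0 : g 0 != 0 by rewrite -cmod_gt0 g0E mulr_gt0 ?invr_gt0.
have cg w : cmod w <= rho -> cdiff g w.
  move=> wr; apply: cdiffM; first by apply: cdiffV; [exact: (fE w wr).1|exact: cH].
  by apply: cdiff_prod => b bS _; apply: cdiffX; exact: cu.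
have gf w : cmod w = rho -> cmod (g w) = cmod (f w).
  move=> wr; have [Hw HP] := fE w (le_eq wr).
  have Hc : cmod (H w) != 0 by rewrite cmod_eq0.
  apply: (mulfI Hc); rewrite -[RHS]cmodM HP cmodM cmodV mulVKf// !cmod_prodX.
  apply: eq_bigr => b bS; congr (_ ^+ _); rewrite /u; case: ifP => // br.
  have := cmod_blaschke_circle rho0 br wr; rewrite /blaschke cmodM cmodV => E.
  have wr' : cmod w <= rho by rewrite wr.
  have un : cmod (blaschke_unit rho b w) != 0 by rewrite cmod_eq0 blaschke_unit_neq0.
  by apply: (mulIf un); rewrite E mulVf.
have up := prox_recip_le rho0 cf cg g0 gf.
set A := cmean _ in up *.
apply: (@le_trans _ _ ((A - ln (cmod (g 0)))%:E + W%:E)%E); first by rewrite leeD2r.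
case QE : (prox r0 (recip f)) (prox_ge0 (recip f) r0) => [Q| |] // Q0; last by rewrite addey// leey.
rewrite -!EFinD lee_fin; rewrite -addrA lerD2l addrC lerBlDr.
apply/ler_addgt0Pr => e e0.
pose K := \sum_(b <- S) (p b)%:R : R.
have K0 : 0 <= K by apply: sumr_ge0.
have K1 : 0 < K + 1 by rewrite ltr_wpDl.
(* with this s, moving the poles off the inner circle costs at most e *)
pose s := 1 + e / (K + 1).
have s1 : 1 < s by rewrite /s ltrDl divr_gt0.
have s0 : 0 < s := lt_trans ltr01 s1.
pose v := pole_factor s r0.
have v0 b : cmod (v b 0) = (if cmod b < r0 then r0 else s * cmod b)^-1.
  rewrite /v /pole_factor; case: ltP => br; last by rewrite cmodV sub0r cmodN cmodM cmod_real gtr0_norm.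
  rewrite /blaschke_unit mulr0 subr0 !cmodM cmodV !cmod_real !gtr0_norm ?exprn_gt0//.
  by field; rewrite gt_eqF.
have [cphi] := pole_free_mean r00 (ltW r0r) s1 cH FE.
set phi := (G in logcirc 0 G); rewrite QE lee_fin in cphi * => Qphi.
have vpos b : 0 < cmod (v b 0).
  by rewrite cmod_gt0 pole_factor_neq0// cmod0 ltW.
have [V0 VE] := @ln_prod_pow R S (fun b => cmod (v b 0)) p (fun b _ => vpos b).
have phi0E : cmod (phi 0) = cmod (H 0) * \prod_(b <- S) cmod (v b 0) ^+ p b.
  by rewrite cmodM cmod_prodX.
have phi0 : ln (cmod (phi 0)) <= Q.
  apply: le_trans Qphi; have := submean_centre 0 r00 cphi.
  by move=> h; rewrite -ler_expR lnK// posrE phi0E mulr_gt0.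
have : ln (cmod (phi 0)) + ln (cmod (g 0)) =
    \sum_(b <- S) (p b)%:R * (ln (cmod (u b 0)) + ln (cmod (v b 0))).
  rewrite phi0E g0E !lnM ?posrE ?invr_gt0// lnV ?posrE// UE VE.
  under [RHS]eq_bigr do rewrite mulrDr.
  by rewrite big_split /=; set x := ln _; set y := \sum_(_ <- _) _; set z := \sum_(_ <- _) _; ring.
move=> E; rewrite -[leRHS]addrA [_ + e]addrC addrA.
have ls : ln s <= e / (K + 1).
  apply: (le_trans (le_ln1Dx _)) => //.
  by apply: lt_trans (divr_gt0 e0 K1); rewrite ltrN10.
suff : W <= ln (cmod (phi 0)) + ln (cmod (g 0)) + e by move: phi0; lra.
rewrite E; apply: (@le_trans _ _ (\sum_(b <- S) (p b)%:R * (ln (cmod (u b 0)) + ln (cmod (v b 0)))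
    + \sum_(b <- S) (p b)%:R * ln s)).
  rewrite -big_split /= /W big_seq [leRHS]big_seq; apply: ler_sum => b bS.
  rewrite -mulrDr ler_wpM2l// -addrA (u0 _ bS) lerD2l v0 lnV; last first.
    by rewrite posrE -invr_gt0 -v0.
  rewrite -lerBlDr -opprD lerN2; case: ltP => br.
    by rewrite lerDl ln_ge0// ltW.
  by rewrite lnM ?posrE ?(lt_le_trans r00 br)// addrC.
rewrite lerD2l -mulr_suml -/K; apply: (le_trans (ler_wpM2l K0 ls)).
by rewrite mulrA ler_pdivrMr// mulrC ler_wpM2l ?(ltW e0)// lerDl.
Qed.

(** The supremum over the circle is finite by continuity, and the maximum principle
    makes it a bound on the whole disc. *)
Lemma circ_sup_log f (rho : R) : entire f -> 0 < rho ->
  exists x : R, [/\ 0 <= x, circ_sup (pospart (lnmod f)) rho = x%:E &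
    forall z, cmod z <= rho -> tlog 0 (cmod (f z)) <= x].
Proof.
move=> hf rho0; have cf w : cdiff f w by apply/holo_cdiff.
have tE z : pospart (lnmod f) z = (tlog 0 (cmod (f z)))%:E.
  by rewrite -lnp_tlog ?cmod_ge0.
have [M M0 hM] := @circle_bounded R f 0 rho (fun w _ => cf w).
have cp : ccircle rho (polar rho 0) by exact: (cmod_polar 0 (ltW rho0)).
have lb z : ccircle rho z -> ((tlog 0 (cmod (f z)))%:E <= circ_sup (pospart (lnmod f)) rho)%E.
  by move=> hz; rewrite -tE; apply: ereal_sup_ubound; exists z.
have ub : (circ_sup (pospart (lnmod f)) rho <= (tlog 0 M)%:E)%E.
  apply: ge_ereal_sup => _ [z hz <-]; rewrite tE lee_fin; apply: le_tlog.
  by apply: hM; rewrite subr0.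
case: (circ_sup _ _) lb ub => [x| |] lb // ub; last first.
  by have := lb _ cp; rewrite leeNy_eq.
have x0 : 0 <= x by have := lb _ cp; rewrite lee_fin; apply: le_trans; exact: tlog0_ge0.
exists x; split => // z zr.
rewrite /tlog oppr0 expR0 -[leRHS]expRK ler_ln ?posrE ?expR_gt0 ?lt_max ?ltr01 ?orbT//.
have e1 : 1 <= expR x by rewrite -[leLHS]expR0 ler_expR.
rewrite ge_max e1 andbT.
apply: (maximum_principle (rho:=rho)) => //.
move=> w wr; have := lb w wr; rewrite lee_fin => h.
by apply: (le_trans (expR_tlog 0 _)); rewrite ler_expR.
Qed.

End Jensen.

(** * Entire functions *)

Section EntireFunctions.
Context {R : realType}.
Implicit Types (z w b : R[i]) (f g : R[i] -> R[i]) (F : R[i] -> option R[i]) (E : set R[i]).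

Lemma circ_sup_le_max_mod f (rho : R) :
  (circ_sup (pospart (lnmod f)) rho <= lnp (max_mod rho (to_sphere f)))%E.
Proof.
apply: ge_ereal_sup => _ [z hz <-].
have h : ((cmod (f z))%:E <= max_mod rho (to_sphere f))%E.
  by apply: ereal_sup_ubound; exists z.
have c0 : (0 <= (cmod (f z))%:E)%E by rewrite lee_fin cmod_ge0.
have c1 := le_trans c0 h.
rewrite /pospart /lnp ge_max; apply/andP; split; rewrite le_max ?lexx//.
by apply/orP; right; rewrite /lnmod lee_lne// in_itv/= leey andbT.
Qed.

Lemma prox_le_cst F (t x : R) : 0 <= t ->
  (forall z, cmod z = t -> lnp (smod (F z)) <= x%:E)%E -> (prox t F <= x%:E)%E.
Proof.
move=> t0 Fx; have p0 := @pi2_gt0 R; apply: circ_mean_le_trunc => [z|M M0]; first exact: lnp_ge0.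
apply: (@le_trans _ _ (\int[@lebesgue_measure R]_(phi in `[0%R, (2 * pi)%R]) x%:E)%E).
  apply: ge0_le_integral_any => phi _; first by rewrite le_min lnp_ge0 lee_fin.
  by rewrite ge_min Fx// cmod_polar.
rewrite (rint_EFin (@continuous_icont R _ _ _ (@cst_continuous _ _ x))) lee_fin.
by rewrite rint_cst ?(ltW p0)// subr0 mulrC.
Qed.

Lemma prox2_le_cst F (r x : R) : 0 < r -> 0 <= x ->
  (forall z, (cmod z <= r)%R -> lnp (smod (F z)) <= x%:E)%E -> (prox2 r F <= x%:E)%E.
Proof.
move=> r0 x0 Fx; rewrite -[x]addr0; apply: prox2_le_linear => // t /andP[t0 tr].
rewrite mul0r addr0 EFinM; apply: lee_wpmul2r; first by rewrite lee_fin.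
by apply: prox_le_cst => // z zt; apply: Fx; rewrite zt.
Qed.

Lemma nevT_recip_le f (r0 rho x : R) : entire f -> (exists z, f z <> 0) -> 0 < r0 -> r0 < rho ->
  (forall z, cmod z <= rho -> tlog 0 (cmod (f z)) <= x) ->
  (nevT rho (recip f) - Npoles r0 (recip f) <= x%:E + prox r0 (recip f))%E.
Proof.
move=> hf f0 r00 r0r hx; have rho0 := lt_trans r00 r0r.
apply: (le_trans (jensen_le hf f0 r00 r0r)); rewrite leeD2r// lee_fin -[leRHS](@cmean_cst R).
apply: le_cmean; first by apply: logcirc_continuous; [exact: ltW|move=> w _; exact/holo_cdiff].
  exact: cst_continuous.
by move=> th; apply: hx; rewrite cmod_polar// ltW.
Qed.

(** ln^+|f| is at most its maximum on the circle of radius k r, and ln^+(1/|f|)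
    is the logarithm of a meromorphic function, whose characteristic is bounded
    by Jensen's formula. *)
Lemma plane_integral_abs_log_le f (r0 r k : R) E : entire f -> (exists z, f z <> 0) ->
  0 < r0 -> r0 < r -> 1 < k -> E `<=` cdisc r -> plane_measurable E ->
  (plane_integral E (fun z => `|lnmod f z|) <=
    (3 * k / (k - 1))%:E * (circ_sup (pospart (lnmod f)) (k * r) + prox r0 (recip f))
      * xlog (100 * k * r ^+ 2) (area E))%E.
Proof.
move=> hf f0 r00 r0r k1 hE mE; have rp := lt_trans r00 r0r.
have k0 : 0 < k := lt_trans ltr01 k1; have k10 : 0 < k - 1 by rewrite subr_gt0.
have rrho : r < k * r by rewrite ltr_pMl.
have [x [x0 -> hx]] := circ_sup_log hf (lt_trans rp rrho).
have NT := nevT_recip_le hf f0 r00 (lt_trans r0r rrho) hx.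
have := plane_integral_log_le (recip_meromorphic hf f0) r00 r0r k1 x0 hE mE.
have Q0 := prox_ge0 (recip f) r0.
set c := 2 * k / (k - 1); have c0 : 0 < c by rewrite divr_gt0// mulr_gt0.
have c30 : 0 < 3 * k / (k - 1) by rewrite divr_gt0// mulr_gt0.
have le1 : (plane_integral E (fun z => `|lnmod f z|) <=
    plane_integral E (fun z => x%:E + lnp (smod (recip f z))))%E.
  apply: ge0_le_integral_any => p Ep; first exact: abse_ge0.
  rewrite abse_lnmod leeD2r//= lnp_tlog ?cmod_ge0// lee_fin.
  by apply: hx; apply: le_trans (hE _ Ep) (ltW rrho).
move=> /(le_trans le1) /le_trans; apply.
have [lam lam0 lamE] := area_fin rp hE mE.
have lam_le : lam <= 25 / 4 * r ^+ 2 by rewrite -lee_fin -lamE; exact: area_le.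
rewrite lamE; move: lam0; rewrite le_eqVlt => /predU1P[<-|lam0].
  by rewrite /xlog eqxx !mule0 adde0.
have d0 : 0 < 100 * k * r ^+ 2 by rewrite mulr_gt0 ?exprn_gt0// mulr_gt0.
rewrite xlog_EFin//; set L := ln _.
have L2 : 2 <= L by exact: log_size_ge2.
have lamL : 0 < lam * L by rewrite mulr_gt0//; clear -L2; lra.
case: (prox r0 _) Q0 NT => [Q| |] // Q0 NT; last first.
  by rewrite addey// gt0_muley ?lte_fin// gt0_mulye ?lte_fin// leey.
rewrite lee_fin in Q0.
apply: (@le_trans _ _ (x%:E * lam%:E + c%:E * (x%:E + Q%:E) * (lam * L)%:E)%E).
  apply: leeD2l; apply: lee_wpmul2r; first by rewrite lee_fin ltW.
  by apply: lee_wpmul2l => //; rewrite lee_fin ltW.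
rewrite -[(x%:E + Q%:E)%E]EFinD -!EFinM -EFinD lee_fin.
have -> : 3 * k / (k - 1) * (x + Q) * (lam * L) =
   k / (k - 1) * ((x + Q) * (lam * L)) + c * (x + Q) * (lam * L).
  by rewrite /c; set ik := (k - 1)^-1; ring.
rewrite lerD2r; have xl0 : 0 <= x * lam by rewrite mulr_ge0// ltW.
apply: (@le_trans _ _ ((x + Q) * (lam * L))).
  have -> : (x + Q) * (lam * L) = x * lam * L + Q * (lam * L) by ring.
  have q0 : 0 <= Q * (lam * L) by rewrite mulr_ge0// ltW.
  have xL : 0 <= x * lam * (L - 2) by rewrite mulr_ge0// subr_ge0.
  by clear -q0 xL xl0; lra.
have kk1 : 1 <= k / (k - 1) by rewrite ler_pdivlMr// mul1r gerBl.
by rewrite ler_peMl// (mulr_ge0 _ (ltW lamL))// addr_ge0.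
Qed.

Lemma prox2_add_recip_le f (r0 r k : R) : entire f -> (exists z, f z <> 0) ->
  0 < r0 -> r0 < r -> 1 < k ->
  (prox2 r (to_sphere f) + prox2 r (recip f) <=
    (5 * k / (k - 1))%:E * (circ_sup (pospart (lnmod f)) (k * r) + prox r0 (recip f)))%E.
Proof.
move=> hf f0 r00 r0r k1; have rp := lt_trans r00 r0r.
have k0 : 0 < k := lt_trans ltr01 k1; have k10 : 0 < k - 1 by rewrite subr_gt0.
have rrho : r < k * r by rewrite ltr_pMl.
have [x [x0 -> hx]] := circ_sup_log hf (lt_trans rp rrho).
have NT := nevT_recip_le hf f0 r00 (lt_trans r0r rrho) hx.
have pf : (prox2 r (to_sphere f) <= x%:E)%E.
  apply: prox2_le_cst => // z zr; rewrite /= lnp_tlog ?cmod_ge0// lee_fin.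
  by apply: hx; exact: le_trans zr (ltW rrho).
have pr := prox2_le (recip_meromorphic hf f0) r00 r0r k1.
have Q0 := prox_ge0 (recip f) r0.
have c0 : 0 <= 4 * k / (k - 1) by rewrite divr_ge0 ?mulr_ge0 ?(ltW k0) ?(ltW k10).
have c5 : 0 < 5 * k / (k - 1) by rewrite divr_gt0// mulr_gt0.
apply: (le_trans (leeD pf (le_trans pr (lee_wpmul2l _ NT)))); first by rewrite lee_fin.
case: (prox r0 _) Q0 => [Q| |] // Q0; last by rewrite addey// [leRHS]gt0_muley ?lte_fin// leey.
rewrite lee_fin in Q0; rewrite -(EFinD x Q) -!EFinM -EFinD lee_fin.
have -> : 5 * k / (k - 1) * (x + Q) = k / (k - 1) * (x + Q) + 4 * k / (k - 1) * (x + Q).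
  by set ik := (k - 1)^-1; ring.
rewrite lerD2r; apply: (@le_trans _ _ (x + Q)); first by rewrite lerDl.
have kk1 : 1 <= k / (k - 1) by rewrite ler_pdivlMr// mul1r gerBl.
by rewrite ler_peMl// addr_ge0.
Qed.

Lemma ln_expR1M (k : R) : 1 < k -> 1 <= ln (expR 1 * k).
Proof.
move=> k1; have k0 : 0 < k := lt_trans ltr01 k1.
by rewrite lnM ?posrE ?expR_gt0// expRK lerDl ln_ge0// ltW.
Qed.

(** Since ln (e k) is at least 1, it may be inserted into the constant. *)
Lemma le_log_const (a c k : R) (X : \bar R) : 1 < k -> 0 <= a -> a <= c -> (0 <= X)%E ->
  ((a * k / (k - 1))%:E * X <= (c * k * ln (expR 1 * k) / (k - 1))%:E * X)%E.
Proof.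
move=> k1 a0 ac X0; have k0 : 0 < k := lt_trans ltr01 k1.
apply: lee_wpmul2r => //; rewrite lee_fin ler_pM2r ?invr_gt0 ?subr_gt0//.
apply: (@le_trans _ _ (c * k)); first by rewrite ler_wpM2r// ltW.
by rewrite ler_peMr ?ln_expR1M// mulr_ge0 ?(ltW k0)// (le_trans a0).
Qed.

Lemma nevT_sub_Npoles_ge0 F (r0 rho : R) : meromorphic F -> 0 < r0 -> r0 < rho ->
  (0 <= nevT rho F - Npoles r0 F)%E.
Proof.
move=> mF r00 r0r; have [S uS SE] := finite_poles rho mF.
rewrite (nevT_sub_Npoles (conj uS SE) r00 r0r) adde_ge0 ?prox_ge0// lee_fin big_seq.
apply: sumr_ge0 => b; rewrite SE => /andP[br _].
rewrite mulr_ge0// subr_ge0 ler_ln ?posrE ?lt_max ?r00//; last exact: lt_trans r0r.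
by rewrite ge_max br (ltW r0r).
Qed.

Lemma xlog_area_ge0 (k r : R) E : 1 < k -> 0 < r -> E `<=` cdisc r -> plane_measurable E ->
  (0 <= xlog (100 * k * r ^+ 2) (area E))%E.
Proof.
move=> k1 r0 hE mE; have [lam lam0 lamE] := area_fin r0 hE mE.
have := area_le r0 hE mE; rewrite lamE lee_fin => lam_le.
move: lam0; rewrite le_eqVlt => /predU1P[<-|lam0]; first by rewrite /xlog eqxx.
have c0 : 0 < 100 * k * r ^+ 2 by rewrite mulr_gt0 ?exprn_gt0// mulr_gt0// (lt_trans ltr01).
rewrite xlog_EFin// lee_fin mulr_ge0 ?(ltW lam0)//.
by apply: le_trans (log_size_ge2 r0 k1 lam0 lam_le); rewrite ler0n.
Qed.

End EntireFunctions.

(** * The four estimates *)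

Theorem corollary3 (R : realType) (r0 r k : R) (E : set R[i])
    (F : R[i] -> option R[i]) (f : R[i] -> R[i])
    (hr0 : 0 < r0) (hr : r0 < r) (hk : 1 < k)
    (hE : E `<=` cdisc r) (mE : plane_measurable E)
    (hF : meromorphic F) (F0 : exists z, F z <> Some 0)
    (hf : entire f) (f0 : exists z, f z <> 0) :
  let u := lnmod f in
  [/\ (plane_integral E (fun z => lnp (smod (F z)))
        <= (2 * k / (k - 1))%:E * (nevT (k * r) F - Npoles r0 F)
           * xlog (100 * k * r ^+ 2) (area E))%E,
      (plane_integral E (fun z => `|u z|)
        <= (3 * k / (k - 1))%:E
           * (lnp (max_mod (k * r) (to_sphere f))
              + prox r0 (inv_sphere (to_sphere f)))
           * xlog (100 * k * r ^+ 2) (area E))%E,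
      (prox2 r F
        <= (7 * k * ln (expR 1 * k) / (k - 1))%:E
           * (nevT (k * r) F - Npoles r0 F))%E &
      (prox2 r (to_sphere f) + prox2 r (inv_sphere (to_sphere f))
        <= (11 * k * ln (expR 1 * k) / (k - 1))%:E
           * (circ_sup (pospart u) (k * r) + circ_mean (negpart u) r0))%E ].
Proof.
have rkr : r < k * r by rewrite ltr_pMl// (lt_trans hr0).
have r0kr : r0 < k * r := lt_trans hr rkr.
have rp : 0 < r := lt_trans hr0 hr.
have negE : circ_mean (negpart (lnmod f)) r0 = prox r0 (recip f).
  by rewrite /prox; congr circ_mean; apply/funext => z; rewrite lnp_recip.
have [x [x0 xE _]] := circ_sup_log hf (lt_trans rp rkr).
have Q0 := prox_ge0 (recip f) r0.
move=> u; split.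
- have := plane_integral_log_le hF hr0 hr hk (lexx 0) hE mE.
  by rewrite mul0e add0e; under [X in plane_integral E X]eq_fun do rewrite add0e.
- apply: (le_trans (plane_integral_abs_log_le hf f0 hr0 hr hk hE mE)).
  apply: lee_wpmul2r; first exact: (xlog_area_ge0 hk rp hE mE).
  apply: lee_wpmul2l; first by rewrite lee_fin divr_ge0 ?mulr_ge0 ?subr_ge0// ltW// (lt_trans ltr01).
  by rewrite leeD2r// circ_sup_le_max_mod.
- apply: (le_trans (prox2_le hF hr0 hr hk)); apply: le_log_const => //.
    by rewrite ler_nat.
  exact: nevT_sub_Npoles_ge0.
- apply: (le_trans (prox2_add_recip_le hf f0 hr0 hr hk)); rewrite negE.
  apply: le_log_const => //; first by rewrite ler_nat.
  by rewrite adde_ge0// xE lee_fin.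
Qed.
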